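(* Let $F$ be a number field, let $p$ be a prime number, and let $K/F$, $L/F$ be extensions of degree $p$ which are locally GCD equivalent over $F$. Suppose that the Galois groups of their Galois closures $\widehat{K}/F$ and $\widehat{L}/F$ are the same group $G$, where $G$ is either the alternating group $A_p$ or the symmetric group $S_p$ (acting on the $p$ embeddings). Then $K$ and $L$ are $F$-isomorphic.
   Context: For a finite extension $M/F$ and a prime $\mathfrak{p}\subset\mathcal{O}_F$ unramified in $M$, the splitting type $f_M(\mathfrak{p})$ is the sorted tuple of inertia degrees of the primes of $\mathcal{O}_M$ above $\mathfrak{p}$. Two finite extensions $K/F$, $L/F$ are locally GCD equivalent over $F$ if for every prime $\mathfrak{p}\subset\mathcal{O}_F$ unramified in both, the gcd of the entries of $f_K(\mathfrak{p})$ equals the gcd of the entries of $f_L(\mathfrak{p})$. *)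

(* Defs.v *)
From HB Require Import structures.
From mathcomp Require Import all_boot all_order all_algebra all_fingroup all_solvable all_field.
Set Implicit Arguments. Unset Strict Implicit. Unset Printing Implicit Defensive.
Import GRing.Theory.
Local Open Scope ring_scope.

(* Everything happens inside an ambient number field E, normal over Q
   (a splittingFieldType rat); F, K, L are subfields of E. *)
Section NT.
Variable E : splittingFieldType rat.

Definition is_alg_int (x : E) : Prop :=
  exists q : {poly int}, q \is monic /\ root (map_poly (fun z : int => z%:~R : E) q) x.

Definition Oint (M : {subfield E}) (x : E) : Prop := x \in M /\ is_alg_int x.

Definition prime_ideal (M : {subfield E}) (P : E -> Prop) : Prop :=
  (forall x, P x -> Oint M x) /\
  P 0 /\
  (forall x y, P x -> P y -> P (x + y)) /\
  (forall a x, Oint M a -> P x -> P (a * x)) /\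
  ~ P 1 /\
  (forall x y, Oint M x -> Oint M y -> P (x * y) -> P x \/ P y) /\
  (exists x, P x /\ x != 0).

Definition lies_over (F : {subfield E}) (P p : E -> Prop) : Prop :=
  forall x, Oint F x -> (P x <-> p x).

(* the family v of elements of O_M is linearly independent modulo P
   over the residue field O_F/p *)
Definition indep_mod (M F : {subfield E}) (P p : E -> Prop) (n : nat)
    (v : 'I_n -> E) : Prop :=
  (forall i, Oint M (v i)) /\
  forall c : 'I_n -> E, (forall i, Oint F (c i)) ->
    P (\sum_(i < n) c i * v i) -> forall i, p (c i).

(* inertia degree f(P|p) = dim_{O_F/p} (O_M/P) = f *)
Definition inertia_deg (M F : {subfield E}) (P p : E -> Prop) (f : nat) : Prop :=
  (exists v : 'I_f -> E, indep_mod M F P p v) /\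
  (forall n (v : 'I_n -> E), indep_mod M F P p v -> (n <= f)%N).

Definition in_sq (P : E -> Prop) (x : E) : Prop :=
  exists n (a b : 'I_n -> E), (forall i, P (a i) /\ P (b i)) /\
    x = \sum_(i < n) a i * b i.

(* p is unramified in M: every prime P of O_M above p has e(P|p) = 1,
   i.e. p O_M is not contained in P^2 *)
Definition unramified (M F : {subfield E}) (p : E -> Prop) : Prop :=
  forall P, prime_ideal M P -> lies_over F P p -> exists x, p x /\ ~ in_sq P x.

Definition in_splitting_type (M F : {subfield E}) (p : E -> Prop) (f : nat) : Prop :=
  exists P, [/\ prime_ideal M P, lies_over F P p & inertia_deg M F P p f].

Definition is_gcd_of (S : nat -> Prop) (g : nat) : Prop :=
  (forall x, S x -> (g %| x)%N) /\
  (forall d, (forall x, S x -> (d %| x)%N) -> (d %| g)%N).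

Definition locally_gcd_equivalent (F K L : {subfield E}) : Prop :=
  forall p, prime_ideal F p -> unramified K F p -> unramified L F p ->
    forall g, is_gcd_of (in_splitting_type K F p) g <->
              is_gcd_of (in_splitting_type L F p) g.

Definition enumerates_embeddings (F K : {subfield E}) (n : nat)
    (phi : 'I_n -> 'End(E)) : Prop :=
  [/\ (forall i, kHom F K (phi i)),
      (forall i j, i != j -> exists2 x, x \in K & phi i x != phi j x)
    & (forall f, kHom F K f -> exists i, forall x, x \in K -> f x = phi i x)].

(* the permutation group induced on the n embeddings of K (enumerated by phi)
   by Gal(E/F), i.e. Gal(\hat K / F) acting on the embeddings, is G *)
Definition galois_closure_group (F K : {subfield E}) (n : nat)
    (phi : 'I_n -> 'End(E)) (G : {set {perm 'I_n}}) : Prop :=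
  forall s : {perm 'I_n},
    s \in G <-> exists2 g, g \in 'Gal({:E} / F)%g &
                 forall i x, x \in K -> g (phi i x) = phi (s i) x.

Definition F_isomorphic (F K L : {subfield E}) : Prop :=
  exists f : 'End(E), kHom F K f /\ (f @: K)%VS = L.

End NT.

(* Main.v *)
Require Import Defs.
From HB Require Import structures.
From mathcomp Require Import all_boot all_order all_algebra all_fingroup all_solvable all_field.
From mathcomp Require Import boolp reals exp Rstruct ring lra zify.
Set Implicit Arguments. Unset Strict Implicit. Unset Printing Implicit Defensive.
Import Order.TTheory GRing.Theory Num.Theory.
Local Open Scope ring_scope.

(** Write Gam = Gal(E/Q) and let H_L = Gal(E/L) act on the p embeddings of K.

    If H_L is transitive, Cauchy's theorem gives ga in H_L acting as a p-cycle.
    A weak form of the Frobenius density theorem provides a prime l, outside any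
    finite set, with a Frobenius element ga ^ j, p not dividing j.  The prime of F
    below is then inert in K (gcd p), but has a prime of degree one above it in L
    (gcd 1): contradiction.  So H_L has an orbit X with 0 < #|X| < p.  Its translates
    under the group G correspond to cosets of H_L in Gal(E/F), so there are at most p
    of them; but G contains Alt_p, so every set of size #|X| is a translate and
    'C(p, #|X|) <= p.  Hence #|X| = 1 or p - 1, H_L fixes some embedding of K, and the
    image of that embedding is L.

    The density statement needs neither zeta functions nor units.  For H <= Gam let
    R_H(l) be the number of g in Gam such that g Frob_l g^-1 is in H.
    - Upper bound: in a box of n elements of an order of E^H, the pigeonhole principle
      forces n^2 / l coincidences modulo each degree one prime above l, so the norm of
      the Vandermonde product of the box is divisible by a large power of l.  Comparing
      with its trivial size gives  sum_(l <= n) R_H(l) ln l / l <= #|H| ln n + O(1).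
    - Lower bound: the elements of the box are equidistributed modulo these primes, and
      counting the prime factors of their norms gives the reverse inequality, up to a
      factor 4/3 and O(1).
    If no Frobenius element were conjugate to some ga ^ j with p not dividing j, then
    R_H = R_H1 for H = <ga> and H1 = <ga ^ p>, while #|H| = p #|H1| >= 2 #|H1|:
    contradiction. *)

(** * Algebraic integers and the Galois action *)

(** A weak density statement is enough because [ga ^+ j] with p not dividing j is still a p-cycle on
    the embeddings and still lies in H_L. In the final comparison the boxes for H and H1 have the
    same cardinality n, and the losses multiply: 4/3 in the lower bound, 5/4 in the upper one from
    the pairs of equal elements, so that 5/3 < 2 <= p decides. The delicate primes are those of size
    comparable to n, where the box is too small to be equidistributed: a count up to a constant
    factor replaces the sharp one, and by Chebyshev's estimate a range of bounded ratio contributes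
    only O(1). A place of E is represented by a residue map into a field; conjugating the place by g
    replaces the sum over primes above l by a sum over Gam, in which each prime of E^H of degree one
    occurs #|H| times. *)

Section Integers.
Variable E : splittingFieldType rat.
Implicit Types (x y : E) (g h : gal_of {:E}).

Lemma alg_intP x : is_alg_int x <-> integralOver (intr : int -> E) x.
Proof. by split=> [[q [qm qx]]|[q qm qx]]; exists q. Qed.

Lemma alg_int_int (z : int) : is_alg_int (z%:~R : E).
Proof. apply/alg_intP; exact: integral_id. Qed.

Lemma alg_int0 : is_alg_int (0 : E).
Proof. exact: (alg_int_int 0). Qed.

Lemma alg_int1 : is_alg_int (1 : E).
Proof. exact: (alg_int_int 1). Qed.

Lemma alg_int_nat (n : nat) : is_alg_int (n%:R : E).
Proof. exact: (alg_int_int n). Qed.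

Lemma alg_intD x y : is_alg_int x -> is_alg_int y -> is_alg_int (x + y).
Proof. by move=> /alg_intP hx /alg_intP hy; apply/alg_intP; apply: integral_add. Qed.

Lemma alg_intN x : is_alg_int x -> is_alg_int (- x).
Proof. by move=> /alg_intP hx; apply/alg_intP; apply: integral_opp. Qed.

Lemma alg_intB x y : is_alg_int x -> is_alg_int y -> is_alg_int (x - y).
Proof. by move=> hx hy; apply/alg_intD/alg_intN. Qed.

Lemma alg_intM x y : is_alg_int x -> is_alg_int y -> is_alg_int (x * y).
Proof. by move=> /alg_intP hx /alg_intP hy; apply/alg_intP; apply: integral_mul. Qed.

Lemma alg_intX x n : is_alg_int x -> is_alg_int (x ^+ n).
Proof.
by move=> hx; elim: n => [|n IH]; [exact: alg_int1|rewrite exprS; apply: alg_intM].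
Qed.

Lemma alg_int_sum (I : Type) (r : seq I) (P : pred I) (F : I -> E) :
  (forall i, is_alg_int (F i)) -> is_alg_int (\sum_(i <- r | P i) F i).
Proof.
by move=> hF; apply: (big_ind _ alg_int0 alg_intD) => i _.
Qed.

Lemma alg_int_prod (I : Type) (r : seq I) (P : pred I) (F : I -> E) :
  (forall i, is_alg_int (F i)) -> is_alg_int (\prod_(i <- r | P i) F i).
Proof.
by move=> hF; apply: (big_ind _ alg_int1 alg_intM) => i _.
Qed.

Lemma alg_int_gal g x : is_alg_int x -> is_alg_int (g x).
Proof.
case=> q [qm qx]; exists q; split=> //.
have -> : map_poly (fun z : int => z%:~R : E) q
        = map_poly g (map_poly (fun z : int => z%:~R : E) q).
  by rewrite -map_poly_comp; apply: eq_map_poly => z /=; rewrite rmorph_int.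
exact: (rmorph_root g).
Qed.

Lemma alg_int_horner (p : {poly int}) x : is_alg_int x ->
  is_alg_int (map_poly intr p).[x].
Proof.
move=> hx; rewrite horner_coef; apply: alg_int_sum => i.
by rewrite coef_map; apply: alg_intM; [exact: alg_int_int|exact: alg_intX].
Qed.

Lemma galMf g h x : (g * h)%g x = h (g x).
Proof. by rewrite galM ?memvf. Qed.

Lemma galVK g x : (g^-1)%g (g x) = x.
Proof. by rewrite -galMf mulgV gal_id. Qed.

Lemma galKV g x : g ((g^-1)%g x) = x.
Proof. by rewrite -galMf mulVg gal_id. Qed.

Lemma gal_inj g : injective (g : E -> E).
Proof. exact: can_inj (galVK g). Qed.

Lemma gal_eq0 g x : (g x == 0) = (x == 0).
Proof. by rewrite fmorph_eq0. Qed.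

Lemma char0_E : has_char0 E.
Proof.
apply/pcharf0P=> n; rewrite -scaler_nat scaler_eq0 oner_eq0 orbF.
by rewrite pnatr_eq0.
Qed.

Lemma intrE_inj : injective (intr : int -> E).
Proof.
move=> a b; rewrite -!(rmorph_int (in_alg E)) => /fmorph_inj.
exact: (intr_inj (R := rat)).
Qed.

Lemma natrE_eq0 n : (n%:R == 0 :> E) = (n == 0)%N.
Proof. by move/pcharf0P: char0_E => ->. Qed.

Lemma galois1f (M : {subfield E}) : galois M {:E}.
Proof.
rewrite /galois subvf normalFieldf andbT /=.
by apply/separableP => y _; apply: pcharf0_separable char0_E _.
Qed.

Lemma gal_fixed_rat x : (forall g, g x = x) -> exists q : rat, x = q%:A.
Proof.
move=> hx; apply/vlineP.
have /galois_fixedField <- := galois1f 1%AS.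
by apply/(fixedFieldP (memvf x)) => g _; apply: hx.
Qed.

Lemma rat_alg_int (q : rat) : is_alg_int (q%:A : E) -> exists z : int, q = z%:~R.
Proof.
case=> p [pm pq].
have : root (map_poly intr p) q.
  rewrite -(fmorph_root (in_alg E)) -map_poly_comp.
  rewrite (@eq_map_poly _ _ _ (fun z : int => z%:~R : E)) //; last first.
    by move=> z; rewrite -[RHS](rmorph_int (in_alg E)).
rewrite -(fmorph_root (@ratr algC)) => rq.
have : ratr q \is a @Num.int algC.
  apply: Cint_rat_Aint; first exact: Crat_rat.
  apply: root_monic_Aint rq _ _; first by do 2![apply: monic_map].
  by apply/polyOverP => i; rewrite !coef_map /= ratr_int.
by rewrite Cint_rat => /intrP[z ->]; exists z.
Qed.

Lemma gal_fixed_int x : is_alg_int x -> (forall g, g x = x) ->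
  exists z : int, x = z%:~R.
Proof.
move=> hx /gal_fixed_rat[q qE].
have [z zE] : exists z : int, q = z%:~R by apply: rat_alg_int; rewrite -qE.
by exists z; rewrite qE zE -(rmorph_int (in_alg E)).
Qed.

Lemma rat_int_alg (z : int) (n : nat) x : is_alg_int x -> (0 < n)%N ->
  z%:~R = n%:R * x -> exists y : int, z = n%:Z * y /\ x = y%:~R.
Proof.
move=> hx n0 zE.
have n0E : (n%:R : E) != 0 by rewrite natrE_eq0 -lt0n.
have [y yE] : exists y : int, x = y%:~R.
  apply: gal_fixed_int => // g; apply: (mulfI n0E).
  by rewrite -zE -{1}(rmorph_nat g) -rmorphM -zE rmorph_int.
exists y; split=> //; apply: intrE_inj; rewrite zE yE intrM.
by congr (_ * _).
Qed.

Lemma alg_int_scale x : exists2 c : nat, (0 < c)%N & is_alg_int (c%:R * x).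
Proof.
have [p pm px] : exists2 p : {poly rat}, p \is monic & root (map_poly (in_alg E) p) x.
  have /polyOver1P[p pE] := minPolyOver 1 x; exists p.
    by rewrite -(map_monic (in_alg E)) -pE monic_minPoly.
  by rewrite -pE root_minPoly.
have [q [a a0 pq]] := rat_poly_scale p.
pose n := (size p).-1.
have sp : size p = n.+1.
  by rewrite prednK // size_poly_gt0 monic_neq0.
have qi i : (q`_i)%:~R = a%:~R * p`_i :> rat.
  by rewrite pq coefZ coef_map mulrA mulfV ?mul1r // intr_eq0.
suff ha : is_alg_int (a%:~R * x : E).
  exists `|a|%N; first by rewrite absz_gt0.
  have [aE|aE] : a = `|a|%N :> int \/ - a = `|a|%N :> int.
    by rewrite abszE; case: (ger0P a) => _; [left|right].
    by have -> : (`|a|%N%:R : E) = a%:~R by rewrite [in RHS]aE.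
  have -> : (`|a|%N%:R : E) = - a%:~R by rewrite -mulrNz aE.
  by rewrite mulNr; apply: alg_intN.
(* Multiplying the equation of x by a^n turns its term of degree i into (a p_i) a^(n-1-i) (a x)^i,
   and a p_i is the integer q_i. *)
pose r : {poly int} := 'X^n + \poly_(i < n) (q`_i * a ^+ (n - i.+1)).
exists r; split.
  by rewrite monicE lead_coefDl ?lead_coefXn // size_polyXn ltnS size_poly.
have pxE : (map_poly (in_alg E) p).[x] = \sum_(i < n.+1) (p`_i)%:A * x ^+ i.
  rewrite (@horner_coef_wide _ n.+1) ?size_map_poly ?sp //.
  by apply: eq_bigr => i _; rewrite coef_map.
move/rootP: px; rewrite pxE big_ord_recr /= => px.
have pn : p`_n = 1 by move/monicP: pm; rewrite lead_coefE -/n.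
rewrite pn scale1r mul1r in px.
apply/rootP; rewrite rmorphD /= map_polyXn hornerD hornerXn exprMn.
rewrite (@horner_coef_wide _ n); last first.
  by apply: leq_trans (size_poly _ _) _; rewrite ?size_poly //; apply: size_poly.
have -> : x ^+ n = - \sum_(i < n) (p`_i)%:A * x ^+ i.
  by apply/eqP; rewrite -addr_eq0 addrC px.
apply/eqP; rewrite mulrN addrC subr_eq0 mulr_sumr; apply/eqP/eq_bigr => i _.
rewrite coef_map coef_poly ltn_ord /= intrM.
have -> : ((q`_i)%:~R : E) = a%:~R * (p`_i)%:A.
  by rewrite -!(rmorph_int (in_alg E)) -(rmorphM (in_alg E)) /= -qi.
rewrite exprMn rmorphXn /=.
have -> : (a%:~R : E) ^+ n = a%:~R * a%:~R ^+ (n - i.+1) * a%:~R ^+ i.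
  by rewrite -exprS -exprD -subSn // subSS subnK // ltnW.
rewrite -!mulrA; congr (_ * _); rewrite mulrCA; congr (_ * _).
by rewrite mulrCA.
Qed.

(** An integral primitive element of the fixed field of [H], recorded by its stabilizer so that
    later arguments can work with cosets. *)
Lemma stabilizer_generator (H : {group gal_of {:E}}) :
  exists2 b : E, is_alg_int b & forall g, (g b == b) = (g \in H).
Proof.
pose M := [aspace of fixedField H].
have sepM : separable 1 M.
  by apply/separableP => y _; apply: pcharf0_separable char0_E _.
have ME := eq_adjoin_separable_generator sepM (sub1v _).
set b0 := separable_generator _ _ in ME.
have [c c0 cb] := alg_int_scale b0.
exists (c%:R * b0) => // g.
have -> : (g (c%:R * b0) == c%:R * b0) = (g b0 == b0).
  by rewrite rmorphM rmorph_nat (inj_eq (mulfI _)) // natrE_eq0 -lt0n.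
apply/eqP/idP => [gb|gH]; last first.
  have : b0 \in M by rewrite ME memv_adjoin.
  by case/mem_fixedFieldP => _; apply.
rewrite -(gal_fixedField H) gal_kHom ?subvf //.
apply/kAHomP => y yM.
have : y \in <<1; b0>>%VS by rewrite -ME.
case/Fadjoin_polyP => p /polyOver1P[q ->] ->.
rewrite -horner_map /= gb; congr (_.[_]).
by rewrite -map_poly_comp; apply: eq_map_poly => z /=; rewrite linearZ rmorph1.
Qed.

Definition Nm x : E := \prod_(g : gal_of {:E}) g x.

Lemma NmM : {morph Nm : x y / x * y}.
Proof. by move=> x y; rewrite /Nm -big_split; apply: eq_bigr => g _; rewrite rmorphM. Qed.

Lemma Nm_eq0 x : (Nm x == 0) = (x == 0).
Proof.
apply/prodf_eq0/eqP => [[g _]|->]; first by rewrite gal_eq0 => /eqP.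
by exists 1%g; rewrite // rmorph0.
Qed.

Lemma gal_Nm g x : g (Nm x) = Nm x.
Proof.
rewrite rmorph_prod [RHS](reindex_inj (mulIg g)) /=.
by apply: eq_bigr => h _; rewrite galMf.
Qed.

Lemma Nm_int x : is_alg_int x -> exists z : int, Nm x = z%:~R.
Proof.
move=> hx; apply: gal_fixed_int => [|g]; last exact: gal_Nm.
by apply: alg_int_prod => g; apply: alg_int_gal.
Qed.

Definition Trc x : E := \sum_(g : gal_of {:E}) g x.

Lemma gal_Trc g x : g (Trc x) = Trc x.
Proof.
rewrite rmorph_sum [RHS](reindex_inj (mulIg g)) /=.
by apply: eq_bigr => h _; rewrite galMf.
Qed.

Lemma Trc_int x : is_alg_int x -> exists z : int, Trc x = z%:~R.
Proof.
move=> hx; apply: gal_fixed_int => [|g]; last exact: gal_Trc.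
by apply: alg_int_sum => g; apply: alg_int_gal.
Qed.

End Integers.

(** * The order generated by an integral primitive element *)

Section IntegralOrder.
Variable E : splittingFieldType rat.
Implicit Types (x y : E) (g h : gal_of {:E}).

Lemma poly_int_lift (p : {poly E}) : (forall i, exists z : int, p`_i = z%:~R) ->
  exists P : {poly int}, map_poly intr P = p.
Proof.
move=> hp.
have [z zE] := @fin_all_exists _ (fun _ => int) (fun (i : 'I_(size p)) z => p`_i = z%:~R) (fun i => hp i).
exists (\poly_(i < size p) (if insub i is Some j then z j else 0)).
apply/polyP => i; rewrite coef_map coef_poly.
case: ltnP => [lt|le]; first by have := zE (Ordinal lt); rewrite insubT /= => ->.
by rewrite /= nth_default.
Qed.

Lemma alg_int_coef_prod (I : eqType) (r : seq I) (P : pred I) (F : I -> E) :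
  (forall i, is_alg_int (F i)) ->
  forall n, is_alg_int (\prod_(i <- r | P i) ('X - (F i)%:P))`_n.
Proof.
move=> hF; apply: (big_ind (fun p : {poly E} => forall n, is_alg_int p`_n)).
- by move=> n; rewrite coef1; apply: alg_int_nat.
- by move=> p q hp hq n; rewrite coefM; apply: alg_int_sum => j; apply: alg_intM.
move=> i _ n; rewrite coefB coefX coefC.
by apply: alg_intB; [apply: alg_int_nat|case: ifP => _; [apply: hF|apply: alg_int0]].
Qed.

Lemma orbit_poly_int x : is_alg_int x ->
  exists2 F : {poly int}, F \is monic &
    map_poly intr F = \prod_(g : gal_of {:E}) ('X - (g x)%:P).
Proof.
move=> hx; pose f := \prod_(g : gal_of {:E}) ('X - (g x)%:P).
have [F FE] : exists F : {poly int}, map_poly intr F = f.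
  apply: poly_int_lift => i; apply: gal_fixed_int => [|g].
    by apply: alg_int_coef_prod => g; apply: alg_int_gal.
  rewrite -coef_map; suff -> : map_poly g f = f by [].
  rewrite rmorph_prod /f [RHS](reindex_inj (mulIg g)) /=.
  by apply: eq_bigr => h _; rewrite rmorphB /= map_polyX map_polyC /= galMf.
exists F => //; rewrite monicE; apply/eqP.
apply: (@intrE_inj E); rewrite -(lead_coef_map_inj (@intrE_inj E)) // FE.
by apply/monicP; apply: monic_prod_XsubC.
Qed.

Section PrimitiveElement.
Variable th : E.
Hypothesis th_int : is_alg_int th.
Hypothesis th_gen : forall g, g th = th -> g = 1%g.

Let q1 : {poly E} := \prod_(h : gal_of {:E} | h != 1%g) ('X - (h th)%:P).
Let dl := q1.[th].

(* Euler's dual basis formula: [dl] is the derivative at [th] of the minimal polynomial of [th]. *)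
Lemma dual_expansion y : y * dl = \sum_(i < size q1) Trc (y * q1`_i) * th ^+ i.
Proof.
transitivity (\sum_(g : gal_of {:E}) g y * (map_poly g q1).[th]).
  rewrite (bigD1 1%g) //= gal_id big1 ?addr0 => [|g g1].
    by congr (_ * _.[_]); rewrite [RHS]map_poly_id // => z _; rewrite gal_id.
  rewrite /q1 rmorph_prod horner_prod (bigD1 g^-1%g) ?mulr0 //; last by rewrite invg_eq1.
  rewrite /= rmorphB /= map_polyX map_polyC /= hornerXsubC galKV subrr.
  by rewrite mul0r mulr0.
rewrite [RHS](eq_bigr (fun i : 'I_(size q1) => \sum_(g : gal_of {:E}) g y * (g q1`_i * th ^+ i))); last first.
  by move=> i _; rewrite mulr_suml; apply: eq_bigr => g _; rewrite rmorphM /= mulrA.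
rewrite exchange_big /=; apply: eq_bigr => g _.
rewrite -mulr_sumr; congr (_ * _).
rewrite (@horner_coef_wide _ (size q1)) ?size_map_poly //.
by apply: eq_bigr => i _; rewrite coef_map.
Qed.

Lemma dl_neq0 : dl != 0.
Proof.
rewrite /dl horner_prod; apply/prodf_neq0 => g g1.
rewrite hornerXsubC subr_eq0; apply: contra g1 => /eqP/esym/th_gen->.
by [].
Qed.

Lemma dl_int : is_alg_int dl.
Proof.
rewrite /dl horner_prod; apply: alg_int_prod => g; rewrite hornerXsubC.
by apply: alg_intB => //; apply: alg_int_gal.
Qed.

(** By Euler's formula the coefficients of [y * dl] are traces, so divisibility of traces becomes
    divisibility of elements. It serves with m = 1 to put [dl] times O_E inside Z[th], and with m =
    l to detect elements divisible by l up to a constant. *)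
Lemma dual_poly (m : int) y :
  (forall z, is_alg_int z -> exists t : int, Trc (y * z) = (m * t)%:~R) ->
  exists A : {poly int}, y * dl = m%:~R * (map_poly intr A).[th].
Proof.
move=> hy.
have hq i : is_alg_int q1`_i.
  by apply: alg_int_coef_prod => g; apply: alg_int_gal.
have [t tE] := @fin_all_exists _ (fun _ => int) (fun (i : 'I_(size q1)) t => Trc (y * q1`_i) = (m * t)%:~R)
  (fun i => hy _ (hq i)).
exists (\poly_(i < size q1) (if insub i is Some j then t j else 0)).
rewrite dual_expansion (@horner_coef_wide _ (size q1)); last first.
  by apply: leq_trans (size_poly _ _) _; rewrite ?size_poly //; apply: size_poly.
rewrite mulr_sumr; apply: eq_bigr => i _.
rewrite coef_map coef_poly ltn_ord insubT ?ltn_ord //= => lti.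
have -> : Sub (i : nat) lti = i by apply: val_inj.
by rewrite tE intrM mulrA.
Qed.

Lemma order_exists : exists disc : nat, [/\ (0 < disc)%N,
  forall x, is_alg_int x -> exists A : {poly int},
    (disc ^ 2)%:R * x = (map_poly intr A).[th] &
  forall (l : nat) y, (forall z, is_alg_int z -> exists t : int, Trc (y * z) = (l%:Z * t)%:~R) ->
    exists2 w, is_alg_int w & disc%:R * y = l%:R * w].
Proof.
have [D0 DE] := Nm_int dl_int.
have D00 : D0 != 0 by rewrite -(inj_eq (@intrE_inj E)) -DE Nm_eq0 dl_neq0.
(* The product of the other conjugates, with a sign that makes [dl * d'] the positive integer |Nm
   dl|. *)
pose d' : E := (\prod_(g : gal_of {:E} | g != 1%g) g dl) * (-1) ^+ (D0 < 0)%R.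
have d'_int : is_alg_int d'.
  apply: alg_intM; first by apply: alg_int_prod => g; apply: alg_int_gal dl_int.
  by apply/alg_intX/alg_intN/alg_int1.
have ddE : dl * d' = `|D0|%N%:R.
  transitivity (`|D0|%:~R : E); last by rewrite -abszE.
  rewrite /d' mulrA; have -> : dl * \prod_(g : gal_of {:E} | g != 1%g) g dl = Nm dl.
    by rewrite /Nm [RHS](bigD1 1%g) //= gal_id.
  rewrite DE; case: (ltrP D0 0) => h; first by rewrite ltr0_norm // expr1 mulrN1 mulrNz.
  by rewrite ger0_norm // expr0 mulr1.
exists `|D0|%N; split; first by rewrite absz_gt0.
- have int1 y : is_alg_int y -> exists A : {poly int}, y * dl = (map_poly intr A).[th].
    move=> hy; have [|A AE] := @dual_poly 1 y; last by exists A; rewrite AE mul1r.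
    by move=> z hz; have [t tE] := Trc_int (alg_intM hy hz); exists t; rewrite mul1r.
  (* Since [d'] need not lie in Z[th], [int1] is applied to [x] and to [d' ^+ 2]; the product (x
     dl)(d'^2 dl) = x (dl d')^2 is the origin of the square. *)
  move=> x hx; have [A AE] := int1 _ hx.
  have [A' A'E] := int1 _ (alg_intX 2 d'_int).
  exists (A * A'); rewrite (rmorphM (map_poly intr)) /= hornerM -AE -A'E natrX -ddE.
  by rewrite expr2; ring.
move=> l y hy; have [A AE] := dual_poly hy.
exists ((map_poly intr A).[th] * d').
  by apply: alg_intM => //; apply: alg_int_horner.
by rewrite mulrA -[l%:R]/(l%:Z%:~R) -AE -ddE; ring.
Qed.

End PrimitiveElement.

(** A polynomial with integer coefficients vanishing at x also vanishes at its conjugates g x, and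
    [H] supplies [#|H|] distinct ones. *)
Lemma small_poly_root (P : {poly int}) x (H : {set gal_of {:E}}) :
  {in H &, forall g h, g x = h x -> g = h} ->
  (size P <= #|H|)%N -> (map_poly intr P).[x] = 0 -> P = 0.
Proof.
move=> inj sP Px; pose rs := [seq (g : gal_of {:E}) x | g in H].
apply/eqP; apply: contraT => P0.
have PE0 : map_poly (intr : int -> E) P != 0.
  rewrite -size_poly_eq0 size_map_inj_poly ?size_poly_eq0 //; exact: intrE_inj.
suff : (size rs < size (map_poly (intr : int -> E) P))%N.
  by rewrite size_image (size_map_inj_poly (@intrE_inj E)) // ltnNge sP.
apply: max_poly_roots PE0 _ _.
  apply/allP => _ /imageP[g _ ->]; apply/rootP.
  have -> : map_poly (intr : int -> E) P = map_poly g (map_poly intr P).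
    by rewrite -map_poly_comp; apply: eq_map_poly => z /=; rewrite rmorph_int.
  by rewrite horner_map Px rmorph0.
rewrite map_inj_in_uniq ?enum_uniq // => g h; rewrite !mem_enum; exact: inj.
Qed.

End IntegralOrder.

(** * Residue maps and Frobenius elements *)

Section Places.
Variable E : splittingFieldType rat.
Implicit Types (x y : E) (g h : gal_of {:E}).

(* [rho] induces an embedding of O_E / P into [k] for a prime P above [l]; its values outside
   the algebraic integers are irrelevant. *)
Definition is_residue_map (l : nat) (k : fieldType) (rho : E -> k) : Prop :=
  [/\ l \in [pchar k], rho 1 = 1,
      forall x y, is_alg_int x -> is_alg_int y -> rho (x + y) = rho x + rho y &
      forall x y, is_alg_int x -> is_alg_int y -> rho (x * y) = rho x * rho y].

Definition is_frobenius (l : nat) (k : fieldType) (rho : E -> k) (s : gal_of {:E}) : Prop :=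
  forall x, is_alg_int x -> rho (s x) = rho x ^+ l.

(* Equivalent to O_E / l being reduced, i.e. to [l] being unramified in E. *)
Definition power_congruent (l : nat) : Prop :=
  forall x, is_alg_int x ->
    exists2 y, is_alg_int y & x ^+ (l ^ #|{: gal_of {:E}}|)%N - x = l%:R * y.

Section ResidueMap.
Variables (l : nat) (k : fieldType) (rho : E -> k).
Hypothesis rhoP : is_residue_map l rho.

Lemma residue_prime : prime l.
Proof. by have [lk _ _ _] := rhoP; apply: pcharf_prime lk. Qed.

Lemma residueD x y : is_alg_int x -> is_alg_int y -> rho (x + y) = rho x + rho y.
Proof. by have [_ _ rD _] := rhoP; apply: rD. Qed.

Lemma residueM x y : is_alg_int x -> is_alg_int y -> rho (x * y) = rho x * rho y.
Proof. by have [_ _ _ rM] := rhoP; apply: rM. Qed.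

Lemma residue1 : rho 1 = 1.
Proof. by have [] := rhoP. Qed.

Lemma residue0 : rho 0 = 0.
Proof.
have := residueD (alg_int0 E) (alg_int0 E).
by rewrite addr0 => /esym/eqP; rewrite -subr_eq0 addrK => /eqP.
Qed.

Lemma residueN x : is_alg_int x -> rho (- x) = - rho x.
Proof.
move=> hx; apply/eqP; rewrite -addr_eq0 -residueD ?addNr ?residue0 //.
exact: alg_intN.
Qed.

Lemma residueB x y : is_alg_int x -> is_alg_int y -> rho (x - y) = rho x - rho y.
Proof. by move=> hx hy; rewrite residueD ?residueN //; apply: alg_intN. Qed.

Lemma residueX x n : is_alg_int x -> rho (x ^+ n) = rho x ^+ n.
Proof.
move=> hx; elim: n => [|n IH]; first by rewrite residue1.
by rewrite !exprS residueM ?IH //; apply: alg_intX.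
Qed.

Lemma residue_sum (I : Type) (r : seq I) (P : pred I) (F : I -> E) :
  (forall i, is_alg_int (F i)) ->
  rho (\sum_(i <- r | P i) F i) = \sum_(i <- r | P i) rho (F i).
Proof.
move=> hF; elim: r => [|i r IH]; first by rewrite !big_nil residue0.
rewrite !big_cons; case: ifP => // _.
by rewrite residueD ?IH //; apply: alg_int_sum.
Qed.

Lemma residue_prod (I : Type) (r : seq I) (P : pred I) (F : I -> E) :
  (forall i, is_alg_int (F i)) ->
  rho (\prod_(i <- r | P i) F i) = \prod_(i <- r | P i) rho (F i).
Proof.
move=> hF; elim: r => [|i r IH]; first by rewrite !big_nil residue1.
rewrite !big_cons; case: ifP => // _.
by rewrite residueM ?IH //; apply: alg_int_prod.
Qed.

Lemma residue_nat n : rho n%:R = n%:R.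
Proof.
elim: n => [|n IH]; first exact: residue0.
by rewrite !mulrS residueD ?residue1 ?IH //; [apply: alg_int1|apply: alg_int_nat].
Qed.

Lemma residue_int (z : int) : rho z%:~R = z%:~R.
Proof.
case: z => n; first exact: residue_nat.
rewrite NegzE !mulrNz residueN; last exact: alg_int_int.
by congr (- _); exact: residue_nat.
Qed.

Lemma residue_nat_eq0 n : (rho n%:R == 0) = (l %| n)%N.
Proof. by case: rhoP => lk _ _ _; rewrite residue_nat (dvdn_pcharf lk). Qed.

Lemma residue_int_eq0 (z : int) : (rho z%:~R == 0) = (l %| `|z|)%N.
Proof.
rewrite -residue_nat_eq0; case: z => n //.
rewrite NegzE mulrNz residueN ?oppr_eq0 //; exact: alg_int_int.
Qed.

Lemma residue_galM g x y : is_alg_int x -> is_alg_int y ->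
  rho (g (x * y)) = rho (g x) * rho (g y).
Proof. by move=> hx hy; rewrite rmorphM residueM //; apply: alg_int_gal. Qed.

Lemma residue_map_gal g : is_residue_map l (fun x => rho (g x)).
Proof.
case: rhoP => lk r1 rD rM; split=> //.
- by rewrite rmorph1.
- by move=> x y hx hy; rewrite rmorphD rD //; apply: alg_int_gal.
by move=> x y hx hy; rewrite rmorphM rM //; apply: alg_int_gal.
Qed.

(** Allows a Frobenius element that is only conjugate to [ga ^+ j] to be replaced by one equal to
    it, at another place. *)
Lemma frobenius_gal s g : is_frobenius l rho s ->
  is_frobenius l (fun x => rho (g x)) (g * s * g^-1)%g.
Proof.
move=> hs x hx; rewrite !galMf galKV; apply: hs; exact: alg_int_gal.
Qed.

Lemma frobenius_iter s n x : is_frobenius l rho s -> is_alg_int x ->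
  rho ((s ^+ n)%g x) = rho x ^+ (l ^ n)%N.
Proof.
move=> hs; elim: n x => [|n IH] x hx; first by rewrite expg0 gal_id expr1.
rewrite expgS galMf IH; last exact: alg_int_gal.
by rewrite hs // -exprM -expnS.
Qed.

(** With q = l^N, the element u = 1 - x^(q-1) has residue 1 and u x = x - x^q is a multiple of l: in
    the localization, l generates the maximal ideal. *)
Lemma residue_unramified x : power_congruent l -> is_alg_int x -> rho x = 0 ->
  exists u, [/\ is_alg_int u, rho u = 1 & exists2 y, is_alg_int y & u * x = l%:R * y].
Proof.
move=> hl hx rx; have [y hy yE] := hl x hx.
set q := (l ^ _)%N in yE.
have q1 : (1 < q)%N.
  rewrite -[1%N](exp1n #|{: gal_of {:E}}|) ltn_exp2r ?prime_gt1 ?residue_prime //.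
  by apply/card_gt0P; exists 1%g.
exists (1 - x ^+ q.-1); split.
- by apply: alg_intB; [apply: alg_int1|apply: alg_intX].
- rewrite residueB ?residue1 ?residueX //; [|exact: alg_int1|exact: alg_intX].
  by rewrite rx expr0n -subn1 subn_eq0 leqNgt q1 subr0.
exists (- y); first exact: alg_intN.
by rewrite mulrBl mul1r -exprSr prednK ?(ltnW q1) // mulrN -yE opprB.
Qed.

End ResidueMap.

(** A root of the minimal polynomial F of [th] in an algebraic closure of F_l defines a ring map on
    Z[th]; it extends to O_E because disc^2 O_E lies in Z[th] and l does not divide disc. The same
    disc controls ramification through the trace form. *)
Lemma places_exist : exists2 B : nat, (0 < B)%N & forall l, prime l -> ~~ (l %| B)%N ->
  power_congruent l /\
  exists (k : fieldType) (rho : E -> k) (s : gal_of {:E}),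
    is_residue_map l rho /\ is_frobenius l rho s.
Proof.
have [th th_int th_stab] := stabilizer_generator (1%G : {group gal_of {:E}}).
have th_gen g : g th = th -> g = 1%g.
  by move/eqP; rewrite th_stab => /set1P.
have [disc [disc0 bnP discP]] := order_exists th_int th_gen.
exists disc => // l l_pr l_disc.
have [F Fm FE] := orbit_poly_int th_int.
set bn := (disc ^ 2)%N in bnP.
have [k [iota _]] := countable_algebraic_closure 'F_l.
have lk : l \in [pchar k].
  by have := pchar_Fp l_pr; rewrite -(fmorph_pchar iota).
have sF : size F = #|{: gal_of {:E}}|.+1.
  rewrite -(size_map_inj_poly (@intrE_inj E)) // FE size_prod_XsubC.
  by rewrite cardT enumT [index_enum _]unlock.
have [t /rootP tF] : exists t : k, root (map_poly intr F) t.
  apply/closed_rootP; rewrite size_map_poly_id0 ?(monicP Fm) ?oner_eq0 // sF.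
  by rewrite eqSS; apply/eqP => /card0_eq/(_ 1%g).
pose phi (A : {poly int}) : k := (map_poly intr A).[t].
have phiD A B : phi (A + B) = phi A + phi B by rewrite /phi rmorphD hornerD.
have phiM A B : phi (A * B) = phi A * phi B by rewrite /phi rmorphM hornerM.
have phiC z : phi z%:P = z%:~R by rewrite /phi map_polyC hornerC.
pose ev (A : {poly int}) : E := (map_poly intr A).[th].
have evD A B : ev (A + B) = ev A + ev B by rewrite /ev rmorphD hornerD.
have evM A B : ev (A * B) = ev A * ev B by rewrite /ev rmorphM hornerM.
have evC z : ev z%:P = z%:~R by rewrite /ev map_polyC hornerC.
have evF : ev F = 0.
  rewrite /ev FE horner_prod (bigD1 1%g) //= hornerXsubC gal_id subrr mul0r.
  by [].
(* The remainder of A modulo F has degree less than N and vanishes at N conjugates, so the kernel of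
   [ev] is generated by F, which [phi] kills. *)
have phi0 A : ev A = 0 -> phi A = 0.
  have AE := Pdiv.RingMonic.rdivp_eq Fm A.
  rewrite AE evD evM evF mulr0 add0r => r0.
  rewrite phiD phiM (tF : phi F = 0) mulr0 add0r.
  rewrite (@small_poly_root E (Pdiv.Ring.rmodp A F) th [set: gal_of {:E}]) //.
  - by rewrite /phi rmorph0 horner0.
  - move=> g h _ _ gh; apply/eqP; rewrite -(inj_eq (mulIg h^-1%g)) mulgV.
    by apply/eqP/th_gen; rewrite galMf gh galVK.
  rewrite cardsT -ltnS -sF Pdiv.Ring.ltn_rmodpN0 //; exact: monic_neq0.
have phi_eq A B : ev A = ev B -> phi A = phi B.
  move=> eAB; apply/eqP; rewrite -subr_eq0.
  have -> : phi A - phi B = phi (A + (-1)%:P * B) by rewrite phiD phiM phiC mulN1r.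
  by apply/eqP/phi0; rewrite evD evM evC eAB mulN1r subrr.
have bn0 : (bn%:R : k) != 0.
  by rewrite -(dvdn_pcharf lk) Euclid_dvdX // andbT.
have bnC : phi (bn%:Z%:P) = bn%:R by rewrite phiC.
have bnE : ev (bn%:Z%:P) = bn%:R by rewrite evC.
(* The value at x is phi(A) / disc^2 whenever disc^2 x = A(th); by [phi_eq] it is independent of A.
   Elements that are not integral get the default 0. *)
have [rho rhoE] : exists rho : E -> k, forall x A, is_alg_int x -> bn%:R * x = ev A ->
    rho x = bn%:R^-1 * phi A.
  suff /choice[rho rhoP] : forall x, exists r : k, forall A, is_alg_int x -> bn%:R * x = ev A ->
    r = bn%:R^-1 * phi A by exists rho => x A; apply: rhoP.
  move=> x; case: (pselect (is_alg_int x)) => hx; last by exists 0.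
  have [A AE] := bnP x hx; exists (bn%:R^-1 * phi A) => B _ BE.
  by congr (_ * _); apply: phi_eq; rewrite -BE AE.
have rho_ev A : rho (ev A) = phi A.
  rewrite (@rhoE _ (bn%:Z%:P * A)); first by rewrite phiM bnC mulKf.
    exact: alg_int_horner.
  by rewrite evM bnE.
have rhoP : is_residue_map l rho.
  split=> //.
  - by rewrite -[1]/(1%:~R) -evC rho_ev phiC.
  - move=> x y hx hy; have [A AE] := bnP x hx; have [B BE] := bnP y hy.
    rewrite (rhoE _ _ hx AE) (rhoE _ _ hy BE) (@rhoE _ (A + B)) ?phiD ?mulrDr //.
      exact: alg_intD.
    by rewrite evD AE BE.
  move=> x y hx hy; have [A AE] := bnP x hx; have [B BE] := bnP y hy.
  have [C CE] := bnP _ (alg_intM hx hy).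
  rewrite (rhoE _ _ hx AE) (rhoE _ _ hy BE) (rhoE _ _ (alg_intM hx hy) CE).
  have : phi (bn%:Z%:P * C) = phi (A * B).
    apply: phi_eq; rewrite !evM bnE -[ev A]AE -[ev B]BE -[ev C]CE; ring.
  rewrite !phiM bnC => h.
  by apply: (mulfI bn0); rewrite mulVKf //; apply: (mulfI bn0); rewrite h; field.
have [s sP] : exists s, is_frobenius l rho s.
  have phiXl A : phi (A \Po 'X^l) = phi A ^+ l.
    rewrite /phi map_comp_poly map_polyXn horner_comp hornerXn.
    rewrite -!(pFrobenius_autE lk) -horner_map /= -map_poly_comp.
    congr (_.[_]); apply: eq_map_poly => z /=; rewrite rmorph_int //.
  (* F(th^l) has residue F(t)^l = 0 and is the product of the th^l - g th. Some factor has residue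
     0, and its g is the Frobenius element. *)
  have : rho (ev (F \Po 'X^l)) = 0.
    by rewrite rho_ev phiXl /phi tF expr0n gtn_eqF ?prime_gt0.
  rewrite /ev map_comp_poly FE horner_comp map_polyXn hornerXn horner_prod.
  rewrite (residue_prod rhoP); last first.
    by move=> g; rewrite hornerXsubC; apply: alg_intB; [apply: alg_intX|apply: alg_int_gal].
  move/eqP/prodf_eq0 => [s _]; rewrite hornerXsubC (residueB rhoP); first last.
  - exact: alg_int_gal.
  - exact: alg_intX.
  rewrite subr_eq0 (residueX rhoP) // => /eqP sth; exists s => x hx.
  have [A AE] := bnP x hx.
  have sA : bn%:R * s x = (map_poly intr A).[s th].
    rewrite -(rmorph_nat s) -rmorphM AE -horner_map /= -map_poly_comp.
    by congr (_.[_]); apply: eq_map_poly => z /=; rewrite rmorph_int.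
  have : rho (bn%:R * s x) = (bn%:R * rho x) ^+ l.
    rewrite sA (rhoE _ _ hx AE) mulVKf // -phiXl /phi map_comp_poly map_polyXn.
    rewrite horner_comp hornerXn !horner_coef (residue_sum rhoP); last first.
      move=> i; apply: alg_intM; first by rewrite coef_map; apply: alg_int_int.
      by apply/alg_intX/alg_int_gal.
    rewrite (size_map_inj_poly (@intrE_inj E)) //.
    rewrite -[RHS](horner_coef (map_poly intr A)) (@horner_coef_wide _ (size A)) ?size_poly //.
    apply: eq_bigr => i _; rewrite !coef_map /= (residueM rhoP); first last.
    - by apply/alg_intX/alg_int_gal.
    - exact: alg_int_int.
    rewrite (residue_int rhoP) (residueX rhoP); last exact: alg_int_gal.
    by rewrite -sth -[th]hornerX -(map_polyX intr) -/(ev 'X) rho_ev /phi map_polyX hornerX.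
  rewrite (residueM rhoP) ?(residue_nat rhoP); [|exact: alg_int_nat|exact: alg_int_gal].
  rewrite exprMn -(pFrobenius_autE lk) rmorph_nat; exact: (mulfI bn0).
split; last by exists k, rho, s.
move=> x hx; set q := (l ^ _)%N; pose y := x ^+ q - x.
have y_int : is_alg_int y by apply: alg_intB => //; apply: alg_intX.
(* Raising residues to the power l^N amounts to iterating the Frobenius element N times, which is
   the identity since N is the order of the group. So all conjugates of y have residue 0, and the
   traces of its integral multiples are divisible by l. *)
have rgy g : rho (g y) = 0.
  rewrite rmorphB rmorphXn /= (residueB rhoP) ?(residueX rhoP); first last.
  - exact: alg_int_gal.
  - by apply/alg_intX/alg_int_gal.
  - exact: alg_int_gal.
  rewrite -(frobenius_iter _ sP) //; last exact: alg_int_gal.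
  have -> : (s ^+ #|{: gal_of {:E}}| = 1)%g.
    by rewrite -cardsT; apply: expg_cardG; rewrite inE.
  by rewrite gal_id subrr.
have [w w_int wE] : exists2 w, is_alg_int w & disc%:R * y = l%:R * w.
  apply: discP => z z_int; have yz := alg_intM y_int z_int.
  have [T TE] := Trc_int yz.
  have /eqP : rho T%:~R = 0.
    rewrite -TE /Trc (residue_sum rhoP); last by move=> g; apply: alg_int_gal.
    by rewrite big1 // => g _; rewrite (residue_galM rhoP) // rgy mul0r.
  rewrite (residue_int_eq0 rhoP) => lT; have /dvdzP[T' T'E] : (l %| T)%Z by [].
  by exists T'; rewrite TE T'E mulrC.
have : coprime disc l by rewrite coprime_sym prime_coprime.
case/(coprimeP _ disc0) => -[a b] /= ab.
have abE : a%:R * disc%:R = 1 + b%:R * l%:R :> E.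
  rewrite -!natrM -(natrD E 1); congr _%:R; lia.
exists (a%:R * w - b%:R * y).
  by apply: alg_intB; apply: alg_intM => //; apply: alg_int_nat.
rewrite -/y; clearbody y.
transitivity ((a%:R * disc%:R - b%:R * l%:R) * y); first by rewrite abE addrK mul1r.
rewrite [LHS]mulrBl.
have -> : a%:R * disc%:R * y = a%:R * (l%:R * w) by rewrite -wE mulrA.
by rewrite !mulrBr; ring.
Qed.

End Places.

(** * Norms and valuations *)

Section Norm.
Variable E : splittingFieldType rat.
Implicit Types (x y : E) (g h : gal_of {:E}).

(* [nmz] is 0 when the norm is not a rational integer. *)
Definition nmz x : int :=
  if pselect (exists z : int, Nm x = z%:~R) is left e then projT1 (cid e) else 0.

Definition nm x : nat := `|nmz x|%N.

Lemma nmzE x : is_alg_int x -> Nm x = (nmz x)%:~R.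
Proof.
move=> hx; rewrite /nmz; case: pselect => [e|]; first by case: (cid e).
by case; apply: Nm_int.
Qed.

Lemma nmE x : is_alg_int x -> (nm x)%:R = (-1) ^+ (nmz x < 0)%R * Nm x.
Proof.
move=> hx; rewrite (nmzE hx) /nm.
have -> : (`|nmz x|%N%:R : E) = `|nmz x|%:~R by rewrite -abszE.
case: ltrP => h; first by rewrite ltr0_norm // expr1 mulN1r mulrNz.
by rewrite ger0_norm // expr0 mul1r.
Qed.

Lemma nm_gt0 x : is_alg_int x -> x != 0 -> (0 < nm x)%N.
Proof.
move=> hx x0; rewrite absz_gt0 -(inj_eq (@intrE_inj E)) -nmzE //.
by rewrite Nm_eq0.
Qed.

Lemma nmM x y : is_alg_int x -> is_alg_int y -> nm (x * y) = (nm x * nm y)%N.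
Proof.
move=> hx hy; rewrite /nm -abszM; congr absz; apply: (@intrE_inj E).
by rewrite intrM -!nmzE ?NmM //; apply: alg_intM.
Qed.

Section Valuation.
Variables (l : nat) (k : fieldType) (rho : E -> k).
Hypothesis rhoP : is_residue_map l rho.
Hypothesis l_unr : power_congruent E l.

(* The localization of O_E at the kernel of [rho] is a discrete valuation ring with
   uniformizer [l], because [l] is unramified. *)
Definition val_spec x a := exists w w', [/\ is_alg_int w, is_alg_int w',
  rho w != 0, rho w' != 0 & w * x = l%:R ^+ a * w'].

Let l_neq0 : (l%:R : E) != 0.
Proof. by rewrite natrE_eq0 -lt0n prime_gt0 // (residue_prime rhoP). Qed.

Let rho_l : rho l%:R = 0.
Proof. by apply/eqP; rewrite (residue_nat_eq0 rhoP). Qed.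

(** Otherwise, cross-multiplying the two presentations of x and cancelling l^a would make a product
    of two elements of nonzero residue divisible by l. *)
Lemma val_spec_ge x a n y w : val_spec x a -> is_alg_int w -> is_alg_int y ->
  rho w != 0 -> w * x = l%:R ^+ n * y -> (n <= a)%N.
Proof.
move=> [v [v' [hv hv' rv rv' vE]]] hw hy rw wE.
rewrite leqNgt; apply/negP => lt.
suff: rho (w * v') == 0.
  by rewrite (residueM rhoP) // mulf_eq0 (negPf rw) (negPf rv').
have -> : w * v' = l%:R * (l%:R ^+ (n - a.+1) * y * v).
  apply: (mulfI (expf_neq0 a l_neq0)).
  have -> : l%:R ^+ a * (w * v') = w * (l%:R ^+ a * v') by ring.
  rewrite -vE.
  have -> : w * (v * x) = v * (w * x) by ring.
  rewrite wE mulrA -{1}(subnK lt) exprD exprS; ring.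
rewrite (residueM rhoP) ?rho_l ?mul0r //; first exact: alg_int_nat.
by do 2![apply: alg_intM => //]; apply/alg_intX/alg_int_nat.
Qed.

(** The norm is a multiple of x in O_E, so its exponent of l bounds that of x. This is what makes a
    maximal exponent exist. *)
Lemma val_spec_norm_ge x n y w : is_alg_int x -> x != 0 -> is_alg_int w -> is_alg_int y ->
  rho w != 0 -> w * x = l%:R ^+ n * y -> (n <= logn l (nm x))%N.
Proof.
move=> hx x0 hw hy rw wE; have nx := nm_gt0 hx x0.
have [b bl bE] := pfactor_coprime (residue_prime rhoP) nx.
pose c : E := (-1) ^+ (nmz x < 0)%R * \prod_(g : gal_of {:E} | g != 1%g) g x.
have hc : is_alg_int c.
  apply: alg_intM; first by apply/alg_intX/alg_intN/alg_int1.
  by apply: alg_int_prod => g; apply: alg_int_gal.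
have cE : c * x = (nm x)%:R.
  by rewrite nmE // /Nm (bigD1 1%g) //= gal_id /c -mulrA [X in _ * X = _]mulrC.
apply: (@val_spec_ge (nm x)%:R _ _ (y * c) w) => //; last first.
- by rewrite -cE mulrCA wE; ring.
- exact: alg_intM.
exists 1, b%:R; split; [exact: alg_int1|exact: alg_int_nat| | |].
- by rewrite (residue1 rhoP) oner_eq0.
- by rewrite (residue_nat_eq0 rhoP) -prime_coprime ?(residue_prime rhoP).
by rewrite mul1r [in LHS]bE natrM natrX mulrC.
Qed.

Lemma val_spec_exists x : is_alg_int x -> x != 0 -> exists a, val_spec x a.
Proof.
move=> hx x0.
pose P n := `[< exists w y, [/\ is_alg_int w, is_alg_int y, rho w != 0 & w * x = l%:R ^+ n * y] >].
have exP : exists n, P n.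
  exists 0%N; apply/asboolP; exists 1, x; split=> //; first exact: alg_int1.
  by rewrite (residue1 rhoP) oner_eq0.
have ubP n : P n -> (n <= logn l (nm x))%N.
  by move/asboolP => [w [y [hw hy rw wE]]]; apply: val_spec_norm_ge wE.
case: (ex_maxnP exP ubP) => a /asboolP[w [y [hw hy rw wE]]] a_max.
exists a, w, y; split=> //; apply/eqP => ry.
have [u [hu ru [z hz uE]]] := residue_unramified rhoP l_unr hy ry.
suff /a_max : P a.+1 by rewrite ltnn.
apply/asboolP; exists (u * w), z; split=> //; first exact: alg_intM.
  by rewrite (residueM rhoP) // ru mul1r.
by rewrite -mulrA wE mulrCA uE exprS; ring.
Qed.

Lemma val_spec_prod (I : Type) (r : seq I) (F : I -> E) (a : I -> nat) :
  (forall i, val_spec (F i) (a i)) -> val_spec (\prod_(i <- r) F i) (\sum_(i <- r) a i).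
Proof.
move=> hF; elim: r => [|i r [w [w' [hw hw' rw rw' wE]]]].
  rewrite !big_nil; exists 1, 1; split; rewrite ?(residue1 rhoP) ?oner_eq0 //; try exact: alg_int1.
have [v [v' [hv hv' rv rv' vE]]] := hF i.
exists (v * w), (v' * w'); split; try exact: alg_intM.
- by rewrite (residueM rhoP) // mulf_neq0.
- by rewrite (residueM rhoP) // mulf_neq0.
rewrite !big_cons mulrACA vE wE exprD; ring.
Qed.

(** For the last clause: up to sign [nm x] is the product of the conjugates of x, and the valuation
    of a rational integer is its exponent of l because an integer prime to l has nonzero residue. *)
Lemma valuation_exists : exists val : E -> nat, [/\
  forall x, is_alg_int x -> x != 0 -> (0 < val x)%N = (rho x == 0),
  forall n x y, is_alg_int x -> is_alg_int y -> x != 0 -> y != 0 -> x != y ->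
    (n <= val x)%N -> (n <= val y)%N -> (n <= val (x - y)%R)%N &
  forall x, is_alg_int x -> x != 0 ->
    logn l (nm x) = \sum_(g : gal_of {:E}) val (g x)].
Proof.
have [v vP] : exists v : E -> nat, forall x, is_alg_int x -> x != 0 -> val_spec x (v x).
  suff /choice[v vP] : forall x, exists a, is_alg_int x -> x != 0 -> val_spec x a by exists v.
  move=> x.
  case: (pselect (is_alg_int x /\ x != 0)) => [[hx x0]|nx].
    by have [a aP] := val_spec_exists hx x0; exists a.
  by exists 0%N => hx x0; case: nx.
exists v; split.
- move=> x hx x0; have [w [w' [hw hw' rw rw' wE]]] := vP x hx x0.
  apply/idP/eqP => [v0|rx].
    have /eqP : rho (w * x) = 0.
      rewrite wE -(prednK v0) exprS -mulrA (residueM rhoP) ?rho_l ?mul0r //.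
        exact: alg_int_nat.
      by apply: alg_intM => //; apply/alg_intX/alg_int_nat.
    by rewrite (residueM rhoP) // mulf_eq0 (negPf rw) => /eqP.
  have [u [hu ru [z hz uE]]] := residue_unramified rhoP l_unr hx rx.
  by apply: (@val_spec_ge x _ _ z u (vP x hx x0)); rewrite ?ru ?oner_eq0 ?expr1.
- move=> n x y hx hy x0 y0 xy nx ny.
  have [w [w' [hw hw' rw rw' wE]]] := vP x hx x0.
  have [u [u' [hu hu' ru ru' uE]]] := vP y hy y0.
  have xy0 : x - y != 0 by rewrite subr_eq0.
  pose z := u * l%:R ^+ (v x - n) * w' - w * l%:R ^+ (v y - n) * u'.
  apply: (@val_spec_ge (x - y) _ _ z (u * w) (vP _ (alg_intB hx hy) xy0)).
  + exact: alg_intM.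
  + by apply: alg_intB; do 2![apply: alg_intM => //]; apply/alg_intX/alg_int_nat.
  + by rewrite (residueM rhoP) // mulf_neq0.
  have -> : u * w * (x - y) = u * (w * x) - w * (u * y) by ring.
  by rewrite wE uE -{1}(subnK nx) -{1}(subnK ny) !exprD /z; ring.
move=> x hx x0.
have gP g : val_spec (g x) (v (g x)).
  by apply: vP; [apply: alg_int_gal|rewrite gal_eq0].
have nx := nm_gt0 hx x0.
have [b bl bE] := pfactor_coprime (residue_prime rhoP) nx.
have [w [w' [hw hw' rw rw' wE]]] := val_spec_prod (index_enum _) gP.
have nE : (nm x)%:R = (-1) ^+ (nmz x < 0)%R * \prod_g (g : gal_of {:E}) x := nmE hx.
apply/eqP; rewrite eqn_leq; apply/andP; split.
  apply: (@val_spec_ge (\prod_g (g : gal_of {:E}) x) _ _ ((-1) ^+ (nmz x < 0)%R * b%:R) 1).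
  - by exists w, w'.
  - exact: alg_int1.
  - by apply: alg_intM; [apply/alg_intX/alg_intN/alg_int1|apply: alg_int_nat].
  - by rewrite (residue1 rhoP) oner_eq0.
  rewrite mul1r; apply: (can_inj (signrMK (nmz x < 0)%R)).
  by rewrite -nE [in LHS]bE mulrCA signrMK natrM natrX mulrC.
apply: (@val_spec_ge (nm x)%:R _ _ ((-1) ^+ (nmz x < 0)%R * w') w) => //.
- exists 1, b%:R; split; [exact: alg_int1|exact: alg_int_nat| | |].
  + by rewrite (residue1 rhoP) oner_eq0.
  + by rewrite (residue_nat_eq0 rhoP) -prime_coprime ?(residue_prime rhoP).
  by rewrite mul1r [in LHS]bE natrM natrX mulrC.
- by apply: alg_intM => //; apply/alg_intX/alg_intN/alg_int1.
by rewrite nE mulrCA wE mulrCA.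
Qed.

End Valuation.
End Norm.

(** * Archimedean bounds for norms *)

Section Size.
Variable E : splittingFieldType rat.
Implicit Types (x y : E) (g h : gal_of {:E}).

Local Notation N := #|{: gal_of {:E}}|.

(** The sum of the absolute values of the coordinates in a Q-basis, scaled by a bound for the
    structure constants; it plays the part of the archimedean absolute values while staying in
    [rat]. *)
Lemma submultiplicative_norm : exists nrm : E -> rat, [/\ forall x, 0 <= nrm x,
  forall x y, nrm (x + y) <= nrm x + nrm y,
  forall (z : int) x, nrm (z%:~R * x) = `|z|%:~R * nrm x,
  forall x y, nrm (x * y) <= nrm x * nrm y & 1 <= nrm 1].
Proof.
pose b := vbasis {:E}.
pose sz x : rat := \sum_i `|coord b i x|.
have sz0 x : 0 <= sz x by apply: sumr_ge0.
have szD x y : sz (x + y) <= sz x + sz y.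
  by rewrite -big_split; apply: ler_sum => i _; rewrite linearD ler_normD.
have szZ q x : sz (q *: x) = `|q| * sz x.
  by rewrite mulr_sumr; apply: eq_bigr => i _; rewrite linearZ normrM.
have sz_sum (I : Type) (r : seq I) (F : I -> E) :
    sz (\sum_(i <- r) F i) <= \sum_(i <- r) sz (F i).
  elim: r => [|i r IH]; last by rewrite !big_cons (le_trans (szD _ _)) ?lerD2l.
  by rewrite !big_nil /sz big1 // => i _; rewrite linear0 normr0.
have xE x : x = \sum_i coord b i x *: b`_i by apply: coord_vbasis; rewrite memvf.
pose C : rat := 1 + \sum_(i < \dim {:E}) \sum_(j < \dim {:E}) sz (b`_i * b`_j : E).
have C0 : 0 < C by rewrite ltr_pwDl // sumr_ge0 // => i _; rewrite sumr_ge0.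
have Cij (i j : 'I_(\dim {:E})) : sz (b`_i * b`_j) <= C.
  rewrite /C (bigD1 i) //= (bigD1 j) //=.
  have h1 : 0 <= \sum_(j' < \dim {:E} | j' != j) sz (b`_i * b`_j') by rewrite sumr_ge0.
  have h2 : 0 <= \sum_(i' < \dim {:E} | i' != i) \sum_(j' < \dim {:E}) sz (b`_i' * b`_j').
    by rewrite sumr_ge0 // => i' _; rewrite sumr_ge0.
  by rewrite -addrA; lra.
have szM x y : sz (x * y) <= C * (sz x * sz y).
  have -> : x * y = \sum_i \sum_j (coord b i x * coord b j y) *: (b`_i * b`_j).
    rewrite {1}[x]xE {1}[y]xE mulr_suml; apply: eq_bigr => i _.
    rewrite mulr_sumr; apply: eq_bigr => j _.
    by rewrite -scalerAl -scalerAr scalerA.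
  apply: le_trans (sz_sum _ _ _) _.
  rewrite {1}/sz mulr_suml mulr_sumr; apply: ler_sum => i _.
  apply: le_trans (sz_sum _ _ _) _.
  rewrite {2}/sz mulr_sumr mulr_sumr; apply: ler_sum => j _.
  by rewrite szZ normrM mulrC ler_wpM2r ?mulr_ge0.
have sz1 : 0 < sz 1.
  rewrite lt_neqAle sz0 andbT eq_sym; apply/eqP => s1.
  have : (1 : E) = 0.
    rewrite [LHS]xE big1 // => i _.
    suff -> : coord b i 1 = 0 by rewrite scale0r.
    move: (s1) => /eqP; rewrite psumr_eq0 => [/allP/(_ i)|j _]; last exact: normr_ge0.
    by rewrite mem_index_enum => /(_ isT) /= ; rewrite normr_eq0 => /eqP.
  by move/eqP; rewrite oner_eq0.
exists (fun x => C * sz x); split.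
- by move=> x; rewrite mulr_ge0 // ltW.
- by move=> x y; rewrite -mulrDr ler_wpM2l // ltW.
- move=> z x; have -> : z%:~R * x = z%:~R *: x.
    by rewrite -[in RHS](mul1r x) scalerAl -(rmorph_int (in_alg E)).
  by rewrite szZ intr_norm; ring.
- by move=> x y; apply: le_trans (ler_wpM2l (ltW C0) (szM x y)) _; rewrite mulrACA !mulrA.
have := szM 1 1; rewrite mulr1 => h.
by rewrite -(ler_pM2r sz1) mul1r -mulrA.
Qed.

Definition el (b : E) (d : nat) (v : 'I_d -> int) : E := \sum_(i < d) (v i)%:~R * b ^+ i.

Lemma el_int b d (v : 'I_d -> int) : is_alg_int b -> is_alg_int (el b v).
Proof.
by move=> hb; apply: alg_int_sum => i; apply: alg_intM; [apply: alg_int_int|apply: alg_intX].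
Qed.

(** Expand the product of the u + g w, where w is [el b v]: every term but u^N contains some g w, of
    size at most C D. The case u = 0 bounds norms from above, a large u bounds them from below. *)
Lemma size_bound (b : E) (d : nat) : is_alg_int b ->
  exists2 C : nat, (0 < C)%N & forall (D u : nat) (v : 'I_d -> int),
  (forall i, `|v i| <= D%:Z) ->
  `|nmz (u%:R + el b v) - u%:Z ^+ N| <= (u + C * D)%N%:Z ^+ N - u%:Z ^+ N.
Proof.
move=> hb; have [nrm [n0 nD nZ nM n1]] := submultiplicative_norm.
pose C1 := \sum_(g : gal_of {:E}) \sum_(i < d) nrm (g (b ^+ i)).
have C10 : 0 <= C1 by rewrite sumr_ge0 // => g _; rewrite sumr_ge0.
pose C := (Num.bound C1).+1.
have C1C : C1 <= C%:R.
  apply: ltW; apply: lt_le_trans (archi_boundP C10) _.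
  by rewrite ler_nat.
exists C => // D u v vD.
have nrm0 : nrm 0 = 0 by rewrite -(mul0r 0) (nZ 0) mul0r.
have nrm_sum (I : Type) (r : seq I) (F : I -> E) :
    nrm (\sum_(i <- r) F i) <= \sum_(i <- r) nrm (F i).
  elim: r => [|i r IH]; last by rewrite !big_cons (le_trans (nD _ _)) ?lerD2l.
  by rewrite !big_nil nrm0.
have gw g : nrm (g (el b v)) <= (C * D)%N%:R.
  rewrite rmorph_sum; apply: le_trans (nrm_sum _ _ _) _.
  apply: (@le_trans _ _ (D%:R * C1)); last first.
    by rewrite natrM mulrC ler_wpM2r.
  rewrite /C1 (bigD1 g) //= mulrDr.
  apply: ler_wpDr.
    by rewrite mulr_ge0 // sumr_ge0 // => h _; rewrite sumr_ge0.
  rewrite mulr_sumr; apply: ler_sum => i _; rewrite rmorphM /= rmorph_int nZ.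
  rewrite ler_wpM2r //; have := vD i.
  by rewrite -(ler_int rat).
have step (r : seq (gal_of {:E})) :
  nrm (\prod_(g <- r) (u%:R + g (el b v)) - u%:R ^+ size r) <=
    (u + C * D)%N%:R ^+ size r - u%:R ^+ size r.
  elim: r => [|g r IH]; first by rewrite big_nil !expr0 !subrr nrm0.
  set P := \prod_(g <- r) _ in IH.
  rewrite big_cons /=.
  set K := size r in IH *; set W := (C * D)%N in gw IH *.
  have -> : (u%:R + g (el b v)) * P - u%:R ^+ K.+1 =
     u%:Z%:~R * (P - u%:R ^+ K) + (P - u%:R ^+ K) * g (el b v) + (u%:Z ^+ K)%:~R * g (el b v).
    have id (Q a U UK : E) : (U + a) * Q - U * UK = U * (Q - UK) + (Q - UK) * a + UK * a.
      by ring.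
    by rewrite exprS rmorphXn; apply: id.
  apply: le_trans (nD _ _) _; rewrite nZ.
  apply: (@le_trans _ _ (u%:R * ((u + W)%N%:R ^+ K - u%:R ^+ K) +
       ((u + W)%N%:R ^+ K - u%:R ^+ K) * W%:R + u%:R ^+ K * W%:R)); last first.
    have id (U V A B : rat) : U * (A - B) + (A - B) * V + B * V = (U + V) * A - U * B.
      by ring.
    by rewrite id !exprS natrD.
  apply: lerD; last first.
    rewrite normrX ger0_norm // rmorphXn /= -[u%:Z%:~R]/(u%:R : rat).
    by rewrite ler_wpM2l // exprn_ge0.
  apply: le_trans (nD _ _) _; apply: lerD.
    rewrite nZ ger0_norm // -[u%:Z%:~R]/(u%:R : rat).
    by rewrite ler_wpM2l.
  apply: le_trans (nM _ _) _.
  by apply: ler_pM.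
have w_int : is_alg_int (u%:R + el b v).
  by apply: alg_intD; [apply: alg_int_nat|apply: el_int].
have := step (enum {: gal_of {:E}}).
rewrite -cardE big_enum /=.
have -> : \prod_(g : gal_of {:E}) (u%:R + g (el b v)) - u%:R ^+ N =
    (nmz (u%:R + el b v) - u%:Z ^+ N)%:~R * 1.
  rewrite mulr1 intrB -(nmzE w_int) rmorphXn /=; congr (_ - _).
  by apply: eq_bigr => g _; rewrite rmorphD rmorph_nat.
rewrite nZ => h.
rewrite -(ler_int rat) intrB !rmorphXn /=.
apply: le_trans h; rewrite ler_peMr // ler0z.
Qed.

(** Representatives of the d right cosets of [H] give d distinct conjugates of b, too many for a
    nonzero polynomial of degree less than d. *)
Lemma el_eq0 (H : {group gal_of {:E}}) b (v : 'I_#|[set: gal_of {:E}] : H|%g -> int) :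
  (forall g, (g b == b) = (g \in H)) -> el b v = 0 -> forall i, v i = 0.
Proof.
move=> bH bv; set d := #|_ : H|%g in v bv *.
pose P : {poly int} := \poly_(i < d) (if insub i is Some j then v j else 0).
have Pi (i : 'I_d) : P`_i = v i.
  by rewrite coef_poly ltn_ord insubT ?ltn_ord //= => lti; congr v; apply: val_inj.
suff P0 : P = 0 by move=> i; rewrite -Pi P0 coef0.
pose T := [set repr A | A in rcosets H [set: gal_of {:E}]].
have cT : #|T| = d.
  rewrite card_in_imset // => A B /rcosetsP[g _ ->] /rcosetsP[h _ ->] e.
  by rewrite -(rcoset_repr H g) e rcoset_repr.
apply: (@small_poly_root E P b T); last first.
- rewrite (@horner_coef_wide _ d); last first.
    by apply: leq_trans (size_poly _ _) _; rewrite ?size_poly //; apply: size_poly.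
  by rewrite -[RHS]bv; apply: eq_bigr => i _; rewrite coef_map Pi.
- by rewrite cT size_poly.
move=> _ _ /imsetP[A /rcosetsP[g _ ->] ->] /imsetP[B /rcosetsP[h _ ->] ->] e.
congr repr.
have : (repr (H :* g) * (repr (H :* h))^-1)%g \in H.
  by rewrite -bH galMf e galVK.
rewrite -mem_rcoset => /rcoset_eqP eq1.
by rewrite -(rcoset_repr H g) eq1 rcoset_repr.
Qed.

End Size.

(** * Logarithmic sums over primes *)

Section LogSums.
Variable R : realType.

Definition lnn (n : nat) : R := ln n%:R.

Lemma lnnM m n : (0 < m)%N -> (0 < n)%N -> lnn (m * n) = lnn m + lnn n.
Proof. by move=> m0 n0; rewrite /lnn natrM lnM ?posrE ?ltr0n. Qed.

Lemma lnn1 : lnn 1 = 0.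
Proof. exact: ln1. Qed.

Lemma lnnX m k : (0 < m)%N -> lnn (m ^ k) = k%:R * lnn m.
Proof. by move=> m0; rewrite /lnn natrX lnXn ?ltr0n // mulr_natl. Qed.

Lemma lnn_ge0 n : 0 <= lnn n.
Proof. by case: n => [|n]; [rewrite /lnn ln0|rewrite ln_ge0 // ler1n]. Qed.

Lemma le_lnn m n : (m <= n)%N -> lnn m <= lnn n.
Proof.
case: m => [|m] mn; first by rewrite {1}/lnn ln0 // lnn_ge0.
by rewrite /lnn ler_ln ?posrE ?ltr0n ?ler_nat //; apply: leq_trans mn.
Qed.

Lemma lnn2_gt0 : 0 < lnn 2.
Proof. by rewrite ln_gt0 // ltr1n. Qed.

Lemma lnn_prod (I : Type) (r : seq I) (P : pred I) (F : I -> nat) :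
  (forall i, P i -> 0 < F i)%N -> lnn (\prod_(i <- r | P i) F i) = \sum_(i <- r | P i) lnn (F i).
Proof.
move=> hF.
suff [] : (0 < \prod_(i <- r | P i) F i)%N /\ lnn (\prod_(i <- r | P i) F i) = \sum_(i <- r | P i) lnn (F i) by [].
apply: (big_ind2 (fun (a : nat) (b : R) => (0 < a)%N /\ lnn a = b)).
- by rewrite lnn1.
- by move=> a a' b b' [a0 <-] [b0 <-]; rewrite muln_gt0 a0 b0 lnnM.
- by move=> i Pi; split=> //; apply: hF.
Qed.

Lemma lnn_prime_sum m X : (0 < m)%N -> (m <= X)%N ->
  lnn m = \sum_(0 <= l < X.+1 | prime l) (logn l m)%:R * lnn l.
Proof.
move=> m0 mX; rewrite -[m in LHS](partnT m0) (widen_partn _ mX).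
rewrite lnn_prod; last first.
  move=> l _; case: l => [|l]; last by rewrite expn_gt0.
  by rewrite lognE.
rewrite (bigID prime) /= [X in _ + X]big1 ?addr0.
  by apply: eq_bigr => l lp; rewrite lnnX ?prime_gt0.
move=> l lp; rewrite lognE (negPf lp) expn0 lnn1 //.
Qed.

Lemma lnn_prime_sum_le m Y (P : pred nat) : (0 < m)%N -> (forall l, P l -> prime l) ->
  \sum_(0 <= l < Y.+1 | P l) (logn l m)%:R * lnn l <= lnn m.
Proof.
move=> m0 hP; rewrite (@lnn_prime_sum m (maxn m Y)) ?leq_maxl //.
have t0 l : 0 <= (logn l m)%:R * lnn l by rewrite mulr_ge0 ?lnn_ge0.
rewrite [leRHS](@big_cat_nat _ _ _ Y.+1) /= ?ltnS ?leq_maxr //.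
apply: ler_wpDr; first by rewrite sumr_ge0.
rewrite big_mkcond [leRHS]big_mkcond /=; apply: ler_sum => l _.
by case: ifP => [/hP->|_] //; case: ifP.
Qed.

Lemma binom_pow2 n k : ('C(n, k) <= 2 ^ n)%N.
Proof.
case: (leqP k n) => [kn|/bin_small-> //].
rewrite -[2%N]/(1 + 1)%N Pascal (bigD1 (inord k)) //= inordK ?ltnS //.
by rewrite !exp1n !muln1 leq_addr.
Qed.

Lemma prime_gt_not_dvd_fact l k : prime l -> (k < l)%N -> ~~ (l %| k`!)%N.
Proof.
move=> lp; elim: k => [|k IH] kl; first by rewrite dvdn1 gtn_eqF ?prime_gt1.
by rewrite factS Euclid_dvdM // negb_or IH ?(ltnW kl) // gtnNdvd.
Qed.

Lemma primes_dvd_central_binom k : (\prod_(k.+1 <= l < (2 * k).+1 | prime l) l %| 'C(2 * k, k))%N.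
Proof.
set r := index_iota _ _.
have : (forall l, l \in r -> prime l -> l %| 'C(2 * k, k))%N.
  move=> l; rewrite mem_index_iota => /andP[kl lk] lp.
  have : (l %| 'C(2 * k, k) * (k`! * (2 * k - k)`!))%N.
    by rewrite bin_fact ?leq_pmull // dvdn_fact // prime_gt0.
  have kf : ~~ (l %| k`!)%N by apply: prime_gt_not_dvd_fact.
  have -> : (2 * k - k = k)%N by lia.
  by rewrite !Euclid_dvdM // (negPf kf) !orbF.
have : uniq r by apply: iota_uniq.
elim: r => [|l r IH]; first by rewrite big_nil dvd1n.
rewrite /= big_cons => /andP[lr ur] hr; case: ifP => lp; last first.
  by apply: IH => // l' l'r; apply: hr; rewrite inE l'r orbT.
rewrite Gauss_dvd.
  by rewrite hr ?inE ?eqxx //=; apply: IH => // l' l'r; apply: hr; rewrite inE l'r orbT.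
rewrite prime_coprime // Euclid_dvd_prod // big_has_cond; apply/hasPn => l' l'r.
rewrite negb_and -implybE; apply/implyP => l'p; rewrite dvdn_prime2 //.
by apply: contraNneq lr => ->.
Qed.

Lemma chebyshev_dyadic k : (0 < k)%N ->
  \sum_(k.+1 <= l < (2 * k).+1 | prime l) lnn l / l%:R <= 2 * lnn 2.
Proof.
move=> k0; apply: (@le_trans _ _ ((\sum_(k.+1 <= l < (2 * k).+1 | prime l) lnn l) / k%:R)).
  rewrite mulr_suml [leLHS]big_seq_cond [leRHS]big_seq_cond; apply: ler_sum => l.
  rewrite mem_index_iota => /andP[/andP[kl _] lp].
  rewrite ler_wpM2l ?lnn_ge0 // lef_pV2 ?posrE ?ltr0n ?ler_nat //; last exact: prime_gt0.
  exact: ltnW.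
rewrite ler_pdivrMr ?ltr0n // -lnn_prod => [|l lp]; last exact: prime_gt0.
have bin0 : (0 < 'C(2 * k, k))%N by rewrite bin_gt0 leq_pmull.
apply: le_trans (le_lnn (dvdn_leq bin0 (primes_dvd_central_binom k))) _.
apply: le_trans (le_lnn (binom_pow2 _ _)) _.
by rewrite lnnX // natrM mulrAC.
Qed.

(** The bound does not depend on [k]: this absorbs the primes for which no sharp count is
    available. *)
Lemma chebyshev_range k J : (0 < k)%N ->
  \sum_(k.+1 <= l < (2 ^ J * k).+1 | prime l) lnn l / l%:R <= (2 * J)%:R * lnn 2.
Proof.
move=> k0; elim: J => [|J IH]; first by rewrite expn0 mul1n big_geq // muln0 mul0r.
have p0 : (0 < 2 ^ J)%N by rewrite expn_gt0.
rewrite (@big_cat_nat _ _ _ (2 ^ J * k).+1) /= ?ltnS ?leq_pmull //; last first.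
  by rewrite leq_mul2r leq_exp2l // leqnSn orbT.
have -> : (2 ^ J.+1 * k = 2 * (2 ^ J * k))%N by rewrite expnS mulnA.
have := chebyshev_dyadic (k := (2 ^ J * k)%N); rewrite muln_gt0 p0 k0 => /(_ isT) h.
apply: le_trans (lerD IH h) _.
by rewrite -mulrDl ler_wpM2r ?lnn_ge0 // -natrD ler_nat mulnS addnC.
Qed.

Lemma sum_lnn_sq J : \sum_(0 <= l < 2 ^ J) lnn l / l%:R ^+ 2 <= 4 * lnn 2.
Proof.
have p2 i : 0 < (2 ^+ i : R) by rewrite exprn_gt0.
(* 4 - (2J + 4) / 2^J is the sum of (j + 1) / 2^j over j < J, the bound given by the blocks 2^j <= l
   < 2^(j+1). *)
apply: (@le_trans _ _ (lnn 2 * (4 - (2 * J + 4)%:R / 2 ^+ J))); last first.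
  rewrite mulrC ler_wpM2r ?lnn_ge0 // lerBlDr lerDl.
  by rewrite divr_ge0 // ltW.
elim: J => [|J IH].
  by rewrite expn0 big_nat1 /lnn ln0 // mul0r mulr_ge0 ?lnn_ge0 // expr0 divr1 subrr.
rewrite (@big_cat_nat _ _ _ (2 ^ J)) //=; last by rewrite leq_exp2l.
have h : \sum_(2 ^ J <= l < 2 ^ J.+1) lnn l / l%:R ^+ 2 <= (J.+1)%:R * lnn 2 / 2 ^+ J.
  apply: (@le_trans _ _ (\sum_(2 ^ J <= l < 2 ^ J.+1) (J.+1)%:R * lnn 2 / 2 ^+ J ^+ 2)).
    rewrite [leLHS]big_nat [leRHS]big_nat; apply: ler_sum => l /andP[l1 l2].
    apply: ler_pM; rewrite ?lnn_ge0 ?invr_ge0 ?sqr_ge0 //.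
      by rewrite -lnnX //; apply/le_lnn/ltnW.
    rewrite lef_pV2 ?posrE ?exprn_gt0 ?ltr0n //; last by apply: leq_trans l1; rewrite expn_gt0.
    rewrite lerXn2r ?nnegrE ?ler0n // ?(ltW (p2 J)) //.
    by rewrite -natrX ler_nat.
  rewrite sumr_const_nat expnS mul2n -addnn addnK -[X in X <= _]mulr_natr natrX.
  rewrite le_eqVlt; apply/orP; left; apply/eqP; field.
  by rewrite gt_eqF.
apply: le_trans (lerD IH h) _.
rewrite le_eqVlt; apply/orP; left; apply/eqP.
rewrite exprS natrD natrM natrD natrM mulrS; field.
by rewrite gt_eqF.
Qed.

End LogSums.

(** * The upper Mertens bound *)

Lemma frobenius_fixed_nat (k : fieldType) (l : nat) (y : k) :
  l \in [pchar k] -> y ^+ l = y -> exists i : 'I_l, y = i%:R.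
Proof.
move=> lk yl; have lp := pcharf_prime lk.
have [//|nex] := pselect (exists i : 'I_l, y = i%:R).
pose rs := y :: [seq (i%:R : k) | i : 'I_l].
have : ('X^l - 'X : {poly k}) != 0.
  rewrite -size_poly_eq0 size_polyDl ?size_polyXn // size_polyN size_polyX.
  by rewrite ltnS prime_gt1.
move/max_poly_roots => /(_ rs).
rewrite /= size_image card_ord size_polyDl ?size_polyXn ?size_polyN ?size_polyX ?ltnS ?prime_gt1 //.
rewrite ltnn => h; suff : false by []; apply: h.
  rewrite /root !hornerE yl subrr eqxx /=; apply/allP => _ /imageP[i _ ->].
  by rewrite /root !hornerE -(pFrobenius_autE lk) rmorph_nat subrr.
apply/andP; split; first by apply/imageP => -[i _ yi]; apply: nex; exists i.
rewrite map_inj_uniq ?enum_uniq // => i j ij; apply: val_inj => /=.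
wlog le : i j ij / (i <= j)%N.
  by move=> h; case: (leqP i j) => [|/ltnW] le; [apply: h|apply/esym/h].
have /eqP : ((j - i)%N%:R : k) = 0 by rewrite natrB // ij subrr.
rewrite -(dvdn_pcharf lk) => dv; case: (posnP (j - i)%N) => [|ji]; first by lia.
have := dvdn_leq ji dv; have := ltn_ord j; lia.
Qed.

(** Cauchy-Schwarz for the fibre sizes [m i]; the diagonal pairs are counted among the
    coincidences. *)
Lemma collision_count (T : finType) (l : nat) (c : T -> 'I_l) :
  (#|T| ^ 2 <= l * \sum_(p : T * T) (c p.1 == c p.2))%N.
Proof.
pose m i := (\sum_x (c x == i))%N.
have mT : (#|T| = \sum_i m i)%N.
  rewrite exchange_big /= -sum1_card; apply: eq_bigr => x _.
  by rewrite (bigD1 (c x)) //= eqxx big1 // => i /negPf; rewrite eq_sym => ->.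
have -> : (\sum_(p : T * T) (c p.1 == c p.2) = \sum_i m i * m i)%N.
  rewrite -(pair_bigA _ (fun x y => (c x == c y) : nat)) /=.
  transitivity (\sum_x m (c x))%N.
    by apply: eq_bigr => x _; apply: eq_bigr => y _; rewrite eq_sym.
  rewrite (partition_big c xpredT) //=; apply: eq_bigr => i _.
  rewrite (eq_bigr (fun=> m i)); last by move=> x /eqP->.
  by rewrite sum_nat_const -sum1_card big_mkcond.
rewrite mT expnS expn1 big_distrlr /=.
have -> : (l * \sum_i m i * m i = \sum_(i : 'I_l) \sum_(j : 'I_l) m i * m i)%N.
  rewrite [RHS](eq_bigr (fun i => l * (m i * m i))%N) ?big_distrr //= => i _.
  by rewrite sum_nat_const card_ord.
rewrite -(leq_pmul2l (isT : 0 < 2)%N) !mul2n -!addnn.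
rewrite [X in (_ <= _ + X)%N]exchange_big /= -!big_split /=.
apply: leq_sum => i _; rewrite -!big_split /=; apply: leq_sum => j _.
by have [h _] := nat_Cauchy (m i) (m j); move: h; rewrite mul2n -addnn !expnS !expn0 !muln1.
Qed.

Section Box.
Variable E : splittingFieldType rat.
Implicit Types (x y : E) (g h : gal_of {:E}).
Variables (H : {group gal_of {:E}}) (b : E).
Hypothesis b_int : is_alg_int b.
Hypothesis bH : forall g, (g b == b) = (g \in H).

Local Notation N := #|{: gal_of {:E}}|.
Local Notation d := #|[set: gal_of {:E}] : H|%g.

Definition box D := {ffun 'I_d -> 'I_D}.
HB.instance Definition _ D := Finite.on (box D).

Definition bel D (v : box D) : E := el b (fun i => (v i : nat)%:Z).

(* [#|H|] times the number of degree one primes of the fixed field of [H] above the prime whose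
   Frobenius element is [s]. *)
Definition fixed_count (s : gal_of {:E}) : nat := #|[set g : gal_of {:E} | s (g b) == g b]|.

Definition good_at (l : nat) (s : gal_of {:E}) : Prop :=
  power_congruent E l /\ exists (k : fieldType) (rho : E -> k),
    is_residue_map l rho /\ is_frobenius l rho s.

Lemma card_box D : #|{: box D}| = (D ^ d)%N.
Proof. by rewrite card_ffun !card_ord. Qed.

Lemma N_eq : (N = #|H| * d)%N.
Proof. by rewrite -cardsT -(Lagrange (subsetT H)). Qed.

Lemma N_gt0 : (0 < N)%N.
Proof. by apply/card_gt0P; exists 1%g. Qed.

Lemma d_gt0 : (0 < d)%N.
Proof. exact: indexg_gt0. Qed.

Lemma fixed_count_le s : (fixed_count s <= N)%N.
Proof. exact: max_card. Qed.

Lemma gal_el g (s : gal_of {:E}) n (v : 'I_n -> int) : s (g b) = g b ->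
  s (g (el b v)) = g (el b v).
Proof.
move=> sg; rewrite /el !rmorph_sum; apply: eq_bigr => i _.
by rewrite !rmorphM /= !rmorph_int !rmorphXn /= sg.
Qed.

Lemma elB n (v w : 'I_n -> int) : el b v - el b w = el b (fun i => v i - w i).
Proof.
by rewrite /el -sumrB; apply: eq_bigr => i _; rewrite -mulrBl intrB.
Qed.

Lemma bel_int D (v : box D) : is_alg_int (bel v).
Proof. exact: el_int. Qed.

Lemma bel_inj D : injective (@bel D).
Proof.
move=> v w /eqP; rewrite -subr_eq0 elB => /eqP/(el_eq0 bH) vw.
apply/ffunP => i; apply: val_inj; have /eqP := vw i.
by rewrite subr_eq0 => /eqP[].
Qed.

(** For each g counted by [fixed_count], composing the residue map with g sends the box into the
    prime field, so at least n^2 / l pairs coincide. A coincidence of distinct elements makes a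
    conjugate of their difference vanish at the place, adding at least 1 to the exponent of l in its
    norm; the last term pays for the diagonal pairs. *)
Lemma collision_norm (l D : nat) s : good_at l s ->
  (fixed_count s * (D ^ d) ^ 2 <=
   l * (\sum_(p : box D * box D | p.1 != p.2) logn l (nm (bel p.1 - bel p.2)) +
        fixed_count s * D ^ d))%N.
Proof.
move=> [l_unr [k [rho [rhoP sP]]]].
have lk : l \in [pchar k] by case: rhoP.
have [val [val0 _ valN]] := valuation_exists rhoP l_unr.
pose S := [set g : gal_of {:E} | s (g b) == g b].
pose cl g (p : box D * box D) : nat := rho (g (bel p.1)) == rho (g (bel p.2)).
have hg g : g \in S -> ((D ^ d) ^ 2 <= l * \sum_(p : box D * box D) cl g p)%N.
  rewrite inE => /eqP sg.
  have cP (v : box D) : exists i : 'I_l, rho (g (bel v)) = i%:R.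
    apply: frobenius_fixed_nat => //.
    by rewrite -sP ?gal_el //; apply/alg_int_gal/bel_int.
  have [c cE] := fin_all_exists cP.
  rewrite -card_box; apply: leq_trans (collision_count c) _.
  rewrite leq_mul2l; apply/orP; right; apply: leq_sum => p _.
  rewrite /cl !cE; case: (c p.1 =P c p.2) => [->|_]; by rewrite ?eqxx.
have hp p : p.1 != p.2 -> (\sum_(g in S) cl g p <= logn l (nm (bel p.1 - bel p.2)))%N.
  move=> p12.
  have x0 : bel p.1 - bel p.2 != 0 by rewrite subr_eq0 (inj_eq (@bel_inj D)).
  have x_int : is_alg_int (bel p.1 - bel p.2) by apply: alg_intB; apply: bel_int.
  rewrite valN //; apply: leq_trans (_ : \sum_(g : gal_of {:E}) cl g p <= _)%N.
    by rewrite [X in (_ <= X)%N](bigID (mem S)) /= leq_addr.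
  apply: leq_sum => g _; rewrite /cl.
  have -> : (rho (g (bel p.1)) == rho (g (bel p.2))) = (rho (g (bel p.1 - bel p.2)) == 0).
    rewrite rmorphB (residueB rhoP) ?subr_eq0 //; exact/alg_int_gal/bel_int.
  rewrite -val0; [by case: (val _)|exact: alg_int_gal|by rewrite gal_eq0].
apply: leq_trans (_ : l * (\sum_(p : box D * box D | p.1 != p.2) \sum_(g in S) cl g p + fixed_count s * D ^ d) <= _)%N; last first.
  by rewrite leq_mul2l leq_add2r leq_sum ?orbT.
have -> : (\sum_(p : box D * box D | p.1 != p.2) \sum_(g in S) cl g p + fixed_count s * D ^ d
   = \sum_(g in S) \sum_(p : box D * box D) cl g p)%N.
  rewrite exchange_big /= /fixed_count -sum_nat_const -big_split /=.
  apply: eq_bigr => g _; rewrite [RHS](bigID (fun p => p.1 != p.2)) /=; congr addn.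
  rewrite -card_box -sum1_card.
  rewrite [RHS](eq_bigr (fun=> 1%N)); last first.
    by move=> p; rewrite negbK /cl => /eqP->; rewrite eqxx.
  rewrite -(pair_big_dep xpredT (fun v w : box D => ~~ (v != w)) (fun _ _ => 1%N)) /=.
  apply: eq_bigr => v _; rewrite (big_pred1 v) // => w /=.
  by rewrite negbK eq_sym.
rewrite big_distrr /= /fixed_count -/S -sum_nat_const.
by apply: leq_sum => g gS; apply: hg.
Qed.

Lemma nm_el_bound : exists2 C : nat, (0 < C)%N & forall (D : nat) (v : 'I_d -> int),
  (forall i, `|v i| <= D%:Z) -> (nm (el b v) <= (C * D) ^ N)%N.
Proof.
have [C C0 hC] := size_bound d b_int; exists C => // D v vD.
have := hC D 0%N v vD; rewrite add0r add0n expr0n gtn_eqF ?N_gt0 // !subr0.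
have -> : (C * D)%N%:Z ^+ N = ((C * D) ^ N)%N%:Z by rewrite -!natz natrX.
by rewrite -lez_nat /nm abszE.
Qed.

Variable R : realType.

(** [collision_norm] is multiplied by ln l / (l n^2) and summed over l. Norms at most (C D)^N give
    the main term; the diagonal gives an error of order Y ln Y / n, small only if [Y] is well below
    n, whence two separate parameters. *)
Lemma mertens_upper : exists2 C : nat, (0 < C)%N &
  forall (D Y : nat) (P : pred nat) (s : nat -> gal_of {:E}), (0 < D)%N ->
  (forall l, P l -> prime l /\ good_at l (s l)) ->
  \sum_(0 <= l < Y.+1 | P l) (fixed_count (s l))%:R * (lnn R l / l%:R) <=
    N%:R * lnn R (C * D) + N%:R * Y.+1%:R * lnn R Y / (D ^ d)%:R.
Proof.
have [C C0 hC] := nm_el_bound; exists C => // D Y P s D0 hP.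
set n := (D ^ d)%N; have n0 : (0 < n)%N by rewrite expn_gt0 D0.
have nR : 0 < (n%:R : R) by rewrite ltr0n.
pose lg l (p : box D * box D) := logn l (nm (bel p.1 - bel p.2)).
have up : \sum_(p : box D * box D | p.1 != p.2) \sum_(0 <= l < Y.+1 | P l) (lg l p)%:R * lnn R l
   <= (n ^ 2)%:R * (N%:R * lnn R (C * D)).
  apply: (@le_trans _ _ (\sum_(p : box D * box D) N%:R * lnn R (C * D))); last first.
    by rewrite sumr_const card_prod card_box -/n -[leLHS]mulr_natl expnS expn1.
  rewrite big_mkcond /=; apply: ler_sum => p _; case: ifP => p12; last first.
    by rewrite mulr_ge0 ?lnn_ge0.
  have x0 : bel p.1 - bel p.2 != 0 by rewrite subr_eq0 (inj_eq (@bel_inj D)).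
  have x_int : is_alg_int (bel p.1 - bel p.2) by apply: alg_intB; apply: bel_int.
  apply: le_trans (lnn_prime_sum_le _ _ (nm_gt0 x_int x0) _) _.
    by move=> l /hP[].
  rewrite -lnnX ?muln_gt0 ?C0 //; apply: le_lnn; rewrite elB; apply: hC => i.
  by have := ltn_ord (p.1 i); have := ltn_ord (p.2 i); lia.
have low l : (l < Y.+1)%N -> P l -> (n ^ 2)%:R * ((fixed_count (s l))%:R * (lnn R l / l%:R)) <=
    \sum_(p : box D * box D | p.1 != p.2) (lg l p)%:R * lnn R l +
    n%:R * (N%:R * lnn R Y).
  move=> lY Pl; have [lp gl] := hP l Pl.
  have l0 : 0 < (l%:R : R) by rewrite ltr0n prime_gt0.
  have := collision_norm D gl; rewrite -/n -(ler_nat R) => h.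
  apply: (@le_trans _ _ ((\sum_(p : box D * box D | p.1 != p.2) lg l p +
      fixed_count (s l) * n)%N%:R * lnn R l)).
    have -> : (n ^ 2)%:R * ((fixed_count (s l))%:R * (lnn R l / l%:R)) =
        (fixed_count (s l) * n ^ 2)%:R / l%:R * lnn R l.
      rewrite natrM; move: (lnn R l) (n ^ 2)%:R (fixed_count _)%:R => x y z; ring.
    by rewrite ler_wpM2r ?lnn_ge0 // ler_pdivrMr // mulrC -natrM.
  rewrite natrD natr_sum mulrDl mulr_suml lerD2l natrM -mulrA mulrC -mulrA.
  rewrite ler_wpM2l // mulrC ler_pM ?lnn_ge0 //.
    by rewrite ler_nat fixed_count_le.
  exact: le_lnn.
have n2 : 0 < ((n ^ 2)%:R : R) by rewrite ltr0n expn_gt0 n0.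
rewrite -(ler_pM2l n2) mulr_sumr.
apply: (@le_trans _ _ (\sum_(0 <= l < Y.+1 | P l) (
    \sum_(p : box D * box D | p.1 != p.2) (lg l p)%:R * lnn R l +
    n%:R * (N%:R * lnn R Y)))).
  rewrite [leLHS]big_seq_cond [leRHS]big_seq_cond; apply: ler_sum => l.
  rewrite mem_index_iota => /andP[/andP[_ lY] Pl]; exact: low.
rewrite big_split /= exchange_big /= mulrDr; apply: lerD => //.
have -> : (n ^ 2)%:R * (N%:R * Y.+1%:R * lnn R Y / n%:R) = Y.+1%:R * (n%:R * (N%:R * lnn R Y)) :> R.
  rewrite natrX; move: (lnn R Y) (gt_eqF nR) => x nn; field.
  by rewrite nn.
set t := n%:R * _; have t0 : 0 <= t by rewrite !mulr_ge0 ?lnn_ge0.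
apply: (@le_trans _ _ (\sum_(0 <= l < Y.+1) t)).
  by rewrite big_mkcond /=; apply: ler_sum => l _; case: ifP.
by rewrite big_const_nat subn0 iter_addr_0 mulr_natl.
Qed.

End Box.

(** * Small representatives of residue classes *)

Section SmallResidues.
Variable E : splittingFieldType rat.
Implicit Types (x y : E) (g h : gal_of {:E}).
Variables (H : {group gal_of {:E}}) (b : E).
Hypothesis b_int : is_alg_int b.
Hypothesis bH : forall g, (g b == b) = (g \in H).

Local Notation N := #|{: gal_of {:E}}|.
Local Notation d := #|[set: gal_of {:E}] : H|%g.

Lemma coset_poly_int : exists2 F : {poly int}, F \is monic &
  size F = d.+1 /\ (map_poly intr F).[b] = 0.
Proof.
pose cs := rcosets H [set: gal_of {:E}].
pose f := \prod_(A in cs) ('X - ((repr A : gal_of {:E}) b)%:P).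
have hb h : h \in H -> h b = b by rewrite -bH => /eqP.
have reprE A (a : gal_of {:E}) : A \in cs -> a \in A -> (repr A : gal_of {:E}) b = a b.
  case/rcosetsP => g _ -> /rcosetP[h hH ->].
  have /rcosetP[h' h'H ->] := mem_repr_rcoset H g.
  by rewrite !galMf (hb h') // (hb h).
have [F FE] : exists F : {poly int}, map_poly intr F = f.
  apply: poly_int_lift => i; apply: gal_fixed_int => [|g].
    by apply: alg_int_coef_prod => A; apply: alg_int_gal.
  rewrite -coef_map; suff -> : map_poly g f = f by [].
  have inj : injective (fun A : {set gal_of {:E}} => (A :* g)%g).
    by apply: can_inj (fun A => (A :* g^-1)%g) _ => A; rewrite -rcosetM mulgV rcoset1.
  rewrite rmorph_prod /f [RHS](reindex_inj inj) /=.
  have csg A : ((A :* g)%g \in cs) = (A \in cs).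
    apply/rcosetsP/rcosetsP => -[h _ hE]; last by exists (h * g)%g; rewrite // hE rcosetM.
    by exists (h * g^-1)%g; rewrite // rcosetM -hE -rcosetM mulgV rcoset1.
  apply: eq_big => [A|A Acs]; first by rewrite csg.
  rewrite rmorphB /= map_polyX map_polyC /= -galMf.
  congr (_ - _%:P); apply/esym/reprE; first by rewrite csg.
  by rewrite mem_rcoset mulgK; case/rcosetsP: Acs => h _ ->; apply: mem_repr_rcoset.
have f_monic : f \is monic by apply: monic_prod_XsubC.
exists F.
  by rewrite monicE; apply/eqP/(@intrE_inj E); rewrite -(lead_coef_map_inj (@intrE_inj E)) // FE; apply/monicP.
split; last first.
  rewrite FE /f horner_prod (bigD1 (H : {set _})) /=; last first.
    by apply/rcosetsP; exists 1%g; rewrite ?rcoset1.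
  rewrite hornerXsubC (@reprE _ 1%g) ?group1 ?gal_id ?subrr ?mul0r //.
  by apply/rcosetsP; exists 1%g; rewrite ?rcoset1.
rewrite -(size_map_inj_poly (@intrE_inj E)) // FE /f -big_enum /= size_prod_XsubC.
by rewrite -cardE.
Qed.

Lemma poly_el (P : {poly int}) : exists v : 'I_d -> int, (map_poly intr P).[b] = el b v.
Proof.
have [F Fm [sF Fb]] := coset_poly_int.
exists (fun i => (Pdiv.Ring.rmodp P F)`_i).
rewrite {1}(Pdiv.RingMonic.rdivp_eq Fm P) rmorphD rmorphM /= hornerD hornerM Fb mulr0 add0r.
have sz : (size (Pdiv.Ring.rmodp P F) <= d)%N.
  by rewrite -ltnS -sF Pdiv.Ring.ltn_rmodpN0 // monic_neq0.
rewrite (@horner_coef_wide _ d); last by apply: leq_trans (size_poly _ _) sz.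
by apply: eq_bigr => i _; rewrite coef_map.
Qed.

Lemma el_inj (v w : 'I_d -> int) : el b v = el b w -> v =1 w.
Proof.
move=> /eqP; rewrite -subr_eq0 elB => /eqP/(el_eq0 bH) vw i.
by apply/eqP; rewrite -subr_eq0 vw.
Qed.

Lemma el_lin (I : finType) (c : I -> int) (v : I -> 'I_d -> int) :
  \sum_i (c i)%:~R * el b (v i) = el b (fun j => \sum_i c i * v i j).
Proof.
rewrite /el; under eq_bigr do rewrite mulr_sumr.
rewrite exchange_big /=; apply: eq_bigr => j _.
by rewrite rmorph_sum mulr_suml; apply: eq_bigr => i _; rewrite /= intrM mulrA.
Qed.

Lemma el_mul_bound : exists C : nat, forall (t : nat) (v : 'I_d -> int) (j : 'I_d),
  (forall i, `|v i| <= t%:Z) ->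
  exists2 w : 'I_d -> int, el b w = el b v * b ^+ j & forall i, `|w i| <= (C * t)%N%:Z.
Proof.
have ex (m : nat) : exists v : 'I_d -> int, b ^+ m = el b v.
  by have [v vE] := poly_el 'X^m; exists v; rewrite -vE map_polyXn hornerXn.
have [e eE] : exists e : nat -> 'I_d -> int, forall m, b ^+ m = el b (e m).
  by case/choice: ex => e eE; exists e.
pose C := (\sum_(i < d) \sum_(j < d) \sum_(k < d) `|e (i + j)%N k|)%N.
exists C => t v j vt.
exists (fun k => \sum_(i < d) v i * e (i + j)%N k).
  rewrite -(@el_lin _ v (fun i => e (i + j)%N)) {2}/el mulr_suml; apply: eq_bigr => i _.
  by rewrite -eE -mulrA exprD.
move=> k; apply: le_trans (ler_norm_sum _ _ _) _.
apply: (@le_trans _ _ (\sum_(i < d) t%:Z * `|e (i + j)%N k|)).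
  by apply: ler_sum => i _; rewrite normrM ler_wpM2r.
rewrite -mulr_sumr PoszM mulrC ler_wpM2r // /C.
rewrite (big_morph Posz PoszD (erefl _)).
apply: ler_sum => i _; rewrite (bigD1 j) //= (bigD1 k) //= !PoszD abszE -addrA lerDl.
by [].
Qed.

Lemma el_inv (v : 'I_d -> int) : el b v != 0 ->
  exists (M : nat) (r : 'I_d -> int), (0 < M)%N /\ M%:R = el b v * el b r.
Proof.
move=> y0.
have elQ (w : 'I_d -> int) : el b w \in <<1; b>>%VS.
  apply: rpred_sum => i _; apply: rpredM; first exact: rpred_int.
  by apply: rpredX; apply: memv_adjoin.
have : (el b v)^-1 \in <<1; b>>%VS by rewrite rpredV elQ.
case/Fadjoin_polyP => p /polyOver1P[q ->] yE.
have [P [a a0 PE]] := rat_poly_scale q.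
have [r rE] := poly_el (a *: P).
(* The value of [P] at b is a divided by [el b v]; one more factor a makes the product the positive
   integer a^2. *)
exists (`|a| ^ 2)%N, r; split; first by rewrite expn_gt0 absz_gt0 a0.
rewrite -rE linearZ /= hornerZ.
have PbE : (map_poly intr P).[b] = a%:~R * (el b v)^-1.
  rewrite yE PE -[X in X * _](rmorph_int (in_alg E)) /= linearZ /= hornerZ.
  rewrite -[in_alg E _ * _]/(a%:~R%:A * _) -scalerAl mul1r.
  rewrite [X in _ *: X]mulr_algl scalerA mulfV ?intr_eq0 // scale1r.
  congr (_.[_]); rewrite -map_poly_comp; apply: eq_map_poly => z /=.
  by rewrite -(rmorph_int (in_alg E)).
rewrite PbE mulrC mulrA divfK // -intrM.
rewrite -[LHS]/((`|a| ^ 2)%N%:Z%:~R); congr (_%:~R).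
by rewrite expnS expn1 PoszM abszE -normrM ger0_norm // -expr2 sqr_ge0.
Qed.

(* The representative of [n] modulo [y] is [n - y * floor (n / y)]. *)
Lemma small_residues : exists C : nat, forall (t : nat) (v : 'I_d -> int) (n : nat),
  (forall i, `|v i| <= t%:Z) -> el b v != 0 ->
  exists r q : 'I_d -> int, n%:R - el b r = el b v * el b q /\ forall i, `|r i| <= (C * t)%N%:Z.
Proof.
have [C hC] := el_mul_bound; exists (d * C)%N => t v n vt y0.
have [M [r [M0 ME]]] := el_inv y0.
have M0R : (M%:R : E) != 0 by rewrite natrE_eq0 -lt0n.
(* In coordinates n / y = n r / M: q is the floor and m / M the fractional part, so n - y q = y m /
   M is bounded in terms of the y b^j alone, whatever n is. *)
pose q i := ((n%:Z * r i) %/ M)%Z; pose m i := ((n%:Z * r i) %% M)%Z.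
have qm i : n%:Z * r i = q i * M + m i by exact: divz_eq.
have m0 i : 0 <= m i by rewrite modz_ge0 // eqz_nat -lt0n.
have mM i : m i <= M%:Z by rewrite ltW // ltz_pmod.
have [w wP] : exists w : 'I_d -> 'I_d -> int, forall j, el b (w j) = el b v * b ^+ j /\ (forall i, `|w j i| <= (C * t)%N%:Z).
  have h (j : 'I_d) : exists w : 'I_d -> int, el b w = el b v * b ^+ j /\ (forall i, `|w i| <= (C * t)%N%:Z).
    by have [w w1 w2] := hC t v j vt; exists w.
  by have [w wP] := fin_all_exists h; exists w.
have [n_ n_E] : exists v : 'I_d -> int, (n%:R : E) = el b v.
  by have [v' v'E] := poly_el n%:Z%:P; exists v'; rewrite -v'E map_polyC hornerC.
pose yq k := \sum_j q j * w j k.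
have yqE : el b v * el b q = el b yq.
  rewrite -el_lin [el b q]/el mulr_sumr; apply: eq_bigr => j _.
  by have [-> _] := wP j; rewrite mulrCA.
exists (fun i => n_ i - yq i), q; split.
  by rewrite -elB -n_E -yqE opprB addrCA subrr addr0.
have key i : M%:Z * (n_ i - yq i) = \sum_j m j * w j i.
  move: i; apply: el_inj; rewrite -el_lin.
  transitivity (M%:R * (n%:R - el b v * el b q)).
    rewrite n_E yqE elB /el mulr_sumr; apply: eq_bigr => i _.
    by rewrite intrM mulrA.
  rewrite mulrBr {1}ME -[el b v * el b r * _]mulrA [M%:R * _]mulrCA -mulrBr.
  have -> : el b r * n%:R - M%:R * el b q = el b m.
    rewrite /el mulr_suml mulr_sumr -sumrB; apply: eq_bigr => j _.
    rewrite mulrAC mulrA -mulrBl; congr (_ * _).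
    have := congr1 (fun z : int => z%:~R : E) (qm j); rewrite /= intrD !intrM.
    by rewrite [X in X = _]mulrC -[n%:Z%:~R]/(n%:R : E) => ->; rewrite mulrC -[M%:Z%:~R]/(M%:R : E) addrC addKr.
  rewrite [el b m]/el mulr_sumr; apply: eq_bigr => j _.
  by have [-> _] := wP j; rewrite mulrCA.
move=> i; have MZ : 0 < M%:Z :> int by rewrite ltz_nat.
rewrite -(ler_pM2l MZ) -[X in X * _ <= _](gtr0_norm MZ) -normrM key.
apply: le_trans (ler_norm_sum _ _ _) _.
apply: (@le_trans _ _ (\sum_(j < d) M%:Z * (C * t)%N%:Z)).
  apply: ler_sum => j _; rewrite normrM (ger0_norm (m0 j)) ler_pM //.
  by have [_] := wP j; apply.
rewrite sumr_const card_ord -mulr_natr natz -mulrA -!PoszM lez_nat.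
by rewrite [(C * t * _)%N]mulnC -[(_ * C * t)%N]mulnA leqnn.
Qed.

End SmallResidues.

(** * Counting box elements in prime ideals *)

(** A Bernoulli inequality: for W / U <= 1 / (4k), induction on j gives (1 + W / U)^j <= 4k / (4k -
    j), which is 4/3 at j = k. This is the source of the factor 4/3 in the lower bound. *)
Lemma pow_perturb (k U W : nat) : (4 * k * W <= U)%N -> (3 * (U + W) ^ k <= 4 * U ^ k)%N.
Proof.
case: (posnP k) => [->|k0 h]; first by rewrite !expn0.
have key j : (j <= k)%N -> ((U + W) ^ j * (4 * k - j) <= U ^ j * (4 * k))%N.
  elim: j => [|j IH] jk; first by rewrite subn0.
  rewrite [in X in (X <= _)%N]expnS expnS -mulnA mulnCA.
  apply: (@leq_trans ((U + W) ^ j * (U * (4 * k - j)))).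
    rewrite leq_mul2l; apply/orP; right.
    have : (W * (4 * k - j.+1) <= U)%N.
      by apply: leq_trans h; rewrite mulnC leq_mul2r leq_subr orbT.
    have -> : (4 * k - j = (4 * k - j.+1).+1)%N by lia.
    rewrite mulnDl mulnS; lia.
  by rewrite mulnCA -mulnA leq_mul2l IH ?orbT // ltnW.
have := key k (leqnn k); have -> : (4 * k - k = 3 * k)%N by lia.
rewrite !mulnA leq_pmul2r //; lia.
Qed.

Section Counting.
Variable E : splittingFieldType rat.
Implicit Types (x y : E) (g h : gal_of {:E}).
Variables (H : {group gal_of {:E}}) (b : E).
Hypothesis b_int : is_alg_int b.
Hypothesis bH : forall g, (g b == b) = (g \in H).

Local Notation N := #|{: gal_of {:E}}|.
Local Notation d := #|[set: gal_of {:E}] : H|%g.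
Local Notation box := (box H).
Local Notation bel := (bel b).

(* Two elements of [X] cannot lie in the same cell of side [t] if [(C t) ^ d < q]. *)
Lemma sparse_count : exists2 C : nat, (0 < C)%N & forall (D q C2 : nat) (X : {set box D}),
  {in X &, forall v w, v != w -> (q ^ #|H| <= nm (bel v - bel w))%N} ->
  (q <= (C2 * D) ^ d)%N -> (#|X| * q <= ((1 + C2) * (2 * C)) ^ d * D ^ d)%N.
Proof.
have [C C0 hC] := nm_el_bound H b_int; exists C => // D q C2 X hX qD.
have d0 := d_gt0 H.
case: (leqP q (C ^ d)) => [qC|Cq].
  apply: (@leq_trans (D ^ d * C ^ d)).
    by rewrite leq_mul // -(card_box H D) max_card.
  rewrite mulnC leq_mul2r; apply/orP; right; rewrite leq_exp2r //.
  by rewrite mulnA -[X in (X <= _)%N]mul1n leq_mul2r; apply/orP; right; lia.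
(* The largest admissible cell side t: maximality gives q <= (C (t + 1))^d, which combines with the
   number (D / t + 1)^d of cells to bound [#|X| * q]. *)
pose P t := ((C * t) ^ d < q)%N.
have exP : exists t, P t by exists 1%N; rewrite /P muln1.
have ubP t : P t -> (t <= q)%N.
  move=> /ltnW; apply: leq_trans; apply: (@leq_trans (C * t)); first by rewrite leq_pmull.
  case: (posnP (C * t)%N) => [->//|ct]; rewrite -[X in (X <= _)%N]expn1.
  by rewrite leq_pexp2l.
have [t tq tmax] := ex_maxnP exP ubP.
have t1 : (1 <= t)%N by apply: tmax; rewrite /P muln1.
have qt : (q <= (C * t.+1) ^ d)%N.
  by rewrite leqNgt; apply/negP => /tmax; rewrite ltnn.
have ctD : (C * t < C2 * D)%N.
  by rewrite -(ltn_exp2r _ _ d0); apply: leq_trans qD.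
have tD : (t <= C2 * D)%N by apply: leq_trans (ltnW ctD); rewrite leq_pmull.
have cX : (#|X| <= (D %/ t).+1 ^ d)%N.
  pose f (v : box D) : {ffun 'I_d -> 'I_(D %/ t).+1} := [ffun i => inord (v i %/ t)].
  have f_inj : {in X &, injective f}.
    move=> v w vX wX fvw; apply/eqP; apply: contraT => vw.
    have := hX v w vX wX vw; rewrite leqNgt => /negP[].
    apply: leq_ltn_trans (_ : ((C * t) ^ d) ^ #|H| < _)%N; last first.
      by rewrite ltn_exp2r ?cardG_gt0.
    rewrite -expnM [(d * #|H|)%N]mulnC -N_eq elB; apply: hC => i.
    have /(congr1 val) : f v i = f w i by rewrite fvw.
    rewrite !ffunE /= !inordK ?ltnS ?leq_div2r ?(ltnW (ltn_ord _)) // => e.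
    have := divn_eq (v i) t; have := divn_eq (w i) t.
    have := ltn_pmod (v i) t1; have := ltn_pmod (w i) t1; rewrite e.
    move: (w i %/ t * t)%N => z; lia.
  by rewrite -(card_in_imset f_inj) (leq_trans (max_card _)) // card_ffun !card_ord.
apply: (@leq_trans ((D %/ t).+1 ^ d * (C * t.+1) ^ d)); first exact: leq_mul.
rewrite -!expnMn leq_exp2r //.
have h1 : ((D %/ t) * t <= D)%N by apply: leq_trunc_div.
apply: (@leq_trans ((2 * C) * (((D %/ t).+1) * t))).
  have t2 : (t.+1 <= 2 * t)%N by lia.
  have := leq_mul (leqnn ((D %/ t).+1 * C)) t2.
  move: (D %/ t).+1 => Q; lia.
rewrite mulSn [X in (_ <= X)%N]mulnAC [X in (_ <= X)%N]mulnC leq_mul2l; apply/orP; right.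
lia.
Qed.

Section AtPlace.
Variables (l : nat) (k : fieldType) (rho : E -> k) (s : gal_of {:E}) (val : E -> nat).
Hypothesis rhoP : is_residue_map l rho.
Hypothesis sP : is_frobenius l rho s.
Hypothesis val0 : forall x, is_alg_int x -> x != 0 -> (0 < val x)%N = (rho x == 0).
Hypothesis valN : forall x, is_alg_int x -> x != 0 ->
    logn l (nm x) = (\sum_(g : gal_of {:E}) val (g x))%N.

(** As x is fixed by [H], the valuation of its conjugates is constant on the right coset H g. *)
Lemma val_norm g x : is_alg_int x -> x != 0 -> {in H, forall h, h x = x} ->
  (val (g x) * #|H| <= logn l (nm x))%N.
Proof.
move=> hx x0 xH; rewrite valN // mulnC -(card_rcoset H g) -sum_nat_const.
rewrite [X in (_ <= X)%N](bigID (mem (H :* g)%g)) /=.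
apply: leq_trans (leq_addr _ _); apply: leq_sum => _ /rcosetP[h hH ->].
by rewrite galMf (xH h hH).
Qed.

(** The Frobenius element carries a conjugate of residue 0 to another one. When [s] moves g b, the
    cosets H g and H g s are distinct and both contribute: this is the case of a prime of degree at
    least 2. *)
Lemma val_norm2 g x : is_alg_int x -> x != 0 -> {in H, forall h, h x = x} ->
  s (g b) != g b -> (0 < val (g x))%N -> (2 * #|H| <= logn l (nm x))%N.
Proof.
move=> hx x0 xH sg v0; rewrite valN // mul2n -addnn.
have gx_int : is_alg_int (g x) by apply: alg_int_gal.
have gx0 : g x != 0 by rewrite gal_eq0.
have rgx : rho (g x) = 0 by apply/eqP; rewrite -val0.
have v1 : (0 < val ((g * s)%g x))%N.
  rewrite galMf val0; [|exact: alg_int_gal|by rewrite gal_eq0].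
  by rewrite sP // rgx expr0n gtn_eqF ?prime_gt0 ?(residue_prime rhoP).
rewrite [X in (_ <= X)%N](bigID (mem (H :* g)%g)) /=; apply: leq_add.
  rewrite -(card_rcoset H g) -sum1_card; apply: leq_sum => _ /rcosetP[h hH ->].
  by rewrite galMf (xH h hH).
rewrite [X in (_ <= X)%N](bigID (mem (H :* (g * s))%g)) /=.
apply: leq_trans (leq_addr _ _); rewrite -(card_rcoset H (g * s)%g) -sum1_card.
rewrite [X in (_ <= X)%N](eq_bigl (mem (H :* (g * s))%g)); last first.
  move=> f /=; case: (boolP (f \in (H :* (g * s))%g)) => [fs|]; rewrite ?andbF ?andbT //.
  apply: contra sg => fg.
  have e : (H :* g = H :* (g * s))%g by rewrite -(rcoset_eqP fg) -(rcoset_eqP fs).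
  have : (g * s \in H :* g)%g by rewrite e rcoset_refl.
  rewrite mem_rcoset -bH !galMf => /eqP e1.
  by have := congr1 (fun z => g z) e1; rewrite /= galKV => ->.
apply: leq_sum => _ /rcosetP[h hH ->].
by rewrite galMf (xH h hH).
Qed.

End AtPlace.

(* Adding to each [v] the [l] small representatives of the residue classes modulo a small element
   of the prime gives an injection into a slightly larger box. *)
Lemma sharp_count : exists C : nat, forall (l : nat) (k : fieldType) (rho : E -> k) (s g : gal_of {:E}) (D U c t : nat),
  is_residue_map l rho -> is_frobenius l rho s -> ~~ (l %| c)%N -> s (g b) = g b ->
  (l < t ^ d)%N ->
  (#|[set v : box D | rho (g (U%:R + c%:R * bel v)%R) == 0%R]| * l <= (D + 2 * (C * t)) ^ d)%N.
Proof.
have [C hC] := small_residues b_int bH; exists C => l k rho s g D U c t rhoP sP lc sg lt.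
have lk : l \in [pchar k] by case: rhoP.
have rg := residue_map_gal rhoP g.
pose r x := rho (g x).
have cls n (v : 'I_n -> int) : exists i : 'I_l, r (el b v) = i%:R.
  apply: frobenius_fixed_nat => //.
  by rewrite /r -sP ?gal_el //; apply/alg_int_gal/el_int.
(* Among more than l elements of a box of side t, two have the same residue; y is their
   difference. *)
have [y [yt y0 ry]] : exists y : 'I_d -> int, [/\ (forall i, `|y i| <= t%:Z), el b y != 0 & r (el b y) = 0].
  have [f fE] := fin_all_exists (fun v : box t => cls _ (fun i => (v i : nat)%:Z)).
  have /injectivePn[v [w vw fvw]] : ~~ injectiveb f.
    apply/negP => /injectiveP/leq_card; rewrite card_box card_ord leqNgt lt.
    by [].
  exists (fun i => (v i : nat)%:Z - (w i : nat)%:Z); split.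
  - by move=> i; have := ltn_ord (v i); have := ltn_ord (w i); lia.
  - rewrite -elB subr_eq0; apply: contra vw => /eqP e.
    by apply/eqP/(bel_inj bH e).
  rewrite -elB /r (residueB rg); [|exact: el_int|exact: el_int].
  by rewrite -/(r _) -/(r _) !fE fvw subrr.
have ex (j : 'I_l) : exists z : 'I_d -> int, r (el b z) = j%:R /\ forall i, `|z i| <= (C * t)%N%:Z.
  have [z [q [zE zb]]] := hC t y j yt y0; exists z; split=> //.
  have : r (j%:R - el b z) = r (el b y * el b q) by rewrite zE.
  rewrite /r (residueB rg) ?(residueM rg) ?(residue_nat rg); try exact: el_int; last exact: alg_int_nat.
  rewrite -/(r _) -/(r _) -/(r _) ry mul0r => /eqP; rewrite subr_eq0 => /eqP ->//.
have [z zP] := fin_all_exists ex.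
set X := [set v | _]; set T := (C * t)%N in zP *.
pose coord (p : box D * 'I_l) (i : 'I_d) : nat := absz ((p.1 i : nat)%:Z + z p.2 i + T%:Z).
have cE p i : (coord p i)%:Z = (p.1 i : nat)%:Z + z p.2 i + T%:Z.
  by rewrite /coord; have [_ /(_ i)] := zP p.2; lia.
have cb p i : (coord p i < D + 2 * T)%N.
  by have := cE p i; have [_ /(_ i)] := zP p.2; have := ltn_ord (p.1 i); lia.
pose f p : {ffun 'I_d -> 'I_(D + 2 * T)} := [ffun i => Ordinal (cb p i)].
have f_inj : {in setX X [set: 'I_l] &, injective f}.
  move=> [v j] [w j'] /setXP[vX _] /setXP[wX _] fe.
  have e i : (v i : nat)%:Z + z j i = (w i : nat)%:Z + z j' i.
    have /(congr1 val) := congr1 (fun h : {ffun _} => h i) fe.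
    rewrite !ffunE /= => /(congr1 Posz); rewrite !cE /= => /addIr //.
  have elE : bel v + el b (z j) = bel w + el b (z j').
    rewrite /bel /el -!big_split; apply: eq_bigr => i _ /=.
    by rewrite -!mulrDl -!intrD e.
  (* All elements of [X] have the same residue -U / c, so the residue of v + z_j determines j. *)
  have rX (v' : box D) : v' \in X -> c%:R * r (bel v') = - U%:R.
    have bi := bel_int b_int v'; have ci := alg_int_nat E c.
    have cbi := alg_intM ci bi; have Ui := alg_int_nat E U.
    rewrite inE -/(r _) /r (residueD rg Ui cbi) (residueM rg ci bi) !(residue_nat rg).
    by rewrite addrC addr_eq0 => /eqP.
  have c0 : (c%:R : k) != 0 by rewrite -(dvdn_pcharf lk).
  have rvw : r (bel v) = r (bel w) by apply: (mulfI c0); rewrite !rX.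
  have /(congr1 r) := elE; rewrite /r (residueD rg) ?(residueD rg); try exact: el_int; try exact: bel_int.
  rewrite -/(r _) -/(r _) -/(r _) -/(r _) rvw => /addrI.
  have [-> _] := zP j; have [-> _] := zP j' => jj'.
  have jE : j = j'.
    apply: val_inj => /=; move: jj'; clear e elE fe; wlog le : j j' / (j <= j')%N.
      by move=> h e; case: (leqP j j') => [|/ltnW] le; [apply: h|apply/esym/h].
    move=> e; have /eqP : ((j' - j)%N%:R : k) = 0 by rewrite natrB // e subrr.
    rewrite -(dvdn_pcharf lk) => dv; case: (posnP (j' - j)%N) => [|ji]; first by lia.
    by have := dvdn_leq ji dv; have := ltn_ord j'; lia.
  rewrite jE in elE *; congr (_, _); apply: (bel_inj bH); apply: addIr elE.
have := leq_trans (max_card (f @: setX X [set: 'I_l])) (leqnn _).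
by rewrite (card_in_imset f_inj) cardsX cardsT card_ffun !card_ord.
Qed.

End Counting.

(** * Contribution of one prime to the norms *)

Section Lower.
Variable E : splittingFieldType rat.
Implicit Types (x y : E) (g h : gal_of {:E}).
Variables (H : {group gal_of {:E}}) (b : E).
Hypothesis b_int : is_alg_int b.
Hypothesis bH : forall g, (g b == b) = (g \in H).

Local Notation N := #|{: gal_of {:E}}|.
Local Notation d := #|[set: gal_of {:E}] : H|%g.
Local Notation box := (box H).
Local Notation bel := (bel b).

(** The product of the conjugates is again 1 + B z with z integral; as it is a rational integer, so
    is z, and the signed norm is 1 modulo B. *)
Lemma norm_congr1 (B : nat) y : is_alg_int y -> (0 < B)%N ->
  coprime (nm (1 + B%:R * y)) B.
Proof.
move=> hy B0.
have B_int := alg_int_nat E B.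
have x_int : is_alg_int (1 + B%:R * y).
  by apply: alg_intD; [apply: alg_int1|apply: alg_intM].
have [z hz zE] : exists2 z, is_alg_int z & Nm (1 + B%:R * y) = 1 + B%:R * z.
  rewrite /Nm; elim: (index_enum _) => [|g r [z hz zE]].
    by exists 0; [apply: alg_int0|rewrite big_nil mulr0 addr0].
  exists (g y + z + B%:R * g y * z).
    by do ?[apply: alg_intD | apply: alg_intM | apply: alg_int_gal | done].
  rewrite big_cons zE rmorphD rmorph1 rmorphM rmorph_nat /=.
  by move: (g y) (B%:R) => u v; ring.
have zE' : (nmz (1 + B%:R * y) - 1)%:~R = B%:R * z by rewrite intrB -nmzE // zE addrC addKr.
have [w [wE _]] := rat_int_alg hz B0 zE'.
have nE : nmz (1 + B%:R * y) = 1 + B%:Z * w by rewrite -wE [RHS]addrC subrK.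
rewrite /nm nE; change (coprimez (1 + B%:Z * w) B%:Z).
by apply/coprimezP; exists (1, - w); rewrite /=; ring.
Qed.

(* The shift by a large multiple of [D] bounds the norm from below, and the congruence modulo [B]
   removes the bad primes from it. *)
Lemma shift_norm (B : nat) : (0 < B)%N ->
  exists u C2 : nat, forall (D : nat) (v : box D), (0 < D)%N ->
    let x := (1 + B * (u * D))%N%:R + B%:R * bel v in
    [/\ is_alg_int x, x != 0, (D ^ N <= nm x)%N, (nm x <= (C2 * D) ^ N)%N & coprime (nm x) B].
Proof.
move=> B0; have [c c0 hc] := size_bound d b_int.
have N0 := N_gt0 E.
(* The multiple 4 N c meets the hypothesis of [pow_perturb] for exponent N and perturbation c B D:
   the norm then differs from U^N by at most a third of it. *)
exists (4 * N * c)%N, (1 + B * (4 * N * c) + c * B)%N => D v D0 x.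
set U := (1 + _)%N in x *.
have x_int : is_alg_int x.
  apply: alg_intD; [exact: alg_int_nat|apply: alg_intM; [exact: alg_int_nat|exact: bel_int]].
have xE : x = U%:R + el b (fun i => (B * v i)%N%:Z).
  congr (_ + _); rewrite /bel /el mulr_sumr; apply: eq_bigr => i _.
  by rewrite mulrA PoszM intrM.
have := hc (B * D)%N U (fun i => (B * v i)%N%:Z).
rewrite -xE => h.
have {h} h : `|nmz x - U%:Z ^+ N| <= (U + c * (B * D))%N%:Z ^+ N - U%:Z ^+ N.
  by apply: h => i; rewrite ger0_norm // lez_nat leq_mul2l ltnW ?orbT.
have pw : (3 * (U + c * (B * D)) ^ N <= 4 * U ^ N)%N.
  apply: pow_perturb; rewrite /U; lia.
have U2 : (2 * D ^ N <= U ^ N)%N.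
  apply: (@leq_trans ((2 * D) ^ N)).
    rewrite expnMn leq_mul2r; apply/orP; right.
    by rewrite -[X in (X <= _)%N]expn1 leq_pexp2l.
  rewrite leq_exp2r // /U.
  have : (1 * 1 * 1 <= B * N * c)%N by rewrite !leq_mul.
  move=> h1; have := leq_mul h1 (leqnn D); lia.
have toZ (a n : nat) : a%:Z ^+ n = (a ^ n)%N%:Z by rewrite -!natz natrX.
rewrite !toZ in h.
move: pw h U2; set a := (U ^ N)%N; set a' := ((U + _) ^ N)%N => pw h U2.
have nlow : (D ^ N <= nm x)%N by rewrite /nm; lia.
split=> //.
- apply: contraTneq nlow => ->; rewrite -ltnNge.
  have -> : nm (0 : E) = 0%N.
    rewrite /nm; have /eqP := nmzE (alg_int0 E).
    have -> : Nm (0 : E) = 0 by apply/eqP; rewrite Nm_eq0.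
    by rewrite -[0]/(0%:~R) (inj_eq (@intrE_inj E)) => /eqP <-.
  by rewrite expn_gt0 D0.
- have : (nm x <= a')%N by rewrite /nm; lia.
  move/leq_trans; apply; rewrite leq_exp2r // /U.
  have : (B * (4 * N * c * D) = B * (4 * N * c) * D)%N by rewrite !mulnA.
  move=> ->; rewrite !mulnDl mul1n !mulnA; lia.
have -> : x = 1 + B%:R * ((4 * N * c * D)%N%:R + bel v).
  by rewrite /x /U natrD [(B * _)%:R]natrM mulrDr addrA.
apply: norm_congr1 => //.
by apply: alg_intD; [apply: alg_int_nat|apply: bel_int].
Qed.

Variable R : realType.

(** Count by levels: the sum of f is the sum over k >= 1 of the number of v with f >= k. Only level
    1 at the g with s (g b) = g b is of order n / l, and it carries the parameter [al]. The rest is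
    O(n / l^2), with 3 = 1 + 2 for level 1 at the other g and for the geometric tail. *)
Lemma prime_contribution (l : nat) (s : gal_of {:E}) (D X0 C : nat) (al : R)
    (f : box D -> gal_of {:E} -> nat) : (1 < l)%N ->
  (forall v g, f v g <= X0)%N -> 0 <= al ->
  (forall k g, 0 < k -> #|[set v | k <= f v g]| * l ^ k <= C * D ^ d)%N ->
  (forall g, s (g b) != g b -> #|[set v | 0 < f v g]| * l ^ 2 <= C * D ^ d)%N ->
  (forall g, s (g b) = g b -> (#|[set v | (0 < f v g)%N]| * l)%N%:R <= al * (D ^ d)%:R) ->
  (\sum_(v : box D) \sum_(g : gal_of {:E}) f v g)%N%:R <=
    (D ^ d)%:R * ((fixed_count b s)%:R * (al / l%:R) + 3 * (N * C)%:R / l%:R ^+ 2).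
Proof.
move=> l1 fX al0 hk hn hs; set n := (D ^ d)%N.
pose c k g := #|[set v | (k <= f v g)%N]|.
have l0 : 0 < (l%:R : R) by rewrite ltr0n ltnW.
have fE v g : (f v g = \sum_(1 <= k < X0.+1) (k <= f v g))%N.
  rewrite (@big_cat_nat _ _ _ (f v g).+1) //=; last by rewrite ltnS.
  rewrite [X in (_ + X)%N]big_nat_cond [X in (_ + X)%N]big1 ?addn0; last first.
    by move=> k /andP[/andP[k1 _] _]; rewrite leqNgt k1.
  rewrite big_nat_cond (eq_bigr (fun=> 1%N)); last first.
    by move=> k /andP[/andP[_ k1] _]; rewrite -ltnS k1.
  by rewrite -big_nat_cond sum_nat_const_nat muln1 subSS subn0.
have sumE g : (\sum_(v : box D) f v g = c 1 g + \sum_(2 <= k < X0.+1) c k g)%N.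
  have cE k : (c k g = \sum_(v : box D) (k <= f v g))%N.
    by rewrite /c -sum1_card big_mkcond /=; apply: eq_bigr => v _; rewrite inE; case: leqP.
  rewrite [X in (_ + X)%N](eq_bigr (fun k => \sum_(v : box D) (k <= f v g))%N) //.
  rewrite (eq_bigr (fun v => \sum_(1 <= k < X0.+1) (k <= f v g))%N) //.
  rewrite exchange_big /=; case: (posnP X0) => [X00|X0p].
    rewrite X00 !big_geq // cE big1 // => v _.
    by have := fX v g; rewrite X00 leqn0 => /eqP ->.
  by rewrite big_ltn ?ltnS // cE.
have tail g : (\sum_(2 <= k < X0.+1) c k g)%N%:R <= 2 * (C * n)%:R / l%:R ^+ 2 :> R.
  have geo X : \sum_(2 <= k < X.+2) (l%:R ^- k : R) <= 2 / l%:R ^+ 2 - 2 / l%:R ^+ X.+2.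
    elim: X => [|X IH]; first by rewrite big_geq // subrr.
    rewrite big_nat_recr //=; apply: le_trans (lerD IH (lexx _)) _.
    have : 2 / l%:R ^+ X.+3 <= (l%:R ^- X.+2 : R).
      rewrite exprS invfM mulrA; apply: ler_piMl; first by rewrite invr_ge0 exprn_ge0 // ltW.
      by rewrite ler_pdivrMr // mul1r ler_nat.
    by move: (2 / l%:R ^+ X.+3) (l%:R ^- X.+2) (2 / l%:R ^+ 2) => y z w; lra.
  rewrite natr_sum; apply: (@le_trans _ _ (\sum_(2 <= k < X0.+1) (C * n)%:R * l%:R ^- k)).
    rewrite [leLHS]big_nat [leRHS]big_nat; apply: ler_sum => k /andP[k2 _].
    rewrite ler_pdivlMr ?exprn_gt0 // -natrX -natrM ler_nat; apply: hk; exact: ltnW.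
  rewrite -mulr_sumr; case: (posnP X0) => [->|X0p].
    by rewrite big_geq // mulr0 !mulr_ge0 // invr_ge0 exprn_ge0 // ltW.
  rewrite -(prednK X0p) [2 * _]mulrC -mulrA ler_wpM2l //.
  apply: le_trans (geo _) _; by rewrite gerBl divr_ge0 // exprn_ge0.
rewrite exchange_big /= natr_sum.
have fc : (\sum_(g : gal_of {:E}) (s (g b) == g b) = fixed_count b s)%N.
  by rewrite /fixed_count -sum1_card [RHS]big_mkcond /=; apply: eq_bigr => g _; rewrite inE; case: eqP.
have -> : n%:R * ((fixed_count b s)%:R * (al / l%:R) + 3 * (N * C)%:R / l%:R ^+ 2) =
   \sum_(g : gal_of {:E}) (((s (g b) == g b) : nat)%:R * (al * n%:R / l%:R) +
      3 * (C * n)%:R / l%:R ^+ 2).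
  rewrite big_split /= -mulr_suml -natr_sum fc sumr_const mulrDr.
  congr (_ + _); first by move: (fixed_count b s)%:R (n%:R) (l%:R^-1) => x y z; ring.
  rewrite !natrM -[RHS]mulr_natl -[#|xpredT|]/(#|{: gal_of {:E}}|).
  by move: (l%:R ^+ 2)^-1 (N%:R : R) (n%:R : R) (C%:R : R) => z w y t; ring.
apply: ler_sum => g _; rewrite sumE natrD.
have t3 : 3 * (C * n)%:R / l%:R ^+ 2 = (C * n)%:R / l%:R ^+ 2 + 2 * (C * n)%:R / l%:R ^+ 2 :> R.
  by move: (l%:R ^+ 2)^-1 => z; ring.
rewrite t3 addrA; apply: lerD => //.
have t0 : 0 <= (C * n)%:R / l%:R ^+ 2 :> R by rewrite mulr_ge0 // invr_ge0 exprn_ge0 // ltW.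
case: eqP => [sg|/eqP sg].
  rewrite mul1r; apply: ler_wpDr => //; rewrite ler_pdivlMr // -natrM.
  exact: hs.
by rewrite mul0r add0r ler_pdivlMr ?exprn_gt0 // -natrX -natrM ler_nat; apply: hn.
Qed.

End Lower.

(** * The lower Mertens bound *)

(** The hypothesis of [pow_perturb] for a box of side A m enlarged by 2 C (m + 1), the margin of
    [sharp_count] at t = m + 1; it dictates A. *)
Lemma sharp_slack (e C m A0 : nat) : (0 < m)%N ->
  (4 * e * (2 * (C * m.+1)) <= (16 * C * e + A0 + 1) * m)%N.
Proof.
move=> m0; have : (C * e * m.+1 <= C * e * (2 * m))%N.
  by rewrite leq_mul2l; apply/orP; right; lia.
by rewrite !mulnDl; lia.
Qed.

Section MertensLower.
Variable E : splittingFieldType rat.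
Implicit Types (x y : E) (g h : gal_of {:E}).
Variables (H : {group gal_of {:E}}) (b : E).
Hypothesis b_int : is_alg_int b.
Hypothesis bH : forall g, (g b == b) = (g \in H).
Variable R : realType.

Local Notation N := #|{: gal_of {:E}}|.
Local Notation d := #|[set: gal_of {:E}] : H|%g.
Local Notation box := (box H).
Local Notation bel := (bel b).
Local Notation lnn := (lnn R).

Lemma bel_fixed D (v : box D) h : h \in H -> h (bel v) = bel v.
Proof.
rewrite -bH => /eqP hb; rewrite /bel /el rmorph_sum; apply: eq_bigr => i _.
by rewrite rmorphM rmorph_int rmorphXn /= hb.
Qed.

Lemma logn_le_pow l e M : prime l -> (0 < M)%N -> (e <= logn l M)%N -> (l ^ e <= M)%N.
Proof. by move=> lp M0 le; apply: dvdn_leq => //; rewrite pfactor_dvdn. Qed.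

(** The condition on [al] reflects the size of l: a sharp count when l < t^d with t small against D,
    a count up to the factor C for other l up to (C2 D)^d, and any al >= 0 beyond, where l^#|H|
    exceeds the norms and no conjugate has residue 0. *)
Lemma prime_norm_contribution (B : nat) : (0 < B)%N ->
  exists u C2 C C3 : nat, forall (D : nat), (0 < D)%N ->
  let x (v : box D) := (1 + B * (u * D))%N%:R + B%:R * bel v in
  [/\ forall v, is_alg_int (x v), forall v, (D ^ N <= nm (x v))%N,
      forall v, (nm (x v) <= (C2 * D) ^ N)%N,
      forall v l, prime l -> (l %| B)%N -> logn l (nm (x v)) = 0%N &
   forall (l : nat) s (al : R), prime l -> ~~ (l %| B)%N -> good_at l s -> 0 <= al ->
   ((l <= (C2 * D) ^ d)%N -> (exists2 t, (l < t ^ d)%N & ((D + 2 * (C3 * t)) ^ d)%N%:R <= al * (D ^ d)%:R)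
       \/ C%:R <= al) ->
   (\sum_(v : box D) logn l (nm (x v)))%N%:R <=
    (D ^ d)%:R * ((fixed_count b s)%:R * (al / l%:R) + 3 * (N * C)%:R / l%:R ^+ 2)].
Proof.
move=> B0; have [u [C2 shift]] := shift_norm H b_int B0.
have [C0 C00 sparse] := sparse_count H b_int.
have [C3 sharp] := sharp_count b_int bH.
pose C := (((1 + C2) * (2 * C0)) ^ d)%N.
exists u, C2, C, C3 => D D0 x; have d0 := d_gt0 H; have H0 := cardG_gt0 H.
have xP v := shift D v D0; rewrite /= -/(x _) in xP.
have x_int v : is_alg_int (x v) by have [] := xP v.
have x_n0 v : x v != 0 by have [] := xP v.
have x_up v : (nm (x v) <= (C2 * D) ^ N)%N by have [] := xP v.
have x_nm v : (0 < nm (x v))%N := nm_gt0 (x_int v) (x_n0 v).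
have BE : (B%:R : E) != 0 by rewrite natrE_eq0 -lt0n.
have x_inj v w : v != w -> x v != x w.
  move=> vw; rewrite /x (inj_eq (addrI _)) (inj_eq (mulfI BE)) (inj_eq (@bel_inj _ _ _ bH D)) //.
split=> //.
- by move=> v; have [] := xP v.
- move=> v l lp lB; have [_ _ _ _ cop] := xP v.
  rewrite logn_coprime // prime_coprime //; apply: contraL cop => lx.
  rewrite /coprime; apply/negP => /eqP g1.
  have : (l %| gcdn (nm (x v)) B)%N by rewrite dvdn_gcd lx lB.
  by rewrite g1 dvdn1 gtn_eqF ?prime_gt1.
move=> l s al lp lB [l_unr [k [rho [rhoP sP]]]] al0 hal.
have [val [val0 valB valN]] := valuation_exists rhoP l_unr.
pose f v g := val (g (x v)).
rewrite (eq_bigr (fun v => \sum_(g : gal_of {:E}) f v g)%N); last by move=> v _; apply: valN; [apply: x_int|apply: x_n0].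
have xH v : {in H, forall h, h (x v) = x v}.
  by move=> h hH; rewrite /x rmorphD rmorphM !rmorph_nat /= bel_fixed.
(* The shift cancels in x v - x w = B (bel v - bel w), and B is prime to l, so the exponent of l
   passes to differences of box elements and [sparse_count] applies. *)
have sp (X : {set box D}) (q : nat) : (0 < q)%N -> 
    {in X, forall v, (q ^ #|H| <= nm (x v))%N} ->
    {in X &, forall v w, v != w -> exists2 e, (q ^ #|H| = l ^ e)%N & (e <= logn l (nm (x v - x w)))%N} ->
    (#|X| * q <= C * D ^ d)%N.
  move=> q0 hX1 hX2; case: (set_0Vmem X) => [->|[v0 v0X]]; first by rewrite cards0.
  apply: (sparse _ _ C2) => [v w vX wX vw|]; last first.
    rewrite -(leq_exp2r _ _ H0) -expnM [(d * _)%N]mulnC -N_eq.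
    exact: leq_trans (hX1 _ v0X) (x_up _).
  have [e -> le] := hX2 v w vX wX vw; apply: logn_le_pow => //.
    apply: nm_gt0; first by apply: alg_intB; apply: bel_int.
    by rewrite subr_eq0 (inj_eq (@bel_inj _ _ _ bH D)).
  have xB : x v - x w = B%:R * (bel v - bel w).
    by rewrite /x mulrBr opprD addrACA subrr add0r.
  have dn0 : bel v - bel w != 0 by rewrite subr_eq0 (inj_eq (@bel_inj _ _ _ bH D)).
  have d_int : is_alg_int (bel v - bel w) by apply: alg_intB; apply: bel_int.
  have B_int := alg_int_nat E B.
  rewrite xB nmM // lognM ?nm_gt0 // in le.
  have lB0 : logn l (nm (B%:R : E)) = 0%N.
    rewrite valN // big1 // => g _; rewrite rmorph_nat; apply/eqP.
    by rewrite -leqn0 leqNgt val0 // (residue_nat_eq0 rhoP).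
  by rewrite lB0 in le.
have zP v w : v != w -> [/\ is_alg_int (x v - x w), x v - x w != 0 &
    {in H, forall h, h (x v - x w) = x v - x w}].
  move=> vw; split; [exact: alg_intB|by rewrite subr_eq0 x_inj|].
  by move=> h hH; rewrite rmorphB /= !xH.
have gx_int v g : is_alg_int (g (x v)) by apply: alg_int_gal.
have gx_n0 v g : g (x v) != 0 by rewrite gal_eq0 x_n0.
have valz j v w g : v != w -> (j <= f v g)%N -> (j <= f w g)%N -> (j <= val (g (x v - x w)%R))%N.
  move=> vw jv jw; rewrite rmorphB /=; apply: valB => //; try exact: gx_n0.
  by rewrite (inj_eq (@gal_inj E g)) x_inj.
have hk j g : (0 < j)%N -> (#|[set v | (j <= f v g)%N]| * l ^ j <= C * D ^ d)%N.
  move=> j0; apply: sp => [||v w]; first by rewrite expn_gt0 prime_gt0.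
    move=> v; rewrite inE => jv; rewrite -expnM; apply: (logn_le_pow lp (x_nm v)).
    apply: leq_trans (val_norm valN g (x_int v) (x_n0 v) (xH v)).
    by rewrite leq_mul2r jv orbT.
  rewrite !inE => jv jw vw; exists (j * #|H|)%N; first by rewrite expnM.
  have [z_int z0 zH] := zP v w vw.
  apply: leq_trans (val_norm valN g z_int z0 zH).
  by rewrite leq_mul2r valz ?orbT.
apply: (@prime_contribution E H b R l s D ((C2 * D) ^ N)%N C al f) => //; first exact: prime_gt1.
- move=> v g; apply: leq_trans (x_up v).
  apply: leq_trans (_ : logn l (nm (x v)) <= _)%N; last first.
    by apply/ltnW/ltn_logl/x_nm.
  by rewrite (valN _ (x_int v) (x_n0 v)) (bigD1 g) //= leq_addr.
- move=> g sg; apply: sp => [||v w]; first by rewrite expn_gt0 prime_gt0.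
    move=> v; rewrite inE => jv; rewrite -expnM; apply: (logn_le_pow lp (x_nm v)).
    exact: (val_norm2 bH rhoP sP val0 valN (x_int v) (x_n0 v) (xH v) sg jv).
  rewrite !inE => jv jw vw; exists (2 * #|H|)%N; first by rewrite expnM.
  have [z_int z0 zH] := zP v w vw.
  apply: (val_norm2 bH rhoP sP val0 valN z_int z0 zH sg).
  exact: valz.
move=> g sg; set X := [set v | _].
case: (leqP l ((C2 * D) ^ d)) => [lC|lC]; last first.
  have -> : X = set0.
    apply/setP => v; rewrite !inE; apply/negP => v1.
    have := val_norm valN g (x_int v) (x_n0 v) (xH v).
    rewrite -/(f v g) => le.
    have : (l ^ #|H| <= nm (x v))%N.
      apply: (logn_le_pow lp (x_nm v)).
      by apply: leq_trans le; rewrite -[X in (X <= _)%N]mul1n leq_mul2r v1 orbT.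
    move=> h; have := leq_trans h (x_up v).
    by rewrite (N_eq H) [(#|H| * _)%N]mulnC expnM leq_exp2r // leqNgt lC.
  by rewrite cards0 mulr_ge0.
case: (hal lC) => [[t lt le]|Cal]; last first.
  have := hk 1%N g isT; rewrite expn1 -/X -(ler_nat R) => /le_trans; apply.
  by rewrite natrM ler_wpM2r.
apply: le_trans le; rewrite ler_nat.
have -> : X = [set v | rho (g (x v)) == 0].
  by apply/setP => v; rewrite !inE /f (val0 _ (gx_int v g) (gx_n0 v g)).
exact: sharp rhoP sP lB sg lt.
Qed.

(** Two evaluations of the sum of ln (nm (x v)) over the box: at least n N ln D thanks to the shift,
    at most the sum of the contributions of the primes. [A0] lets the caller enlarge A to make the
    error in the upper bound small. *)
Lemma mertens_lower (B : nat) (s : nat -> gal_of {:E}) : (0 < B)%N ->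
  (forall l, prime l -> ~~ (l %| B)%N -> good_at l (s l)) ->
  forall A0, exists A (K : R), [/\ (A0 <= A)%N, (0 < A)%N & forall m, (0 < m)%N ->
   N%:R * lnn (A * m) <=
    4 / 3 * (\sum_(0 <= l < (m ^ d).+1 | prime l && ~~ (l %| B)%N)
      (fixed_count b (s l))%:R * (lnn l / l%:R)) + K].
Proof.
move=> B0 hs A0; have [u [C2 [C [C3 hD]]]] := prime_norm_contribution B0.
have d0 := d_gt0 H.
(* A comes from [sharp_slack]. As (C2 D)^d = J m^d <= 2^J m^d, the primes needing the crude count
   end up in the range of [chebyshev_range]. *)
pose A := (16 * C3 * d + A0 + 1)%N; pose J := ((C2 * A) ^ d)%N.
exists A, ((N * C)%:R * ((2 * J)%:R * lnn 2) + 3 * (N * C)%:R * (4 * lnn 2)).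
split; [rewrite /A; lia|rewrite /A; lia|move=> m m0].
pose D := (A * m)%N; have D0 : (0 < D)%N by rewrite muln_gt0 m0 andbT /A; lia.
pose x (v : box D) : E := (1 + B * (u * D))%N%:R + B%:R * bel v.
have [x_int0 x_low0 x_up0 x_bad0 x_good0] := hD D D0.
have x_low v : (D ^ N <= nm (x v))%N := x_low0 v.
have x_up v : (nm (x v) <= (C2 * D) ^ N)%N := x_up0 v.
have x_bad v l : prime l -> (l %| B)%N -> logn l (nm (x v)) = 0%N := x_bad0 v l.
clear x_int0 x_low0 x_up0 x_bad0.
pose n := (D ^ d)%N; have n0 : 0 < (n%:R : R) by rewrite ltr0n expn_gt0 D0.
have md0 : (0 < m ^ d)%N by rewrite expn_gt0 m0.
pose Y := (2 ^ J * m ^ d)%N.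
have CY : ((C2 * D) ^ d <= Y)%N.
  by rewrite /D mulnA expnMn -/J leq_mul2r ltnW ?orbT // ltn_expl.
have mY : (m ^ d <= Y)%N by rewrite leq_pmull // expn_gt0.
(* X is at least every norm, hence every prime dividing one. *)
pose X := maxn (2 ^ ((C2 * D) ^ N)) Y.
pose X' := (2 ^ X)%N; have XX' : (X < X')%N by rewrite ltn_expl.
(* T1 covers the primes up to m^d, with al = 4/3; T2 those from there to Y, with al = C; T3 the
   terms in 1 / l^2, present for all l. *)
pose T1 l : R := if (l < (m ^ d).+1)%N && ~~ (l %| B)%N then
   4 / 3 * ((fixed_count b (s l))%:R * (lnn l / l%:R)) else 0.
pose T2 l : R := if ((m ^ d).+1 <= l)%N && (l < Y.+1)%N then (N * C)%:R * (lnn l / l%:R) else 0.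
pose T3 l : R := 3 * (N * C)%:R * (lnn l / l%:R ^+ 2).
have T30 l : 0 <= T3 l by rewrite mulr_ge0 // mulr_ge0 ?lnn_ge0 // invr_ge0 exprn_ge0.
have q0 l : 0 <= lnn l / l%:R by rewrite mulr_ge0 ?lnn_ge0 ?invr_ge0.
have T10 l : 0 <= T1 l by rewrite /T1; case: ifP => // _; rewrite !mulr_ge0 ?lnn_ge0 ?invr_ge0.
have T20 l : 0 <= T2 l by rewrite /T2; case: ifP => // _; rewrite !mulr_ge0 ?lnn_ge0 ?invr_ge0.
have per l : prime l -> \sum_(v : box D) (logn l (nm (x v)))%:R * lnn l <= n%:R * (T1 l + T2 l + T3 l).
  move=> lp; rewrite -mulr_suml -natr_sum.
  case: (boolP (l %| B)%N) => lB.
    by rewrite big1 ?mul0r ?mulr_ge0 ?addr_ge0 // => v _; rewrite x_bad.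
  pose al : R := if (l < (m ^ d).+1)%N then 4 / 3 else if (l < Y.+1)%N then C%:R else 0.
  have al0 : 0 <= al by rewrite /al; case: ifP => _; [exact: divr_ge0|case: ifP].
  have := x_good0 l (s l) al lp lB (hs l lp lB) al0.
  have cond : (l <= (C2 * D) ^ d)%N -> (exists2 t, (l < t ^ d)%N & ((D + 2 * (C3 * t)) ^ d)%N%:R <= al * (D ^ d)%:R)
       \/ C%:R <= al.
    move=> lC; rewrite /al; case: ifP => lm.
      left; exists m.+1; first by apply: leq_trans lm _; rewrite ltn_exp2r.
      have := @pow_perturb d D (2 * (C3 * m.+1)); rewrite -/n => pw.
      have {}pw : (3 * (D + 2 * (C3 * m.+1)) ^ d <= 4 * n)%N.
        by apply: pw; rewrite /D /A; apply: sharp_slack.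
      by rewrite -/n mulrAC ler_pdivlMr // mulrC -!natrM ler_nat.
    by right; rewrite ltnS (leq_trans lC CY).
  move=> /(_ cond); rewrite (eq_bigr (fun v => logn l (nm (x v)))) // => h.
  apply: le_trans (ler_wpM2r (lnn_ge0 R l) h) _.
  rewrite -[leLHS]mulrA; apply: ler_wpM2l; first exact: ltW.
  rewrite mulrDl; apply: lerD; last first.
    by rewrite /T3 -!mulrA; rewrite [_^-1 * _]mulrC.
  have -> : (fixed_count b (s l))%:R * (al / l%:R) * lnn l = al * ((fixed_count b (s l))%:R * (lnn l / l%:R)).
    by move: (fixed_count _ _)%:R (lnn l) (l%:R^-1) => a1 a2 a3; ring.
  rewrite /al /T1 /T2 lB andbT [((m ^ d).+1 <= l)%N]leqNgt; case: ifP => lm; first by rewrite /= addr0.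
  rewrite add0r /=; case: ifP => _; last by rewrite mul0r.
  rewrite mulrA -natrM ler_wpM2r // ler_nat mulnC leq_mul2r fixed_count_le orbT.
  by [].
have low : n%:R * (N%:R * lnn D) <= \sum_(v : box D) lnn (nm (x v)).
  rewrite [leLHS]mulr_natl /n -(card_box H D) -sumr_const; apply: ler_sum => v _.
  by rewrite -lnnX //; apply/le_lnn/x_low.
have nm0 v : (0 < nm (x v))%N by apply: leq_trans (x_low v); rewrite expn_gt0 D0.
have step : \sum_(v : box D) lnn (nm (x v)) <= n%:R * \sum_(0 <= l < X.+1 | prime l) (T1 l + T2 l + T3 l).
  rewrite mulr_sumr.
  rewrite (eq_bigr (fun v => \sum_(0 <= l < X.+1 | prime l) (logn l (nm (x v)))%:R * lnn l)); last first.
    move=> v _; apply: lnn_prime_sum => //; apply: leq_trans (x_up v) _.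
    by rewrite (leq_trans _ (leq_maxl _ _)) // ltnW // ltn_expl.
  by rewrite exchange_big /=; apply: ler_sum => l lp; apply: per.
have := le_trans low step; rewrite ler_pM2l // => {low step} le.
apply: le_trans le _; rewrite !big_split /= -addrA; apply: lerD; last apply: lerD.
- rewrite /T1 -big_mkcondr mulr_sumr.
  rewrite [leRHS](@big_nat_widen _ _ _ _ _ X.+1); last first.
    by rewrite ltnS (leq_trans mY) // leq_maxr.
  rewrite le_eqVlt; apply/orP; left; apply/eqP; apply: eq_bigl => l.
  by rewrite [X in prime l && X]andbC andbA.
- rewrite /T2 -big_mkcondr.
  apply: le_trans (ler_wpM2l _ (chebyshev_range R J md0)) => //.
  rewrite mulr_sumr -/Y.
  rewrite [leRHS](@big_nat_widen _ _ _ _ _ X.+1); last by rewrite ltnS leq_maxr.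
  rewrite [leRHS](@big_nat_widenl _ _ _ _ 0%N) //=.
  rewrite le_eqVlt; apply/orP; left; apply/eqP; apply: eq_bigl => l.
  by rewrite -andbA [X in _ && X]andbC.
rewrite /T3 -mulr_sumr; apply: ler_wpM2l; first by rewrite mulr_ge0.
apply: (le_trans _ (sum_lnn_sq R X)).
rewrite big_mkcond /= -/X' [leRHS](@big_cat_nat _ _ _ X.+1) //=.
apply: ler_wpDr; first by apply: sumr_ge0 => l _; rewrite mulr_ge0 ?lnn_ge0 // invr_ge0 exprn_ge0.
by apply: ler_sum => l _; case: ifP => // _; rewrite mulr_ge0 ?lnn_ge0 // invr_ge0 exprn_ge0.
Qed.

End MertensLower.

(** * Existence of Frobenius elements *)

Section FrobeniusExists.
Variable E : splittingFieldType rat.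
Implicit Types (x y : E) (g h : gal_of {:E}).

Local Notation N := #|{: gal_of {:E}}|.
Local Notation R := Rdefinitions.R.

Lemma fixed_count_conj (H : {group gal_of {:E}}) b s : (forall g, (g b == b) = (g \in H)) ->
  fixed_count b s = #|[set g | (g * s * g^-1)%g \in H]|.
Proof.
move=> bH; congr #|pred_of_set _|; apply/setP => g; rewrite !inE -bH !galMf.
by rewrite -[in RHS](inj_eq (@gal_inj E g)) galKV.
Qed.

Theorem frobenius_exists (ga : gal_of {:E}) (p B0 : nat) :
  prime p -> (p %| #[ga]%g)%N -> (0 < B0)%N ->
  exists (l j : nat) (k : fieldType) (rho : E -> k),
    [/\ prime l, ~~ (l %| B0)%N & ~~ (p %| j)%N] /\
    [/\ power_congruent E l, is_residue_map l rho & is_frobenius l rho (ga ^+ j)%g].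
Proof.
move=> pp pga B00; apply: contrapT => none.
have [B1 B10 hB] := places_exist E.
pose B := (B1 * B0)%N; have B_gt0 : (0 < B)%N by rewrite muln_gt0 B10.
have goodB l : prime l -> ~~ (l %| B)%N -> ~~ (l %| B1)%N /\ ~~ (l %| B0)%N.
  by move=> lp; rewrite Euclid_dvdM // negb_or => /andP[].
have [s sP] : exists s : nat -> gal_of {:E}, forall l, prime l -> ~~ (l %| B)%N -> good_at l (s l).
  suff h : forall l, exists s : gal_of {:E}, prime l -> ~~ (l %| B)%N -> good_at l s.
    by have [s sP] := choice h; exists s.
  move=> l; case: (boolP (prime l && ~~ (l %| B)%N)) => [/andP[lp lB]|nl]; last first.
    by exists 1%g => lp lB; move: nl; rewrite lp lB.
  have [lB1 _] := goodB l lp lB.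
  have [l_unr [k [rho [s [rhoP sP]]]]] := hB l lp lB1.
  by exists s => _ _; split=> //; exists k, rho.
pose H := <[ga]>%G; pose H1 := <[(ga ^+ p)%g]>%G.
have [b b_int bH] := stabilizer_generator H.
have [b1 b1_int b1H] := stabilizer_generator H1.
have H1H : H1 \subset H by rewrite cycle_subG mem_cycle.
have cardH : (#|H| = p * #|H1|)%N.
  by rewrite -[#|H1|]/(#[(ga ^+ p)%g]%g) orderXdiv // mulnC divnK.
(* If g s g^-1 = [ga ^+ j] with p not dividing j, the place moved by g contradicts [none]. So p
   divides j, and the power lies in H1. *)
have fcE l : prime l -> ~~ (l %| B)%N -> fixed_count b (s l) = fixed_count b1 (s l).
  move=> lp lB; rewrite (fixed_count_conj _ bH) (fixed_count_conj _ b1H).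
  congr #|pred_of_set _|; apply/setP => g; rewrite !inE.
  apply/idP/idP => [|/(subsetP H1H)//].
  case/cycleP => j jE.
  case: (boolP (p %| j)%N) => [/dvdnP[q qE]|pj].
    by rewrite jE qE mulnC expgM mem_cycle.
  have [lB1 lB0] := goodB l lp lB.
  have [l_unr [k [rho [rhoP rs]]]] := sP l lp lB.
  case: none; exists l, j, k, (fun x => rho (g x)); split=> //; split=> //.
    exact: residue_map_gal.
  by rewrite -jE; apply: frobenius_gal.
set d := #|[set: gal_of {:E}] : H|%g.
have d0 : (0 < d)%N := d_gt0 H.
have d1E : (#|[set: gal_of {:E}] : H1|%g = p * d)%N.
  have := N_eq H1; rewrite (N_eq H) -/d cardH -mulnA => /eqP.
  by rewrite [(p * _)%N]mulnCA eqn_pmul2l ?cardG_gt0 // => /eqP.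
have [A [K [A0 Agt0 low]]] := mertens_lower b_int bH R B_gt0 sP (8 * p * d)%N.
have [C C0 up] := mertens_upper b1_int b1H R.
have N0 : 0 < (N%:R : R) by rewrite ltr0n N_gt0.
have p2 : 2 <= (p%:R : R) by rewrite ler_nat prime_gt1.
have key (M : nat) : (0 < M)%N -> N%:R * lnn R M <= 4 * N%:R * lnn R C + 3 * K.
  (* With A m = D^p, the box of side A m in dimension d for H and the box of side D in dimension p d
     for H1 have the same cardinality. *)
  move=> M0; pose m := (A ^ p.-1 * M ^ p)%N; pose D := (A * M)%N.
  have m0 : (0 < m)%N by rewrite muln_gt0 !expn_gt0 Agt0 M0.
  have D0 : (0 < D)%N by rewrite muln_gt0 Agt0.
  have AmD : (A * m = D ^ p)%N.
    by rewrite mulnA -expnS prednK ?prime_gt0 // -expnMn.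
  have := low m m0; rewrite AmD lnnX // => lo.
  have := up D (m ^ d)%N (fun l => prime l && ~~ (l %| B)%N) s D0.
  rewrite d1E expnM -AmD.
  have hP l : prime l && ~~ (l %| B)%N -> prime l /\ good_at l (s l).
    by case/andP => lp lB; split=> //; apply: sP.
  move=> /(_ hP) hi.
  rewrite (eq_bigr (fun l => (fixed_count b (s l))%:R * (lnn R l / l%:R))) in hi; last first.
    by move=> l /andP[lp lB]; rewrite fcE.
  set S := \sum_(0 <= l < _ | _) _ in lo hi.
  have md0 : (0 < m ^ d)%N by rewrite expn_gt0 m0.
  (* Since m <= D^p, ln (m^d) <= p d ln D; and A^d >= A >= 8 p d makes the diagonal term at most a
     quarter of ln D. *)
  have err : (m ^ d).+1%:R * lnn R (m ^ d) / ((A * m) ^ d)%:R <= 4^-1 * lnn R D.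
    have mdR : 0 < ((m ^ d)%:R : R) by rewrite ltr0n.
    have AmR : 0 < (((A * m) ^ d)%N%:R : R) by rewrite ltr0n AmD !expn_gt0 D0.
    rewrite ler_pdivrMr //.
    apply: (@le_trans _ _ ((2 * m ^ d)%:R * ((d * p)%:R * lnn R D))).
      apply: ler_pM; rewrite ?lnn_ge0 ?ler_nat //; first by rewrite mul2n -addnn -[X in (X <= _)%N]addn1 leq_add2l.
      rewrite lnnX // natrM -mulrA ler_wpM2l // -lnnX // -AmD.
      by apply: le_lnn; rewrite leq_pmull.
    rewrite expnMn [(A ^ d * _)%N]mulnC !natrM.
    have h : 8 * (p%:R * d%:R) <= (A ^ d)%:R :> R.
      rewrite -!natrM ler_nat mulnA; apply: leq_trans A0 _.
      by rewrite -[X in (X <= _)%N]expn1 leq_pexp2l.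
    have L0 : 0 <= lnn R D := lnn_ge0 R D.
    have := ler_wpM2r L0 h => {}h.
    have := ler_wpM2l (ltW mdR) h.
    move: (m ^ d)%:R (A ^ d)%:R (lnn R D) (p%:R : R) (d%:R : R); clear.
    move=> a1 a2 a3 a4 a5; lra.
  have lnCD : lnn R (C * D) = lnn R C + lnn R D by rewrite lnnM.
  have lnDM : lnn R M <= lnn R D by apply: le_lnn; rewrite leq_pmull.
  rewrite lnCD in hi.
  have hi' : S <= N%:R * (lnn R C + lnn R D) + N%:R * (4^-1 * lnn R D).
    apply: le_trans hi _; rewrite lerD2l -!mulrA; apply: ler_wpM2l; first exact: ltW.
    by rewrite mulrA.
  (* 2 on the left against 4/3 * 5/4 = 5/3 on the right: a third of N ln D is bounded by a
     constant. *)
  have lo' : 2 * (N%:R * lnn R D) <= 4 / 3 * S + K.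
    apply: le_trans lo; rewrite [leRHS]mulrCA.
    by apply: ler_wpM2r => //; rewrite mulr_ge0 ?lnn_ge0 // ltW.
  have := ler_wpM2l (ltW N0) lnDM.
  move: hi' lo'; rewrite !mulrDr.
  move: (N%:R : R) (lnn R C) (lnn R D) (lnn R M) (S) (K); clear=> n1 n2 n3 n4 S K.
  have -> : n1 * (4^-1 * n3) = 4^-1 * (n1 * n3) by ring.
  have -> : 4 * n1 * n2 = 4 * (n1 * n2) by ring.
  move: (n1 * n2) (n1 * n3) (n1 * n4) => c1 c2 c3; lra.
set Q := (4 * N%:R * lnn R C + 3 * K) in key.
have Q0 : 0 <= Q by apply: le_trans (key 1%N isT); rewrite mulr_ge0 ?lnn_ge0 // ltW.
pose t := Num.bound (Q / (N%:R * lnn R 2)).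
have NL : 0 < N%:R * lnn R 2 by rewrite mulr_gt0 ?lnn2_gt0.
have := archi_boundP (divr_ge0 Q0 (ltW NL)); rewrite -/t ltr_pdivrMr //.
have := key (2 ^ t)%N; rewrite expn_gt0 => /(_ isT); rewrite lnnX // mulrCA => h1 h2.
by have := le_lt_trans h1 h2; rewrite ltxx.
Qed.

End FrobeniusExists.

(** * Prime ideals of intermediate fields *)

Section Primes.
Variable E : splittingFieldType rat.
Implicit Types (x y : E) (g h : gal_of {:E}) (M F K : {subfield E}).

Lemma Oint_int M (z : int) : Oint M (z%:~R : E).
Proof. by split; [apply: rpred_int|apply: alg_int_int]. Qed.

Lemma Oint_nat M (n : nat) : Oint M (n%:R : E).
Proof. exact: (Oint_int M n). Qed.

Lemma Oint1 M : Oint M (1 : E).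
Proof. exact: (Oint_nat M 1). Qed.

Lemma Oint0 M : Oint M (0 : E).
Proof. exact: (Oint_nat M 0). Qed.

Lemma OintD M x y : Oint M x -> Oint M y -> Oint M (x + y).
Proof. by move=> [xM hx] [yM hy]; split; [apply: rpredD|apply: alg_intD]. Qed.

Lemma OintB M x y : Oint M x -> Oint M y -> Oint M (x - y).
Proof. by move=> [xM hx] [yM hy]; split; [apply: rpredB|apply: alg_intB]. Qed.

Lemma OintM M x y : Oint M x -> Oint M y -> Oint M (x * y).
Proof. by move=> [xM hx] [yM hy]; split; [apply: rpredM|apply: alg_intM]. Qed.

Lemma OintX M x n : Oint M x -> Oint M (x ^+ n).
Proof. by move=> [xM hx]; split; [apply: rpredX|apply: alg_intX]. Qed.

Lemma Oint_sum M (I : Type) (r : seq I) (P : pred I) (f : I -> E) :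
  (forall i, Oint M (f i)) -> Oint M (\sum_(i <- r | P i) f i).
Proof. by move=> hf; apply: (big_ind _ (Oint0 M) (@OintD M)) => i _. Qed.

Lemma Oint_prod M (I : Type) (r : seq I) (P : pred I) (f : I -> E) :
  (forall i, Oint M (f i)) -> Oint M (\prod_(i <- r | P i) f i).
Proof. by move=> hf; apply: (big_ind _ (Oint1 M) (@OintM M)) => i _. Qed.

Lemma OintS F M x : (F <= M)%VS -> Oint F x -> Oint M x.
Proof. by move=> /subvP FM [xF hx]; split=> //; apply: FM. Qed.

Definition residue_ideal (M : {subfield E}) (k : fieldType) (rho : E -> k) (x : E) : Prop :=
  Oint M x /\ rho x = 0.

Section AtPlace.
Variables (l : nat) (k : fieldType) (rho : E -> k).
Hypothesis rhoP : is_residue_map l rho.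

Lemma residue_ideal_prime M : prime_ideal M (residue_ideal M rho).
Proof.
split; first by move=> x [].
split; first by split; [apply: Oint0|apply: residue0 rhoP].
split; first by move=> x y [Ox rx] [Oy ry]; split; [apply: OintD|
  case: Ox Oy => _ hx [_ hy]; rewrite (residueD rhoP) // rx ry addr0].
split; first by move=> a x Oa [Ox rx]; split; [apply: OintM|
  case: Oa Ox => _ ha [_ hx]; rewrite (residueM rhoP) // rx mulr0].
split; first by move=> [_]; rewrite (residue1 rhoP) => /eqP; rewrite oner_eq0.
split; last first.
  exists l%:R; split; first split; first exact: Oint_nat.
    by apply/eqP; rewrite (residue_nat_eq0 rhoP).
  by rewrite natrE_eq0 -lt0n prime_gt0 // (residue_prime rhoP).
move=> x y Ox Oy [_ /eqP]; have [_ hx] := Ox; have [_ hy] := Oy.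
by rewrite (residueM rhoP) // mulf_eq0 => /orP[] /eqP r0; [left|right].
Qed.

Lemma residue_ideal_nat M (n : nat) : residue_ideal M rho n%:R <-> (l %| n)%N.
Proof.
rewrite -(residue_nat_eq0 rhoP); split=> [[_ ->]|/eqP r0]; first by rewrite eqxx.
by split=> //; apply: Oint_nat.
Qed.

Lemma prime_ideal_prod M (P : E -> Prop) (I : Type) (r : seq I) (f : I -> E) :
  prime_ideal M P -> (forall i, Oint M (f i)) -> (forall i, ~ P (f i)) ->
  ~ P (\prod_(i <- r) f i).
Proof.
move=> [_ [_ [_ [_ [P1 [PM _]]]]]] hf nf; elim: r => [|i r IH]; first by rewrite big_nil.
by rewrite big_cons => /(PM _ _ (hf i) (Oint_prod _ _ hf))[/nf|/IH].
Qed.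

(** The multiplier of [residue_unramified] again, now with the quotient in O_M, so that it applies
    to an arbitrary prime ideal of O_M above l. *)
Lemma power_congruent_sub M x : power_congruent E l -> Oint M x ->
  exists2 q, (0 < q)%N & exists2 y, Oint M y & (1 - x ^+ q) * x = l%:R * y.
Proof.
move=> unr [xM hx]; have [y hy yE] := unr x hx.
set q := (l ^ _)%N in yE.
have q1 : (1 < q)%N.
  rewrite -[1%N](exp1n #|{: gal_of {:E}}|) ltn_exp2r ?prime_gt1 ?(residue_prime rhoP) //.
  by apply/card_gt0P; exists 1%g.
have l0 : (l%:R : E) != 0 by rewrite natrE_eq0 -lt0n prime_gt0 // (residue_prime rhoP).
exists q.-1; first by rewrite -ltnS prednK // ltnW.
exists (- y).
  split; last exact: alg_intN.
  rewrite rpredN; have -> : y = (l%:R)^-1 * (x ^+ q - x) by rewrite yE mulKf.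
  by apply: rpredM; [rewrite rpredV rpred_nat|rewrite rpredB // rpredX].
by rewrite mulrBl mul1r -exprSr prednK ?(ltnW q1) // mulrN -yE opprB.
Qed.

(** If l were a sum of a_i b_i with factors in P, let w be the product of multipliers outside P
    making each a_i and b_i divisible by l. Then w l is in l^2 O_M, so w is in l O_M, inside P,
    against primality. *)
Lemma unramified_residue M F : power_congruent E l -> unramified M F (residue_ideal F rho).
Proof.
move=> unr P Ppr PF; have [PO [P0 [PD [PM [P1 [PP _]]]]]] := Ppr.
have lF : residue_ideal F rho l%:R by apply/residue_ideal_nat.
exists l%:R; split=> //.
have Pl : P l%:R by apply/PF => //; apply: Oint_nat.
have l0 : (l%:R : E) != 0 by rewrite natrE_eq0 -lt0n prime_gt0 // (residue_prime rhoP).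
have kill a : P a -> exists u, [/\ Oint M u, ~ P u & exists2 y, Oint M y & u * a = l%:R * y].
  move=> Pa; have Oa := PO a Pa.
  have [q q0 [y Oy yE]] := power_congruent_sub unr Oa.
  exists (1 - a ^+ q); split; [|move=> Pu|by exists y].
    by apply: OintB; [apply: Oint1|apply: OintX].
  apply: P1; rewrite -[1](subrK (a ^+ q)); apply: PD => //.
  rewrite -(prednK q0) exprSr; apply: PM => //; exact: OintX.
move=> [n [a [b [ab lE]]]].
have [u uP] := fin_all_exists (fun i => kill _ (proj1 (ab i))).
have [v vP] := fin_all_exists (fun i => kill _ (proj2 (ab i))).
pose w := \prod_i (u i * v i).
have Ow : Oint M w.
  by apply: Oint_prod => i; apply: OintM; [have [] := uP i|have [] := vP i].
have nPw : ~ P w.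
  apply: (prime_ideal_prod Ppr) => i; first by apply: OintM; [have [] := uP i|have [] := vP i].
  have [Ou nu _] := uP i; have [Ov nv _] := vP i.
  by case/(PP _ _ Ou Ov).
have wa i : exists y, Oint M y /\ w * (a i * b i) = l%:R ^+ 2 * y.
  have [Ou _ [y Oy yE]] := uP i; have [Ov _ [z Oz zE]] := vP i.
  exists (\prod_(j | j != i) (u j * v j) * (y * z)); split.
    apply: OintM; last exact: OintM.
    by apply: Oint_prod => j; apply: OintM; [have [] := uP j|have [] := vP j].
  rewrite /w (bigD1 i) //=; move: (\prod_(j | _) _) => t.
  have -> : u i * v i * t * (a i * b i) = t * ((u i * a i) * (v i * b i)) by ring.
  by rewrite yE zE; ring.
have [y yP] := fin_all_exists wa.
have wl : w = l%:R * \sum_i y i.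
  apply: (mulfI l0); transitivity (\sum_i w * (a i * b i)).
    by rewrite -mulr_sumr -lE mulrC.
  rewrite mulrA -expr2 mulr_sumr.
  by apply: eq_bigr => i _; have [] := yP i.
apply: nPw; rewrite wl mulrC; apply: PM => //.
by apply: Oint_sum => i; have [] := yP i.
Qed.

(** The l^n combinations with coefficients in {0, ..., l - 1} have distinct residues, all roots of
    X^(l^r) - X. *)
Lemma indep_mod_bound M F (P : E -> Prop) n (v : 'I_n -> E) (th : E -> k) (r : nat) :
  (0 < r)%N -> is_residue_map l th -> (forall x, Oint M x -> th x ^+ (l ^ r)%N = th x) ->
  (forall x, P x <-> Oint M x /\ th x = 0) ->
  indep_mod M F P (residue_ideal F rho) v -> (n <= r)%N.
Proof.
move=> r0 thP thr PE [Ov ind]; have lp := residue_prime rhoP.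
pose f (c : {ffun 'I_n -> 'I_l}) := th (\sum_i (c i : nat)%:R * v i).
have Oc (c : 'I_n -> int) : Oint M (\sum_i (c i)%:~R * v i).
  by apply: Oint_sum => i; apply: OintM => //; apply: Oint_int.
have f_inj : injective f.
  move=> c c' fc; apply/ffunP => i.
  have h : P (\sum_i ((c i : nat)%:Z - (c' i : nat)%:Z)%:~R * v i).
    apply/PE; split; first exact: Oc.
    rewrite (eq_bigr (fun i => (c i : nat)%:R * v i - (c' i : nat)%:R * v i)); last first.
      by move=> j _; rewrite -mulrBl intrB.
    have [_ h1] := Oc (fun i => (c i : nat)%:Z); have [_ h2] := Oc (fun i => (c' i : nat)%:Z).
    by rewrite sumrB (residueB thP) // -/(f c) -/(f c') fc subrr.
  have [_ /eqP] := ind _ (fun i => Oint_int F _) h i.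
  rewrite (residue_int_eq0 rhoP) => dv; apply: val_inj => /=.
  have := ltn_ord (c i); have := ltn_ord (c' i).
  move: dv; move: (c i : nat) (c' i : nat) => a a' dv a'l al.
  case: (posnP `|a%:Z - a'%:Z|%N) => [|pos]; first by lia.
  by have := dvdn_leq pos dv; lia.
have q1 : (1 < l ^ r)%N by rewrite -[1%N](exp1n r) ltn_exp2r ?prime_gt1.
rewrite -(@leq_exp2l l) ?prime_gt1 //.
pose rs := [seq f c | c : {ffun 'I_n -> 'I_l}].
have -> : (l ^ n)%N = size rs by rewrite size_image card_ffun !card_ord.
have sX : size ('X^(l ^ r) - 'X : {poly k}) = (l ^ r).+1.
  by rewrite size_polyDl ?size_polyXn // size_polyN size_polyX.
rewrite -ltnS -sX; apply: max_poly_roots.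
- by rewrite -size_poly_eq0 sX.
- apply/allP => _ /imageP[c _ ->]; rewrite /root !hornerE thr ?subrr //.
  exact: (Oc (fun i => (c i : nat)%:Z)).
by rewrite map_inj_uniq ?enum_uniq.
Qed.

End AtPlace.
End Primes.

(** * Embeddings and inert primes *)

Section Embeddings.
Variable E : splittingFieldType rat.
Implicit Types (x y : E) (g h : gal_of {:E}).
Variables (F K : {subfield E}) (p : nat) (phi : 'I_p -> 'End(E)).
Hypothesis FK : (F <= K)%VS.
Hypothesis phiP : enumerates_embeddings F K phi.

Lemma gal_kHom_sub g : g \in 'Gal({:E} / F)%g -> kHom F K g.
Proof.
rewrite gal_kHom ?subvf // => hg; apply: kHomSr hg; exact: subvf.
Qed.

Lemma embedding_gal i : exists2 g, g \in 'Gal({:E} / F)%g & forall x, x \in K -> phi i x = g x.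
Proof.
have [kh _ _] := phiP.
have [|g gF gE] := kHom_to_gal (K := F) (M := K) (E := {:E}%AS) _ (normalFieldf F) (kh i).
  by rewrite FK subvf.
by exists g.
Qed.

Lemma embedding_inj i j : (forall x, x \in K -> phi i x = phi j x) -> i = j.
Proof.
have [_ sep _] := phiP => ij; apply/eqP; apply: contraT => /sep[x xK].
by rewrite ij // eqxx.
Qed.

Lemma embedding_act g : g \in 'Gal({:E} / F)%g ->
  exists c : {perm 'I_p}, forall i x, x \in K -> g (phi i x) = phi (c i) x.
Proof.
move=> gF; have [_ _ all_phi] := phiP.
have ex i : exists j, forall x, x \in K -> g (phi i x) = phi j x.
  have [h hF hE] := embedding_gal i.
  have [j jE] := all_phi _ (gal_kHom_sub (groupM hF gF)).
  by exists j => x xK; rewrite hE // -jE // galMf.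
have [c cE] := fin_all_exists ex.
have c_inj : injective c.
  move=> i j ij; apply: embedding_inj => x xK; apply: (@gal_inj E g).
  by rewrite !cE // ij.
by exists (perm c_inj) => i x xK; rewrite permE cE.
Qed.

Lemma embedding_act_iter g (c : {perm 'I_p}) m :
  (forall i x, x \in K -> g (phi i x) = phi (c i) x) ->
  forall i x, x \in K -> (g ^+ m)%g (phi i x) = phi ((c ^+ m)%g i) x.
Proof.
move=> gc; elim: m => [|m IH] i x xK; first by rewrite !expg0 gal_id perm1.
by rewrite !expgS galMf permM gc // IH.
Qed.

Lemma embedding_id : exists i, forall x, x \in K -> phi i x = x.
Proof.
have [_ _ all_phi] := phiP; have [i iE] := all_phi _ (kHom1 F K).
by exists i => x xK; rewrite -iE // id_lfunE.
Qed.

Lemma embedding_generator :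
  exists2 b, Oint K b & forall i j, phi i b = phi j b -> i = j.
Proof.
have sep : separable F K.
  by apply/separableP => y _; apply: pcharf0_separable (char0_E E) _.
have KE := eq_adjoin_separable_generator sep FK.
set b0 := separable_generator _ _ in KE.
have b0K : b0 \in K by rewrite KE memv_adjoin.
have [c c0 cb] := alg_int_scale b0.
have cn0 : (c%:R : E) != 0 by rewrite natrE_eq0 -lt0n.
exists (c%:R * b0); first by split=> //; apply: rpredM; rewrite ?rpred_nat.
move=> i j; have [g gF gE] := embedding_gal i; have [h hF hE] := embedding_gal j.
have cbK : c%:R * b0 \in K by apply: rpredM; rewrite ?rpred_nat.
rewrite gE // hE // !rmorphM !rmorph_nat => /(mulfI cn0) gh.
apply: embedding_inj => x xK; rewrite gE // hE //.
move: xK; rewrite KE => /Fadjoin_polyP[q qF ->].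
rewrite -!horner_map /= gh; congr (_.[_]).
by rewrite !(fixedPoly_gal (subvf F)).
Qed.

Lemma embedding_norm x : Oint K x -> Oint F (\prod_i phi i x).
Proof.
move=> [xK hx]; split; last first.
  apply: alg_int_prod => i; have [g _ gE] := embedding_gal i.
  by rewrite gE //; apply: alg_int_gal.
have /galois_fixedField <- := galois1f F.
apply/(fixedFieldP (memvf _)) => g gF; have [c cE] := embedding_act gF.
rewrite rmorph_prod [RHS](reindex_inj (@perm_inj _ c)) /=.
by apply: eq_bigr => i _; rewrite cE.
Qed.

(** * Places whose Frobenius element permutes the embeddings of K transitively *)

Section Inert.
Variables (l : nat) (k : fieldType) (rho : E -> k) (s : gal_of {:E}) (c : {perm 'I_p}).
Hypothesis rhoP : is_residue_map l rho.
Hypothesis sP : is_frobenius l rho s.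
Hypothesis unr : power_congruent E l.
Hypothesis p_gt0 : (0 < p)%N.
Hypothesis sc : forall i x, x \in K -> s (phi i x) = phi (c i) x.
Hypothesis c_trans : forall i j, exists m, (c ^+ m)%g i = j.
Hypothesis c_p : (c ^+ p = 1)%g.

Lemma phi_int i x : Oint K x -> is_alg_int (phi i x).
Proof.
by move=> [xK hx]; have [g _ ->] := embedding_gal i => //; apply: alg_int_gal.
Qed.

(** The residue of phi (c i) x is the l-th power of that of phi i x, and the powers of c are
    transitive. *)
Lemma residue_all i j x : Oint K x -> rho (phi i x) = 0 -> rho (phi j x) = 0.
Proof.
move=> Ox ri; have [m <-] := c_trans i j; elim: m => [|m IH]; first by rewrite expg0 perm1.
rewrite expgSr permM -sc; last by case: Ox.
by rewrite sP ?IH ?expr0n ?gtn_eqF ?prime_gt0 ?(residue_prime rhoP) //; apply: phi_int.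
Qed.

(* If [x] is in [P], its relative norm is in [F] and in [P], hence some conjugate of [x] has residue 0;
   all of them do since the Frobenius element permutes them transitively. *)
Lemma inert_prime_unique P i : prime_ideal K P -> lies_over F P (residue_ideal F rho) ->
  forall x, P x <-> Oint K x /\ rho (phi i x) = 0.
Proof.
move=> Ppr PF; have [PO [P0 [PD [PM [P1 [PP _]]]]]] := Ppr.
have dir x : P x -> rho (phi i x) = 0.
  move=> Px; have Ox := PO x Px; have [xK hx] := Ox.
  have [i0 i0E] := embedding_id.
  have Py : P (\prod_i phi i x).
    have [->|x0] := eqVneq x 0.
      by rewrite (bigD1 i0) //= i0E ?rpred0 // mul0r.
    rewrite (bigD1 i0) //= i0E // mulrC; apply: PM => //; split.
      have [yF _] := embedding_norm Ox.
      have -> : \prod_(j | j != i0) phi j x = (\prod_j phi j x) / x.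
        by rewrite [in RHS](bigD1 i0) //= i0E // mulrC mulKf.
      by rewrite rpredM ?rpredV // (subvP FK).
    by apply: alg_int_prod => j; apply: phi_int.
  have [_] := (PF _ (embedding_norm Ox)).1 Py.
  rewrite (residue_prod rhoP); last by move=> j; apply: phi_int.
  by move=> /eqP/prodf_eq0[j _ /eqP rj]; apply: residue_all rj.
move=> x; split=> [Px|[Ox rx]]; first by split; [apply: PO|apply: dir].
have [q q0 [y Oy yE]] := power_congruent_sub rhoP unr Ox.
have Pl : P l%:R by apply/PF; [apply: Oint_nat|apply/(residue_ideal_nat rhoP)].
have Ou : Oint K (1 - x ^+ q) by apply: OintB; [apply: Oint1|apply: OintX].
have : P ((1 - x ^+ q) * x) by rewrite yE mulrC; apply: PM.
case/(PP _ _ Ou Ox) => // /dir; have [g _ gE] := embedding_gal i.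
have [xK hx] := Ox; have [uK _] := Ou.
rewrite gE // rmorphB rmorph1 rmorphXn /= -gE // (residueB rhoP); first last.
- by apply: alg_intX; apply: phi_int.
- exact: alg_int1.
rewrite (residue1 rhoP) (residueX rhoP) ?rx; last exact: phi_int.
by rewrite expr0n gtn_eqF // subr0 => /eqP; rewrite oner_eq0.
Qed.

Lemma inert_residue_prime i : exists P, [/\ prime_ideal K P,
  lies_over F P (residue_ideal F rho) & forall x, P x <-> Oint K x /\ rho (phi i x) = 0].
Proof.
have [g gF gE] := embedding_gal i.
exists (residue_ideal K (fun x => rho (g x))); split.
- exact: residue_ideal_prime (residue_map_gal rhoP g) _.
- move=> x Ox; have OKx := OintS FK Ox; have [xF _] := Ox.
  have gx : g x = x by apply: fixed_gal gF xF; apply: subvf.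
  by split=> -[_ rx]; split=> //; [rewrite -gx|rewrite gx].
by move=> x; split=> -[[xK hx] rx]; split=> //; move: rx; rewrite gE.
Qed.

(** At most p: the p-th power of the Frobenius element fixes the image of K, so residues satisfy
    z^(l^p) = z. At least p: a relation among 1, b, ..., b^(p-1) modulo P gives a nonzero polynomial
    of degree less than p with the p distinct roots rho (phi i b). *)
Lemma inert_degree P b : Oint K b -> (forall i j, rho (phi i b) = rho (phi j b) -> i = j) ->
  prime_ideal K P -> lies_over F P (residue_ideal F rho) ->
  inertia_deg K F P (residue_ideal F rho) p.
Proof.
move=> Ob b_sep Ppr PF.
pose i0 : 'I_p := Ordinal p_gt0.
have PE := inert_prime_unique i0 Ppr PF.
have [g gF gE] := embedding_gal i0.
split; last first.
  move=> n v; apply: (indep_mod_bound rhoP (th := fun x => rho (g x))) => //.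
  - exact: residue_map_gal.
  - move=> x Ox; have [xK hx] := Ox; rewrite -gE // -(frobenius_iter _ sP); last exact: phi_int.
    by rewrite (embedding_act_iter _ sc) // c_p perm1.
  by move=> x; rewrite PE; split=> -[[xK hx] rx]; split=> //; move: rx; rewrite gE.
exists (fun j : 'I_p => b ^+ j); split; first by move=> j; apply: OintX.
move=> d Od Pd j; split=> //.
have OFK := fun j => OintS FK (Od j).
have OS : Oint K (\sum_(j < p) d j * b ^+ j).
  by apply: Oint_sum => j'; apply: OintM => //; apply: OintX.
pose Q : {poly k} := \poly_(j < p) (if insub j is Some j' then rho (d j') else 0).
have Qj (j' : 'I_p) : Q`_j' = rho (d j').
  by rewrite coef_poly ltn_ord insubT ?ltn_ord //= => lt; congr (rho (d _)); apply: val_inj.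
suff Q0 : Q = 0 by rewrite -Qj Q0 coef0.
apply/eqP; apply: contraT => Qn0.
pose rs := [seq rho (phi i b) | i : 'I_p].
have : (size rs < size Q)%N.
  apply: max_poly_roots Qn0 _ _; last first.
    by rewrite map_inj_uniq ?enum_uniq // => i j'; apply: b_sep.
  apply/allP => _ /imageP[i _ ->]; apply/rootP.
  have [_ r0] := (PE _).1 Pd; have := residue_all i OS r0.
  have [h hF hE] := embedding_gal i.
  have [SK _] := OS; have [bK b_int] := Ob.
  rewrite hE // rmorph_sum (residue_sum rhoP); last first.
    move=> j'; apply: alg_int_gal; apply: alg_intM; first by have [] := Od j'.
    exact: alg_intX.
  rewrite (@horner_coef_wide _ p) ?size_poly // => e; rewrite -[RHS]e.
  apply: eq_bigr => j' _; have [dF d_int] := Od j'.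
  rewrite rmorphM rmorphXn /= (fixed_gal (subvf F) hF dF) (residueM rhoP) //; last first.
    exact/alg_intX/alg_int_gal.
  by rewrite (residueX rhoP) ?Qj ?hE //; apply: alg_int_gal.
by rewrite size_image card_ord ltnNge size_poly.
Qed.

Lemma inert_gcd b : Oint K b -> (forall i j, rho (phi i b) = rho (phi j b) -> i = j) ->
  is_gcd_of (in_splitting_type K F (residue_ideal F rho)) p.
Proof.
move=> Ob b_sep; split=> [f [P [Ppr PF [[v vi] fmax]]]|f hf].
  have [[w wi] pmax] := inert_degree Ob b_sep Ppr PF.
  suff -> : f = p by [].
  by apply/eqP; rewrite eqn_leq (pmax _ _ vi) (fmax _ _ wi).
have [P [Ppr PF _]] := inert_residue_prime (Ordinal p_gt0).
by apply: hf; exists P; split=> //; apply: (inert_degree Ob b_sep).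
Qed.

End Inert.
End Embeddings.

(** The Frobenius element fixes L, so residues of O_L satisfy z^l = z and lie in the prime field. *)
Lemma split_degree_one (E : splittingFieldType rat) (F L : {subfield E}) (l : nat)
    (k : fieldType) (rho : E -> k) (s : gal_of {:E}) :
  (F <= L)%VS -> is_residue_map l rho -> is_frobenius l rho s -> s \in 'Gal({:E} / L)%g ->
  in_splitting_type L F (residue_ideal F rho) 1.
Proof.
move=> FL rhoP sP sL; exists (residue_ideal L rho); split.
- exact: residue_ideal_prime rhoP _.
- by move=> x Ox; split=> -[_ rx]; split=> //; apply: OintS Ox.
split; last first.
  move=> n v; apply: (indep_mod_bound rhoP (th := rho)) => // x [xL hx].
  by rewrite expn1 -sP // (fixed_gal (subvf L) sL xL).
exists (fun _ => 1); split; first by move=> _; apply: Oint1.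
move=> c Oc [_ rc] j; split=> //; move: rc.
by rewrite big_ord_recl big_ord0 addr0 mulr1 [j]ord1.
Qed.

(** * Permutations and the main theorem *)

Lemma binom_gt n a : (2 <= a)%N -> (a + 2 <= n)%N -> (n < 'C(n, a))%N.
Proof.
elim: n a => [|n IH] a a2 an; first by lia.
case: (leqP (a + 2) n) => [le|gt].
  case: a a2 an le => // a a2 an le; rewrite binS.
  have := IH a.+1 a2 le; have : (0 < 'C(n, a))%N by rewrite bin_gt0; lia.
  lia.
have -> : a = (n.+1 - 2)%N by lia.
rewrite bin_sub; last by lia.
rewrite bin2 /=; have n3 : (3 <= n)%N by lia.
rewrite geq_half_double -mul2n.
have := leq_mul (leqnn n.+1) n3; lia.
Qed.

Lemma perm_set_map (T : finType) (A B : {set T}) : #|A| = #|B| ->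
  exists s : {perm T}, s @: A = B.
Proof.
move=> cAB.
pose sA := enum A ++ enum (~: A); pose sB := enum B ++ enum (~: B).
have memA (C : {set T}) x : x \in enum C ++ enum (~: C).
  by rewrite mem_cat !mem_enum inE orbN.
have uA (C : {set T}) : uniq (enum C ++ enum (~: C)).
  rewrite cat_uniq !enum_uniq andbT /=; apply/hasPn => x.
  by rewrite !mem_enum inE.
have szs : size sA = size sB.
  by rewrite !size_cat -!cardE !cardsC.
pose f x := nth x sB (index x sA).
have f_inj : injective f.
  move=> x y; rewrite /f (set_nth_default x y) -?szs ?index_mem ?memA // => /eqP.
  rewrite nth_uniq -?szs ?index_mem ?memA ?uA // => /eqP e.
  by rewrite -(nth_index x (memA A x)) -/sA e nth_index ?memA.
exists (perm f_inj); apply/eqP; rewrite eqEcard card_imset ?cAB ?leqnn ?andbT; last exact: perm_inj.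
apply/subsetP => _ /imsetP[x xA ->]; rewrite permE /f /sA index_cat mem_enum xA.
have lt : (index x (enum A) < size (enum B))%N by rewrite -cardE -cAB cardE index_mem mem_enum.
by rewrite nth_cat lt -mem_enum mem_nth.
Qed.

(** An odd s is corrected by a transposition of two points of A, which preserves A. *)
Lemma alt_set_map (T : finType) (A B : {set T}) : #|A| = #|B| -> (1 < #|A|)%N ->
  exists2 s : {perm T}, s \in Alt T & s @: A = B.
Proof.
move=> /perm_set_map[s sAB] /card_gt1P[x [y [xA yA xy]]].
case: (boolP (odd_perm s)) => os; last by exists s; rewrite ?Alt_even.
exists (tperm x y * s)%g.
  by rewrite Alt_even odd_permM odd_tperm xy os.
rewrite -sAB -[in RHS](_ : tperm x y @: A = A).
  by rewrite -imset_comp; apply: eq_imset => z; rewrite /= permM.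
apply/eqP; rewrite eqEcard card_imset ?leqnn ?andbT; last exact: perm_inj.
by apply/subsetP => _ /imsetP[z zA ->]; case: tpermP.
Qed.

Lemma perm_prime_transitive p (s : {perm 'I_p}) : prime p -> #[s]%g = p ->
  forall i j, exists m, (s ^+ m)%g i = j.
Proof.
move=> pp os.
have [i1 i1P] : exists i, s i != i.
  apply/existsP; rewrite -negb_forall; apply: contraTN pp => /forallP h.
  by rewrite -os (_ : s = 1%g) ?order1 //; apply/permP => i; rewrite perm1; apply/eqP.
have : (#|porbit s i1| %| #[s]%g)%N by rewrite porbitE; apply: (dvdn_orbit (perm_action _) <[s]>%G).
rewrite os.
case/primeP: (pp) => _ h /h /orP[/cards1P[z zE]|/eqP full].
  have := mem_porbit s 1 i1; have := porbit_id s i1; rewrite zE expg1 !inE => /eqP <-.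
  by rewrite (negPf i1P).
have all_i i : i \in porbit s i1.
  suff -> : porbit s i1 = setT by [].
  by apply/eqP; rewrite eqEcard subsetT cardsT card_ord full leqnn.
move=> i j; have : j \in porbit s i.
  by have := all_i i; rewrite -eq_porbit_mem => /eqP ->.
by case/porbitP => m ->; exists m.
Qed.

(** * Orbits of Gal(E / L) on the embeddings of K *)

Section Main.
Variable E : splittingFieldType rat.
Variables (F K L : {subfield E}) (p : nat).
Hypothesis pp : prime p.
Hypotheses (FK : (F <= K)%VS) (FL : (F <= L)%VS).
Hypotheses (dimK : \dim_F K = p) (dimL : \dim_F L = p).
Hypothesis gcdKL : locally_gcd_equivalent F K L.
Variable phi : 'I_p -> 'End(E).
Hypothesis phiP : enumerates_embeddings F K phi.

Lemma residue_zero_norm (l : nat) (k : fieldType) (rho : E -> k) x :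
  is_residue_map l rho -> is_alg_int x -> rho x = 0 -> (l %| nm x)%N.
Proof.
move=> rhoP hx rx; rewrite -(residue_nat_eq0 rhoP) nmE // /Nm (bigD1 1%g) //= gal_id.
rewrite mulrCA (residueM rhoP) // ?rx ?mul0r //.
apply: alg_intM; first by apply/alg_intX/alg_intN/alg_int1.
by apply: alg_int_prod => g; apply: alg_int_gal.
Qed.

Lemma no_p_cycle_fixing (ga : gal_of {:E}) (c : {perm 'I_p}) :
  ga \in 'Gal({:E} / L)%g -> (forall i x, x \in K -> ga (phi i x) = phi (c i) x) ->
  #[c]%g <> p.
Proof.
move=> gaL gac oc; have p0 := prime_gt0 pp.
have [b Ob b_sep] := embedding_generator FK phiP.
have phi_i i x := phi_int FK phiP i (x := x).
(* Avoiding the divisors of B0 keeps the conjugates of b distinct modulo l, as [inert_gcd]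
   requires. *)
pose B0 := (\prod_(q : 'I_p * 'I_p | q.1 != q.2) nm (phi q.1 b - phi q.2 b))%N.
have B00 : (0 < B0)%N.
  apply: prodn_cond_gt0 => q q12; apply: nm_gt0; first by apply: alg_intB; apply: phi_i.
  by rewrite subr_eq0; apply: contra q12 => /eqP/b_sep->.
have pga : (p %| #[ga]%g)%N.
  rewrite -oc order_dvdn; apply/eqP/permP => i; rewrite perm1.
  apply: (embedding_inj phiP) => x xK.
  by rewrite -(embedding_act_iter _ gac) // expg_order gal_id.
have [l [j [k [rho [[lp lB pj] [unr rhoP sP]]]]]] := frobenius_exists pp pga B00.
have r_sep i i' : rho (phi i b) = rho (phi i' b) -> i = i'.
  move=> e; apply/eqP; apply: contraNT lB => ii'.
  apply: (@dvdn_trans (nm (phi i b - phi i' b))); last first.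
    by rewrite /B0 (bigD1 (i, i')) //= dvdn_mulr.
  apply: (residue_zero_norm rhoP); first by apply: alg_intB; apply: phi_i.
  by rewrite (residueB rhoP) ?e ?subrr //; apply: phi_i.
have cp1 : (c ^+ p = 1)%g by have := expg_order c; rewrite oc.
have c_p : ((c ^+ j) ^+ p = 1)%g by rewrite -expgM mulnC expgM cp1 expg1n.
have c_trans : forall i i', exists m, ((c ^+ j) ^+ m)%g i = i'.
  apply: perm_prime_transitive => //.
  have : (#[c ^+ j]%g %| p)%N by rewrite order_dvdn c_p.
  case/primeP: (pp) => _ h /h /orP[|/eqP //].
  by rewrite order_eq1 -order_dvdn oc (negPf pj).
have sL : (ga ^+ j)%g \in 'Gal({:E} / L)%g by apply: groupX.
have := inert_gcd FK phiP rhoP sP unr p0 (embedding_act_iter _ gac) c_trans c_p Ob r_sep.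
have /gcdKL -> // : prime_ideal F (residue_ideal F rho) by apply: residue_ideal_prime rhoP _.
- case=> /(_ 1%N (split_degree_one FL rhoP sP sL)) + _.
  by rewrite dvdn1 gtn_eqF ?prime_gt1.
- exact: unramified_residue rhoP _ _ _.
exact: unramified_residue rhoP _ _ _.
Qed.

Lemma card_gal_index : #|'Gal({:E} / F) : 'Gal({:E} / L)|%g = p.
Proof.
have LF : 'Gal({:E} / L)%g \subset 'Gal({:E} / F)%g by apply: galS.
apply/eqP; rewrite -(eqn_pmul2l (cardG_gt0 'Gal({:E} / L)%G)) Lagrange //.
rewrite -(galois_dim (galois1f F)) -(galois_dim (galois1f L)) -dimL.
rewrite -(eqn_pmul2r (adim_gt0 F)) -mulnA -(dim_sup_field FL) -!dim_sup_field ?subvf //.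
Qed.

Theorem F_isomorphic_of_locally_gcd_equivalent (G : {set {perm 'I_p}}) :
  Alt 'I_p \subset G -> galois_closure_group F K phi G -> F_isomorphic F K L.
Proof.
move=> AG Gphi; pose GF := 'Gal({:E} / F)%G; pose HL := 'Gal({:E} / L)%G.
have HLF : HL \subset GF by apply: galS.
have [c cP] : exists c : gal_of {:E} -> {perm 'I_p}, forall g, g \in GF ->
    forall i x, x \in K -> g (phi i x) = phi (c g i) x.
  suff h : forall g, exists s : {perm 'I_p}, g \in GF ->
      forall i x, x \in K -> g (phi i x) = phi (s i) x.
    by have [c cP] := choice h; exists c.
  move=> g; case: (boolP (g \in GF)) => gF; last by exists 1%g.
  by have [s sE] := embedding_act FK phiP gF; exists s.
have c_uniq g (s : {perm 'I_p}) : g \in GF -> (forall i x, x \in K -> g (phi i x) = phi (s i) x) -> c g = s.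
  move=> gF sE; apply/permP => i; apply: (embedding_inj phiP) => x xK.
  by rewrite -cP // sE.
have cM : {in GF &, {morph c : g h / (g * h)%g}}.
  move=> g h gF hF; apply: c_uniq; first exact: groupM.
  by move=> i x xK; rewrite galMf cP // cP // permM.
have c1 : c 1%g = 1%g.
  by apply: c_uniq; rewrite ?group1 // => i x _; rewrite gal_id perm1.
have HF h : h \in HL -> h \in GF by apply: (subsetP HLF).
(* An embedding fixed by Gal(E / L) has its image in L by the Galois correspondence, and the degrees
   agree. *)
have fixed_done i : (forall h, h \in HL -> c h i = i) -> F_isomorphic F K L.
  move=> fix_i; have [kh _ _] := phiP; exists (phi i); split=> //.
  have dims : \dim (phi i @: K) = \dim L.
    by rewrite (kHom_dim (kh i)) (dim_sup_field FK) (dim_sup_field FL) dimK dimL.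
  apply/eqP; rewrite eqEdim dims leqnn andbT.
  apply/subvP => _ /memv_imgP[x xK ->].
  have /galois_fixedField <- := galois1f L.
  apply/(fixedFieldP (memvf _)) => h hL.
  by rewrite cP ?HF // fix_i.
pose i0 : 'I_p := Ordinal (prime_gt0 pp).
pose X := [set c h i0 | h in HL].
have X_stable h : h \in HL -> c h @: X = X.
  move=> hL; apply/eqP; rewrite eqEcard card_imset ?leqnn ?andbT; last exact: perm_inj.
  apply/subsetP => _ /imsetP[_ /imsetP[g gL ->] ->].
  by rewrite -permM -cM ?HF //; apply: imset_f; rewrite groupM.
have i0X : i0 \in X by apply/imsetP; exists 1%g; rewrite ?group1 // c1 perm1.
case: (eqVneq X setT) => [XT|XnT].
  pose C := [set c h | h in HL].
  have gC : group_set C.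
    apply/group_setP; split; first by rewrite -c1; apply: imset_f; rewrite group1.
    move=> _ _ /imsetP[g gL ->] /imsetP[h hL ->].
    by rewrite -cM ?HF //; apply: imset_f; rewrite groupM.
  pose CG := Group gC.
  have : (p %| #|CG|)%N.
    have := dvdn_orbit (perm_action _) CG i0.
    suff -> : orbit (perm_action _) CG i0 = setT by rewrite cardsT card_ord.
    apply/setP => j; rewrite inE; have : j \in X by rewrite XT.
    by case/imsetP => h hL ->; apply: mem_orbit; apply: imset_f.
  case/(Cauchy pp) => s /imsetP[ga gaL ->] oc.
  by case: (no_p_cycle_fixing gaL (cP _ (HF _ gaL)) oc).
have X1 : (0 < #|X|)%N by apply/card_gt0P; exists i0.
have Xp : (#|X| < p)%N by rewrite -[p in X in (_ < X)%N]card_ord -cardsT proper_card // properT.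
have [X1' | X2] := eqVneq #|X| 1%N.
  apply: (fixed_done i0) => h hL; have := X_stable h hL.
  have /cards1P[z zE] : #|X| == 1%N by rewrite X1'.
  have zi : z = i0 by move: i0X; rewrite zE inE => /eqP.
  by rewrite zE zi imset_set1 => /set1_inj.
have [Xp1 | Xp2] := eqVneq #|X| p.-1.
  (* The complement of X is stable as well, so its only point is fixed. *)
  have /cards1P[z zE] : #|~: X| == 1%N.
    by rewrite cardsCs setCK card_ord Xp1 -subn1 subKn // prime_gt0.
  apply: (fixed_done z) => h hL.
  have : c h z \in ~: X.
    rewrite inE -(X_stable h hL) mem_imset; last exact: perm_inj.
    by rewrite -in_setC zE inE.
  by rewrite zE inE => /eqP.
have := @binom_gt p #|X|.
have Xgt1 : (1 < #|X|)%N by rewrite ltn_neqAle eq_sym X2.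
have X2p : (#|X| + 2 <= p)%N by move: #|X| Xp Xp2 => a; clear; lia.
move=> /(_ Xgt1 X2p); rewrite ltnNge => /negP[].
(* The choice made by [repr] is harmless: X is stable under H_L, so all elements of a coset H_L g
   give the same translate. *)
pose fX (A : {set gal_of {:E}}) := c (repr A) @: X.
rewrite -[p in 'C(p, _)]card_ord -card_draws -[X in (_ <= X)%N]card_gal_index.
apply: leq_trans (leq_imset_card fX (mem (rcosets HL GF))).
apply/subset_leq_card/subsetP => B; rewrite inE => /eqP cB.
have [|s sA sB] := @alt_set_map _ X B (esym cB); first exact: Xgt1.
have [g gF gE] := (Gphi s).1 (subsetP AG _ sA).
have cg : c g = s by apply: c_uniq.
apply/imsetP; exists (HL :* g)%g; first by apply/rcosetsP; exists g.
rewrite /fX -sB -cg.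
have /rcosetP[h hL ->] := mem_repr_rcoset HL g.
rewrite (cM h g (HF h hL) gF) -[in LHS](X_stable h hL) -imset_comp.
by apply: eq_imset => z; rewrite /= permM.
Qed.

End Main.

Theorem mainTheorem9 (E : splittingFieldType rat) (F K L : {subfield E}) (p : nat) :
  prime p ->
  (F <= K)%VS -> (F <= L)%VS ->
  \dim_F K = p -> \dim_F L = p ->
  locally_gcd_equivalent F K L ->
  forall G : {set {perm 'I_p}},
  G = Alt 'I_p \/ G = Sym 'I_p ->
  (exists phi : 'I_p -> 'End(E),
     enumerates_embeddings F K phi /\ galois_closure_group F K phi G) ->
  (exists psi : 'I_p -> 'End(E),
     enumerates_embeddings F L psi /\ galois_closure_group F L psi G) ->
  F_isomorphic F K L.
Proof.
move=> pp FK FL dimK dimL gcdKL G GE [phi [phiP Gphi]] _.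
have AG : Alt 'I_p \subset G.
  by case: GE => ->; rewrite ?subxx //; apply: Alt_subset.
exact: (F_isomorphic_of_locally_gcd_equivalent pp FK FL dimK dimL gcdKL phiP AG Gphi).
Qed.
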